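(* Let $\Omega\subset\mathbb{R}^n$ be a domain. To every $u\in SH_1(\Omega)$ one can assign a Radon measure $\mu_1[u]$ on $\Omega$ such that (i) $\mu_1[u]=H_1[u]\,dx$ whenever $u\in C^2(\Omega)$ (and $u\in SH_1(\Omega)$); (ii) if $\{u_j\}\subset SH_1(\Omega)$ is a sequence which converges to $u\in SH_1(\Omega)$ almost everywhere in $\Omega$, then $\mu_1[u_j]\to\mu_1[u]$ weakly as measures.
   Context: The mean curvature operator is $H_1[u]=\operatorname{div}\big(\frac{Du}{\sqrt{1+|Du|^2}}\big)$. A function $u:\Omega\to[-\infty,+\infty)$ is called $H_1$-subharmonic if it is upper semicontinuous, the set $\{u=-\infty\}$ has Lebesgue measure zero, and for every open set $\omega\subset\Omega$ and every $h\in C^2(\overline\omega)$ with $H_1[h]\le 0$ in $\omega$ and $h\ge u$ on $\partial\omega$, one has $h\ge u$ in $\omega$. $SH_1(\Omega)$ denotes the set of all $H_1$-subharmonic functions in $\Omega$. *)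

(* Defs.v *)
From HB Require Import structures.
From mathcomp Require Import all_boot all_order all_algebra.
From mathcomp Require Import all_classical all_reals all_analysis.
Set Implicit Arguments. Unset Strict Implicit. Unset Printing Implicit Defensive.
Import Order.TTheory GRing.Theory Num.Theory.
Import numFieldNormedType.Exports.
Local Open Scope classical_set_scope.
Local Open Scope ring_scope.

Section Defs.
Variables (R : realType) (n : nat).

Definition borelRn : Type := g_sigma_algebraType (@open 'rV[R]_n).

Definition coord (x : 'rV[R]_n) (i : 'I_n) : R := x ord0 i.

Definition evec (i : 'I_n) : 'rV[R]_n := delta_mx ord0 i.

Definition pderiv (f : 'rV[R]_n -> R) (i : 'I_n) : 'rV[R]_n -> R :=
  fun x => 'D_(evec i) f x.

(* the mean curvature operator
   H_1[f] = div( Df / sqrt(1 + |Df|^2) ) *)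
Definition H1 (f : 'rV[R]_n -> R) : 'rV[R]_n -> R :=
  fun x => \sum_(i < n)
    pderiv (fun y => pderiv f i y / Num.sqrt (1 + \sum_(k < n) (pderiv f k y) ^+ 2)) i x.

Definition C2_on (O : set 'rV[R]_n) (f : 'rV[R]_n -> R) : Prop :=
  [/\ forall x, O x -> {for x, continuous f},
      forall i x, O x -> derivable f x (evec i) /\ {for x, continuous (pderiv f i)}
    & forall i j x, O x -> derivable (pderiv f i) x (evec j) /\
                          {for x, continuous (pderiv (pderiv f i) j)}].

Definition cont_ext_closure (O : set 'rV[R]_n) (g : 'rV[R]_n -> R) : Prop :=
  exists2 G : 'rV[R]_n -> R, {within closure O, continuous G} &
                             forall x, O x -> G x = g x.

Definition C2_closure (O : set 'rV[R]_n) (h : 'rV[R]_n -> R) : Prop :=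
  [/\ C2_on O h, {within closure O, continuous h},
      forall i, cont_ext_closure O (pderiv h i)
    & forall i j, cont_ext_closure O (pderiv (pderiv h i) j)].

Definition usc_on (O : set 'rV[R]_n) (u : 'rV[R]_n -> \bar R) : Prop :=
  forall x, O x -> forall a : R, (u x < a%:E)%E ->
    exists2 V, nbhs x V & forall y, V y -> O y -> (u y < a%:E)%E.

Definition relcompact_in (w O : set 'rV[R]_n) : Prop :=
  compact (closure w) /\ closure w `<=` O.

Definition SH1 (lam : set borelRn -> \bar R) (O : set 'rV[R]_n)
    (u : 'rV[R]_n -> \bar R) : Prop :=
  [/\ usc_on O u,
      forall x, O x -> u x != +oo%E,
      lam.-negligible ([set x | O x /\ u x = -oo%E] : set borelRn)
    & forall (w : set 'rV[R]_n) (h : 'rV[R]_n -> R),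
        open w -> relcompact_in w O ->
        C2_closure w h ->
        (forall x, w x -> H1 h x <= 0) ->
        (forall x, (closure w `\` w) x -> (u x <= (h x)%:E)%E) ->
        forall x, w x -> (u x <= (h x)%:E)%E].

(* Radon measure on the open set O, represented as a Borel measure on R^n
   carried by O and finite on compact subsets of O *)
Definition radon_on (O : set 'rV[R]_n) (mu : set borelRn -> \bar R) : Prop :=
  mu (~` O) = 0%E /\
  forall K : set 'rV[R]_n, compact K -> K `<=` O -> (mu K < +oo)%E.

Definition Cc (O : set 'rV[R]_n) (phi : 'rV[R]_n -> R) : Prop :=
  continuous phi /\
  exists K : set 'rV[R]_n, [/\ compact K, K `<=` O & forall x, ~ K x -> phi x = 0].

Definition weak_cvg (O : set 'rV[R]_n) (mus : nat -> {measure set borelRn -> \bar R})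
    (mu : {measure set borelRn -> \bar R}) : Prop :=
  forall phi, Cc O phi ->
    (fun j => (\int[mus j]_(x in O) (phi x)%:E)%E) @ \oo -->
      (\int[mu]_(x in O) (phi x)%:E)%E.

(* lam agrees with the volume on all boxes (a, b] : this characterizes the
   Lebesgue measure on the Borel sets of R^n *)
Definition is_lebesgue (lam : set borelRn -> \bar R) : Prop :=
  forall a b : 'rV[R]_n, (forall i, coord a i <= coord b i) ->
    lam [set x | forall i, coord a i < coord x i <= coord b i] =
    (\prod_(i < n) (coord b i - coord a i))%:E.

End Defs.

(* Main.v *)
Require Import Defs.
From HB Require Import structures.
From mathcomp Require Import all_boot all_order all_algebra.
From mathcomp Require Import all_classical all_reals all_analysis measurable_realfun.
From mathcomp Require Import lra ring.
(* Again, because [vector] has its own [coord]. *)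
Require Import Defs.
Set Implicit Arguments.
Unset Strict Implicit.
Unset Printing Implicit Defensive.
Import Order.TTheory GRing.Theory Num.Theory.
Import numFieldNormedType.Exports.
Local Open Scope classical_set_scope.
Local Open Scope ring_scope.

(** Call a C^2 function [s] on [Omega] with [H1 s >= 0] a classical solution, and put
    [I s phi = \int phi H1 s]. Writing [T = D / sqrt (1 + |D|^2)], the bound [|T s| <= 1] controls
    [I s phi] independently of [s]. Testing [H1 s - H1 t] against [eta * psi e (s - t)], with [psi e]
    a bounded increasing function of size [e], and using
    [(D s - D t).(T s - T t) >= |T s - T t|^2] shows: if [s_j - t_j -> 0] almost everywhere then
    [T s_j - T t_j -> 0] in L^2_loc, hence [I s_j phi - I t_j phi -> 0].

    So [s |-> I s phi] is locally Cauchy for the separable pseudometric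
    [d u v = \int |contract u - contract v| dnu], where [nu] is a finite measure equivalent to
    Lebesgue measure: almost everywhere convergence implies [d]-convergence, and fast [d]-convergence
    implies almost everywhere convergence. Dugundji's formula extends it to a [d]-continuous map
    [u |-> ell u phi] on all functions finite almost everywhere, and because the formula averages
    values [I s_k phi] with positive weights, [ell u] is again a positive linear functional; [mu1 u] is
    its Riesz measure. No approximation of a subharmonic function by smooth ones is needed.
    When [u] is C^2, comparison with small paraboloids gives [H1 u >= 0], so [u] is itself a
    classical solution and [mu1 u] has density [H1 u]. *)

(** * Borel sets and Lebesgue measure on R^n *)

(** Almost everywhere convergence is in general not the convergence of a topology, while an
    extension by continuity needs one; hence the detour through [d]. Subharmonic functions may be
    unbounded and may take the value [-oo], and [Omega] may have infinite volume: this is why [d]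
    compares images under [contract] and integrates against a finite measure.

    A subharmonic function is not known here to be a [d]-limit of classical solutions. Where it is
    one, [ell u] is forced to be the limit of the curvature integrals. Elsewhere its value depends
    on the points chosen for the extension; what counts is that it stays linear and positive in the
    test function and varies continuously with [u]. Weak convergence of the measures is exactly
    convergence of these functionals.

    A functional determines integrals of test functions, whereas (i) speaks of every Borel set. For
    [u] of class C^2 the measure is therefore defined directly by its density, and its integrals are
    shown to agree with [ell u], so that (ii) treats both kinds of [u] alike. *)

Section BorelRn.
Context {R : realType} {n : nat}.
Local Notation X := 'rV[R]_n.
Local Notation B := (borelRn R n).

Lemma open_borel (U : set X) : open U -> measurable (U : set B).
Proof. by move=> oU; exact: sub_sigma_algebra. Qed.

Lemma closed_borel (U : set X) : closed U -> measurable (U : set B).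
Proof.
move=> cU; rewrite -[U]setCK; apply: measurableC.
by apply: open_borel; exact: closed_openC.
Qed.

Lemma compact_borel (U : set X) : compact U -> measurable (U : set B).
Proof. move=> cU; apply: closed_borel; exact: compact_closed. Qed.

Lemma continuous_borel (f : X -> R) : continuous f ->
  measurable_fun setT (f : B -> R).
Proof.
move=> cf; apply: (measurability _ (RGenOInfty.measurableE R)).
move=> _ [_ [a ->] <-]; rewrite setTI; apply: open_borel.
by apply: open_comp => // x _; exact: cf.
Qed.

Lemma norm_lt_coord (x : X) (r : R) : 0 < r -> 
  `|x| < r <-> forall i, `|coord x i| < r.
Proof.
move=> r0; rewrite [X in X < _]/Num.norm /= mx_normrE; split => [/bigmax_ltP[_ h] i|h].
  exact: (h (ord0, i)).
by apply/bigmax_ltP; split => // -[i j] _ /=; rewrite (ord1 i); exact: h.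
Qed.

Lemma norm_le_coord (x : X) (r : R) : 0 <= r -> 
  `|x| <= r <-> forall i, `|coord x i| <= r.
Proof.
move=> r0; rewrite [X in X <= _]/Num.norm /= mx_normrE; split => [/bigmax_leP[_ h] i|h].
  exact: (h (ord0, i)).
by apply/bigmax_leP; split => // -[i j] _ /=; rewrite (ord1 i); exact: h.
Qed.

Lemma coord_le_norm (x : X) i : `|coord x i| <= `|x|.
Proof. by move: (lexx `|x|) => /(norm_le_coord _ (normr_ge0 x)); exact. Qed.

Lemma evec_norm (i : 'I_n) : `|evec R i| = 1.
Proof.
apply/eqP; rewrite eq_le; apply/andP; split.
  by apply/norm_le_coord => // j; rewrite /coord /evec mxE eqxx /=; 
    case: (j == i); rewrite ?normr1 ?normr0.
by have := coord_le_norm (evec R i) i; rewrite /coord /evec mxE !eqxx normr1.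
Qed.

Definition box (a b : X) : set X :=
  [set x | forall i, coord a i < coord x i <= coord b i].

Definition boxes : set (set X) :=
  [set A | exists a b, (forall i, coord a i <= coord b i) /\ A = box a b].

Lemma coord_cts i : continuous (fun x : X => coord x i).
Proof. exact: coord_continuous. Qed.

Lemma box_borel a b : measurable (box a b : set B).
Proof.
have -> : box a b = \bigcap_(i in [set: 'I_n])
    ([set x | coord a i < coord x i] `&` [set x | coord x i <= coord b i]).
  apply/seteqP; split => [x h i _|x h i].
    by case/andP: (h i).
  by case: (h i I) => /= -> ->.
apply: fin_bigcap_measurable => // i _; apply: measurableI.
  apply: open_borel; rewrite (_ : mkset _ = (fun x : X => coord x i) @^-1` [set r | coord a i < r])//.
  by apply: open_comp => [x _|]; [exact: coord_cts | exact: open_gt].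
apply: closed_borel; rewrite (_ : mkset _ = (fun x : X => coord x i) @^-1` [set r | r <= coord b i])//.
by apply: closed_comp => [x _|]; [exact: coord_cts | exact: closed_le].
Qed.

Lemma boxes_setI : setI_closed boxes.
Proof.
move=> _ _ [a [b [ab ->]]] [a' [b' [ab' ->]]].
pose m : X := \row_i Num.max (coord a i) (coord a' i).
(* The outer maximum keeps the corners ordered when the two boxes are disjoint; the box from [m] to
   [M] is then empty. *)
pose M : X := \row_i Num.max (coord m i) (Num.min (coord b i) (coord b' i)).
exists m, M; split => [i|].
  by rewrite {2}/coord mxE le_max lexx.
apply/seteqP; split => x /=.
  move=> [h h'] i; move: (h i) (h' i) => /andP[h1 h2] /andP[h3 h4].
  rewrite {1}/coord mxE gt_max h1 h3 /= {2}/coord mxE le_max le_min h2 h4.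
  by rewrite orbT.
move=> h; split=> i; have /andP[] := h i; rewrite /coord !mxE gt_max => /andP[h1 h2];
  rewrite le_max /coord !mxE le_min; rewrite ?h1 ?h2 /= => /orP[|/andP[]//];
  by rewrite leNgt gt_max h1 h2.
Qed.

Lemma rat_approx (x e : R) : 0 < e -> exists q : rat, x - e < ratr q < x.
Proof.
move=> e0; have /rat_in_itvoo[q] : x - e < x by rewrite ltrBlDr ltrDl.
by rewrite in_itv /=; exists q.
Qed.

Lemma rat_approxr (x e : R) : 0 < e -> exists q : rat, x < ratr q < x + e.
Proof.
move=> e0; have /rat_in_itvoo[q] : x < x + e by rewrite ltrDl.
by rewrite in_itv /=; exists q.
Qed.

Lemma openP_ball (U : set X) x : open U -> U x -> 
  exists2 e, 0 < e & forall y, `|y - x| < e -> U y.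
Proof.
move=> oU Ux; have : nbhs x U by exact: open_nbhs_nbhs.
move=> /nbhs_ballP[e /= e0 he]; exists e => // y yx; apply: he.
by rewrite -ball_normE /ball_ /= distrC.
Qed.

(** An open set is the union of the boxes with rational corners that it contains, and there are
    countably many of these. *)
Lemma borel_boxes : @measurable _ B = <<s boxes >>.
Proof.
apply/seteqP; split; last first.
  apply: smallest_sub; first exact: sigma_algebra_measurable.
  by move=> _ [a [b [_ ->]]]; exact: box_borel.
apply: smallest_sub; first exact: smallest_sigma_algebra.
move=> U oU.
pose rbox (p : 'rV[rat]_n * 'rV[rat]_n) : set X :=
  box (map_mx ratr p.1) (map_mx ratr p.2).
pose F (p : 'rV[rat]_n * 'rV[rat]_n) : set X := 
  if pselect ((forall i, p.1 ord0 i <= p.2 ord0 i) /\ rbox p `<=` U) then rbox p else set0.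
have -> : U = \bigcup_p F p.
  apply/seteqP; split => x; last first.
    by case => p _; rewrite /F; case: pselect => [Q /= |//]; exact: Q.2.
  move=> Ux; have [e e0 he] := openP_ball oU Ux.
  have /choice[a ha] : forall i, exists q : rat, coord x i - e < ratr q < coord x i.
    by move=> i; exact: rat_approx.
  have /choice[b hb] : forall i, exists q : rat, coord x i < ratr q < coord x i + e.
    by move=> i; exact: rat_approxr.
  exists (\row_i a i, \row_i b i) => //; rewrite /F; case: pselect => [Q /=|].
    move=> i; rewrite /coord !mxE.
    by case/andP: (ha i) => _ ->; case/andP: (hb i) => /ltW -> _.
  case; split => [i|y hy].
    rewrite /= !mxE -(ler_rat R); case/andP: (ha i) => _ /ltW /le_trans; apply.
    by case/andP: (hb i) => /ltW -> _.
  apply: he; apply/norm_lt_coord => // i; rewrite /coord !mxE.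
  have /andP[] := hy i; rewrite /coord !mxE => h1 h2.
  case/andP: (ha i) => h3 _; case/andP: (hb i) => _ h4; rewrite ltr_norml; apply/andP; split.
    by rewrite ltrBrDl (lt_trans h3).
  by rewrite ltrBlDl (le_lt_trans h2).
apply: (@countable_bigcupT_measurable _ (g_sigma_algebraType boxes) _ F) => //.
move=> p; rewrite /F; case: pselect => [[h sU] /=|_ /=]; last exact: measurable0.
apply: sub_sigma_algebra; exists (map_mx ratr p.1), (map_mx ratr p.2); split => //.
by move=> i; rewrite /coord !mxE ler_rat.
Qed.

End BorelRn.

Section Lebesgue.
Context {R : realType} {n : nat}.
Local Notation X := 'rV[R]_n.
Local Notation B := (borelRn R n).
Variable lam : {measure set B -> \bar R}.
Hypothesis hlam : is_lebesgue lam.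

Definition cube (k : R) : set X := box (\row__ (- k)) (\row__ k).

Lemma cube_lty (k : R) : 0 <= k -> (lam (cube k) < +oo)%E.
Proof.
move=> k0; rewrite hlam ?ltry // => i; rewrite /coord !mxE.
by rewrite (le_trans _ k0) // oppr_le0.
Qed.

Lemma norm_lt_cube (x : X) (k : R) : `|x| < k -> cube k x.
Proof.
move=> xk i; rewrite /coord !mxE.
have := le_lt_trans (coord_le_norm x i) xk.
by rewrite /coord ltr_norml => /andP[-> /ltW ->].
Qed.

Lemma compact_cube (K : set X) : compact K -> exists2 k : R, 0 <= k & K `<=` cube k.
Proof.
move=> /compact_bounded [M [Mr hM]].
exists (`|M| + 2) => [|x Kx]; first by rewrite addr_ge0.
apply: norm_lt_cube; apply: (@le_lt_trans _ _ (`|M| + 1)); last by rewrite ltrD2l ltr1n.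
by apply: hM => //; rewrite (le_lt_trans (ler_norm _)) // ltrDl.
Qed.

Lemma compact_lty (K : set X) : compact K -> (lam K < +oo)%E.
Proof.
move=> cK; have [k k0 Kk] := compact_cube cK.
apply: (@le_lt_trans _ _ (lam (cube k))); last exact: cube_lty.
apply: le_measure => //; rewrite inE; first exact: compact_borel.
exact: box_borel.
Qed.

Lemma shift_cts (t : X) : continuous (fun x : X => x + t).
Proof.
move=> x; have h : id @ x --> x by exact: cvg_id.
exact: (cvgD h (cvg_cst t)).
Qed.

Definition shiftB (t : X) : B -> B := fun x => (x : X) + t.

Lemma translation_borel (t : X) : measurable_fun setT (shiftB t).
Proof.
apply: (@measurability _ _ B B setT (shiftB t) (@open X) erefl).
move=> _ [U oU <-]; rewrite setTI; apply: open_borel.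
by apply: open_comp => // x _; exact: shift_cts.
Qed.

(** The translated measure agrees with [lam] on boxes, which are stable under intersection, generate
    the Borel sets and contain an exhausting sequence of finite measure. *)
Lemma lebesgue_translation (t : X) (A : set B) : measurable A ->
  lam (shiftB t @^-1` A) = lam A.
Proof.
move=> mA; have mt := translation_borel t.
apply/esym/(@measure_unique _ _ B boxes (fun k => cube k%:R) borel_boxes
  boxes_setI _ _ lam (pushforward lam (shiftB t))) => //.
- move=> k; exists (\row__ (- k%:R)), (\row__ k%:R); split => // i.
  by rewrite /coord !mxE (@le_trans _ _ 0) ?oppr_le0.
- apply/seteqP; split => // x _; exists (Num.truncn `|x : X|).+1 => //.
  by apply: norm_lt_cube; exact: truncnS_gt.
- move=> _ [a [b [ab ->]]]; rewrite /pushforward /= hlam //.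
  rewrite (_ : pushforward lam (shiftB t) (box a b) = lam (box (a - t) (b - t))); last first.
    congr (lam _); by apply/seteqP; split => x h i; have := h i; rewrite /coord !mxE ltrBlDr lerBrDr.
  rewrite hlam => [|i]; last by have := ab i; rewrite /coord !mxE lerD2r.
  congr EFin; apply: eq_bigr => i _; rewrite /coord !mxE; ring.
- by move=> k; exact: cube_lty.
Qed.

(** The integral runs over the whole space, so that translation invariance applies; the integrands
    vanish off a compact subset of [O]. *)
Definition J (f : X -> R) : R := \int[lam]_x (f : B -> R) x.

Lemma Cc_bounded (O : set X) f : Cc O f -> exists2 M : R, 0 < M & forall x, `|f x| <= M.
Proof.
move=> [cf [K [cK _ fK]]].
have : compact (f @` K) by apply: continuous_compact => //; exact: continuous_subspaceT.
move=> /compact_bounded [M [Mr hM]]; exists (`|M| + 1) => [|x].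
  by rewrite ltr_wpDl.
have [Kx|Kx] := pselect (K x); last by rewrite fK // normr0 addr_ge0.
by apply: hM; [rewrite (le_lt_trans (ler_norm _)) // ltrDl | exists x].
Qed.

Lemma Cc_integrable (O : set X) f : Cc O f ->
  lam.-integrable setT (EFin \o (f : B -> R)).
Proof.
move=> Of; have [M M0 fM] := Cc_bounded Of; case: Of => cf [K [cK _ fK]].
have mK := compact_borel cK.
have : lam.-integrable K (EFin \o (f : B -> R)).
  apply: measurable_bounded_integrable => //; first exact: compact_lty.
    by apply: measurable_funTS; exact: continuous_borel.
  by exists M; split; [exact: num_real | move=> x Mx y _; apply: le_trans (ltW Mx)].
rewrite integrable_mkcond // (_ : _ \_ K = EFin \o f) //.
apply/funext => x; rewrite /patch; case: ifPn => // /negP xK.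
by rewrite /= fK // => Kx; apply: xK; rewrite inE.
Qed.

Lemma JD (O O' : set X) f g : Cc O f -> Cc O' g -> J (fun x => f x + g x) = J f + J g.
Proof. by move=> Of Og; apply: RintegralD => //; [exact: Cc_integrable Of|exact: Cc_integrable Og]. Qed.

Lemma JB (O O' : set X) f g : Cc O f -> Cc O' g -> J (fun x => f x - g x) = J f - J g.
Proof. by move=> Of Og; apply: RintegralB => //; [exact: Cc_integrable Of|exact: Cc_integrable Og]. Qed.

Lemma JZ (O : set X) f (a : R) : Cc O f -> J (fun x => a * f x) = a * J f.
Proof. by move=> Of; apply: RintegralZl => //; exact: Cc_integrable Of. Qed.

Lemma J_ge0 f : (forall x, 0 <= f x) -> 0 <= J f.
Proof. by move=> f0; exact: Rintegral_ge0. Qed.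

Lemma le_J (O O' : set X) f g : Cc O f -> Cc O' g -> (forall x, f x <= g x) -> J f <= J g.
Proof. by move=> Of Og fg; apply: le_Rintegral => //; [exact: Cc_integrable Of|exact: Cc_integrable Og]. Qed.

Lemma J_norm (O : set X) f : Cc O f -> `|J f| <= J (fun x => `|f x|).
Proof. by move=> Of; apply: le_normr_Rintegral => //; exact: Cc_integrable Of. Qed.

Lemma J_translation (O : set X) f t : Cc O f -> J (fun x => f (x + t)) = J f.
Proof.
move=> Of; rewrite /J /Rintegral; congr fine.
have [cf _] := Of.
transitivity (\int[pushforward lam (shiftB t)]_x (f x)%:E)%E.
  rewrite (@integral_pushforward _ _ _ _ _ (shiftB t)
    (translation_borel t) lam setT (EFin \o f)) //.
    by apply/measurable_EFinP; exact: continuous_borel.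
  apply: (@Cc_integrable setT (fun x => f (x + t))).
  case: Of => _ [K [cK _ fK]]; split.
    move=> x; apply: (@continuous_comp _ _ _ (fun x : X => x + t) f); last exact: cf.
    exact: shift_cts.
  exists ((fun x : X => x - t) @` K); split => //.
    apply: continuous_compact => //; apply: continuous_subspaceT; exact: shift_cts.
  by move=> x Kx; apply: fK => Kxt; apply: Kx; exists (x + t) => //; rewrite addrK.
apply: eq_measure_integral; first exact: translation_borel.
move=> mt A mA _; exact: lebesgue_translation.
Qed.

Lemma J_dct (O O' O'' : set X) (f_ : nat -> X -> R) f g :
  (forall k, Cc O (f_ k)) -> Cc O' f -> Cc O'' g ->
  (forall k x, `|f_ k x| <= g x) ->
  {ae lam, forall x : B, f_ ^~ x @ \oo --> f x} ->
  (fun k => J (f_ k)) @ \oo --> J f.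
Proof.
move=> Of_ Of Og fg ff.
have [] := @dominated_convergence _ B R lam setT measurableT
  (fun k => EFin \o f_ k) (EFin \o f) (EFin \o g).
- by move=> k; apply/measurable_EFinP; apply: continuous_borel; case: (Of_ k).
- by apply/measurable_EFinP; apply: continuous_borel; case: Of.
- by apply: filterS ff => x fx _; apply: cvg_EFin => //; exact: nearW.
- exact: Cc_integrable Og.
- by apply: aeW => x k _; rewrite /= lee_fin.
move=> fi _; rewrite -(@fineK _ (\int[lam]_x (EFin \o f) x)%E).
  by move=> /fine_cvg.
exact: integrable_fin_num.
Qed.

End Lebesgue.

(** * Lipschitz cut-off functions *)

Section Lipschitz.
Context {R : realType} {n : nat}.
Local Notation X := 'rV[R]_n.

Lemma cts_atP (f : X -> R) (x : X) : {for x, continuous f} <->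
  forall e, 0 < e -> exists2 d, 0 < d & forall y, `|y - x| < d -> `|f y - f x| < e.
Proof.
split=> [cf e e0|h].
  move/cvgrPdist_lt : cf => /(_ e e0) /nbhs_ballP[d /= d0 hd].
  exists d => // y yx; rewrite distrC; apply: hd.
  by rewrite -ball_normE /ball_ /= distrC.
apply/(@cvgrPdist_lt _ _ _ (nbhs x) _ f (f x)) => e e0; have [d d0 hd] := h e e0.
apply/nbhs_ballP; exists d => // y; rewrite -ball_normE /ball_ /= => xy.
by rewrite distrC; apply: hd; rewrite distrC.
Qed.

Definition lip (L : R) (f : X -> R) := forall x y, `|f x - f y| <= L * `|x - y|.

Lemma lip_cts L f : lip L f -> continuous f.
Proof.
move=> fL x; apply/cts_atP => e e0; exists (e / (`|L| + 1)) => [|y yx].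
  by rewrite divr_gt0 // ltr_wpDl.
apply: le_lt_trans (fL _ _) _; rewrite ltr_pdivlMr in yx; last by rewrite ltr_wpDl.
apply: le_lt_trans yx; rewrite mulrC ler_wpM2l //.
by rewrite (le_trans (ler_norm _)) // lerDl.
Qed.

Lemma lip_le L L' f : L <= L' -> lip L f -> lip L' f.
Proof. by move=> LL fL x y; apply: le_trans (fL x y) _; rewrite ler_wpM2r. Qed.

Lemma lip_cst c : lip 0 (fun=> c).
Proof. by move=> x y; rewrite subrr normr0 mul0r. Qed.

Lemma lip_min L f g : lip L f -> lip L g -> lip L (fun x => Num.min (f x) (g x)).
Proof.
move=> fL gL x y; have := fL x y; have := gL x y; rewrite !ler_norml => /andP[a b] /andP[c d].
by apply/andP; split; case: (leP (f x) (g x)); case: (leP (f y) (g y)); lra.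
Qed.

Lemma lip_max L f g : lip L f -> lip L g -> lip L (fun x => Num.max (f x) (g x)).
Proof.
move=> fL gL x y; have := fL x y; have := gL x y; rewrite !ler_norml => /andP[a b] /andP[c d].
by apply/andP; split; case: (leP (f x) (g x)); case: (leP (f y) (g y)); lra.
Qed.

Lemma lip_affine L f a b : lip L f -> lip (`|a| * L) (fun x => a * f x + b).
Proof.
move=> fL x y; rewrite opprD addrACA subrr addr0 -mulrBr normrM -mulrA.
by rewrite ler_wpM2l.
Qed.

Lemma lip_norm : lip 1 (fun x : X => `|x|).
Proof. by move=> x y; rewrite mul1r; exact: ler_dist_dist. Qed.

(* Distance to the complement of [O], capped at 1 so that it is finite when [O] is the whole space. *)
Definition depth (O : set X) (x : X) : R :=
  sup [set r | 0 <= r <= 1 /\ forall y, `|y - x| < r -> O y].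

Lemma has_sup_depth (O : set X) (x : X) : has_sup [set r : R | 0 <= r <= 1 /\ forall y : X, `|y - x| < r -> O y].
Proof.
split; last by exists 1 => r [/andP[]].
by exists 0; split; [rewrite lexx ler01 | move=> y; rewrite ltNge normr_ge0].
Qed.

Lemma depth_ge0 O x : 0 <= depth O x.
Proof.
apply: ub_le_sup; first by case: (has_sup_depth O x).
by split; [rewrite lexx ler01 | move=> y; rewrite ltNge normr_ge0].
Qed.

Lemma lt_depth O (x y : X) : `|y - x| < depth O x -> O y.
Proof.
move=> /sup_gt; case; first by case: (has_sup_depth O x).
by move=> r [_ h] /h.
Qed.

Lemma depth_gt0 O (x : X) : open O -> O x -> 0 < depth O x.
Proof.
move=> oO Ox; have [e e0 he] := openP_ball oO Ox.
apply: (@lt_le_trans _ _ (Num.min e 1)); first by rewrite lt_min e0 ltr01.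
apply: ub_le_sup; first by case: (has_sup_depth O x).
split; first by rewrite le_min ltW //= ler01 ge_min lexx orbT.
by move=> y; rewrite lt_min => /andP[yx _]; exact: he.
Qed.

Lemma depth_out O x : ~ O x -> depth O x = 0.
Proof.
move=> Ox; apply/eqP; rewrite eq_le depth_ge0 andbT leNgt; apply/negP => d0.
by apply: Ox; apply: (@lt_depth O x); rewrite subrr normr0.
Qed.

Lemma lip_depth O : lip 1 (depth O).
Proof.
suff h x y : depth O x <= depth O y + `|x - y|.
  move=> x y; rewrite mul1r ler_norml lerBlDl h andbT lerNl opprB lerBlDl.
  by rewrite distrC h.
apply: ge_sup; first by case: (has_sup_depth O x).
move=> r [/andP[r0 r1] hr]; have [rx|rx] := leP r `|x - y|.
  by rewrite (le_trans rx) // lerDr depth_ge0.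
rewrite -lerBlDr; apply: ub_le_sup; first by case: (has_sup_depth O y).
split; first by rewrite subr_ge0 ltW //= lerBlDr (le_trans r1) // lerDl.
move=> z; rewrite ltrBrDr => zy; apply: hr; apply: le_lt_trans zy.
by rewrite -[z - x](subrKA y) (le_trans (ler_normD _ _)) // lerD2l distrC.
Qed.

(** The complement of [K] is open and [f] is zero there, so continuity has to be checked on [K]
    only. Products of a cut-off with a function that is controlled only on [O], such as [H1 s],
    thereby become test functions on the whole space. *)
Lemma Cc_glue (O K : set X) f : compact K -> K `<=` O ->
  (forall x, ~ K x -> f x = 0) -> (forall x, K x -> {for x, continuous f}) -> Cc O f.
Proof.
move=> cK KO fK ctf; split; last by exists K.
move=> x; have [/ctf//|Kx] := pselect (K x).
have oK : open (~` K) by apply: closed_openC; exact: compact_closed.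
have [e e0 he] := openP_ball oK Kx.
apply/cts_atP => r r0; exists e => // y /he Ky.
by rewrite !fK // subrr normr0.
Qed.

Lemma Cc_mul (O : set X) f g : open O -> Cc O f ->
  (forall x, O x -> {for x, continuous g}) -> Cc O (fun x => f x * g x).
Proof.
move=> oO [cf [K [cK KO fK]]] cg; apply: (Cc_glue cK KO) => [x Kx|x Kx].
  by rewrite fK // mul0r.
by apply: continuousM; [exact: cf | apply: cg; exact: KO].
Qed.

Lemma CcD (O : set X) f g : Cc O f -> Cc O g -> Cc O (fun x => f x + g x).
Proof.
move=> [cf [K [cK KO fK]]] [cg [K' [cK' KO' fK']]]; split.
  by move=> x; apply: continuousD; [exact: cf | exact: cg].
exists (K `|` K'); split; [exact: compactU | by move=> x [/KO|/KO'] |].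
by move=> x /not_orP[Kx Kx']; rewrite fK // fK' // addr0.
Qed.

Lemma CcZ (O : set X) (a : R) f : Cc O f -> Cc O (fun x => a * f x).
Proof.
move=> [cf [K [cK KO fK]]]; split.
  by move=> x; apply: continuousM; [exact: cst_continuous | exact: cf].
by exists K; split => // x Kx; rewrite fK // mulr0.
Qed.

Lemma Cc_comp (O : set X) (F : R -> R) f : continuous F -> F 0 = 0 -> Cc O f ->
  Cc O (fun x => F (f x)).
Proof.
move=> cF F0 [cf [K [cK KO fK]]]; split.
  by move=> x; apply: continuous_comp; [exact: cf | exact: cF].
by exists K; split => // x Kx; rewrite fK.
Qed.

Lemma Cc_pos (O : set X) f : Cc O f -> Cc O (fun x => Num.max (f x) 0).
Proof.
apply: (@Cc_comp O (fun r => Num.max r 0)) => [r|]; last exact: maxxx.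
by apply: continuous_max => //; exact: cst_continuous.
Qed.

Lemma Cc_neg (O : set X) f : Cc O f -> Cc O (fun x => Num.max (- f x) 0).
Proof.
apply: (@Cc_comp O (fun r => Num.max (- r) 0)) => [r|]; last by rewrite oppr0 maxxx.
by apply: continuous_max; [exact: opp_continuous | exact: cst_continuous].
Qed.

Lemma pos_neg_part (r : R) : r = Num.max r 0 - Num.max (- r) 0.
Proof.
have [h|h] := leP 0 r; first by rewrite (max_r (_ : - r <= 0)) ?oppr_le0 // subr0.
by rewrite (max_l (_ : 0 <= - r)) ?oppr_ge0 ?ltW // sub0r opprK.
Qed.

Lemma Cc_norm (O : set X) f : Cc O f -> Cc O (fun x => `|f x|).
Proof. by apply: (@Cc_comp O (fun r => `|r|)) => [r|]; [exact: norm_continuous | rewrite normr0]. Qed.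

Lemma Cc0 (O : set X) : Cc O (fun=> 0).
Proof. by split; [exact: cst_continuous | exists set0; split => //; exact: compact0]. Qed.

Lemma Cc_sum (O : set X) (I : Type) (r : seq I) (P : pred I) (f : I -> X -> R) :
  (forall i, Cc O (f i)) -> Cc O (fun x => \sum_(i <- r | P i) f i x).
Proof.
move=> Of; elim: r => [|i r IH].
  by rewrite (_ : (fun _ => _) = fun=> 0) //; [exact: Cc0 | apply/funext => x; rewrite big_nil].
rewrite (_ : (fun _ => _) = fun x => (if P i then f i x else 0) + \sum_(j <- r | P j) f j x).
  by case: (P i); apply: CcD => //; exact: Cc0.
by apply/funext => x; rewrite big_cons; case: ifP => // _; rewrite add0r.
Qed.

(** The cut-off equals 1 on a full [d]-neighbourhood of [K], because integration by parts shifts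
    supports by up to [d]. *)
Lemma nbhd_cutoff (O K : set X) : open O -> compact K -> K `<=` O ->
  exists d L eta, [/\ 0 < d, 0 < L, Cc O eta, lip L eta &
    (forall x, 0 <= eta x <= 1) /\ forall x y, K x -> `|y - x| <= d -> eta y = 1].
Proof.
move=> oO cK KO; have [K0|/set0P[x0 Kx0]] := eqVneq K set0.
  exists 1, 1, (fun=> 0); split => //; first exact: Cc0.
    by apply: lip_le (lip_cst 0).
  by split => [x|x y]; [rewrite lexx ler01 | rewrite K0].
have cd : {within K, continuous (depth O)}.
  by apply: continuous_subspaceT; exact: lip_cts (lip_depth O).
have [x1 Kx1 hx1] := @compact_EVT_min _ _ (depth O) K (ex_intro _ x0 Kx0) cK cd.
rewrite inE in Kx1.
(* The depth is at least [3 * d] on [K], hence at least [2 * d] within distance [d] of [K]. There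
   [f >= 1], while [f <= 0] wherever the depth is at most [d]. *)
pose d := depth O x1 / 3; have d0 : 0 < d by rewrite divr_gt0 // depth_gt0 //; exact: KO.
have [M [Mr hM]] := compact_bounded cK.
pose N := `|M| + 1.
have KN x : K x -> `|x| <= N.
  by move=> Kx; apply: hM => //; rewrite /N (le_lt_trans (ler_norm _)) // ltrDl.
have N0 : 0 < N by rewrite /N ltr_wpDl.
(* [f] cuts off near the complement of [O] and [g] at infinity, where the depth alone does not bound
   the support. *)
pose f x := d^-1 * depth O x + -1; pose g (x : X) := -1 * `|x| + (N + d + 1).
pose eta x := Num.max 0 (Num.min 1 (Num.min (f x) (g x))).
have etalip : lip (d^-1 + 1) eta.
  have di : 0 <= d^-1 by rewrite invr_ge0 ltW.
  apply: lip_max; first by apply: lip_le (lip_cst 0); rewrite addr_ge0.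
  apply: lip_min; first by apply: lip_le (lip_cst 1); rewrite addr_ge0.
  apply: lip_min.
    apply: lip_le (lip_affine _ _ (@lip_depth O)).
    by rewrite mulr1 ger0_norm // lerDl.
  apply: lip_le (lip_affine _ _ lip_norm).
  by rewrite mulr1 normrN normr1 lerDr.
exists d, (d^-1 + 1), eta; split => //.
- by rewrite addr_gt0 // invr_gt0.
- split; first exact: lip_cts etalip.
  exists ([set x | d <= depth O x] `&` [set x | `|x| <= N + d + 1]); split.
  + apply: bounded_closed_compact.
      exists (N + d + 1); split; first exact: num_real.
      by move=> y yN x [_ /= xN]; rewrite (le_trans xN) // ltW.
    apply: closedI.
      apply: (@closed_comp _ _ (depth O) [set r | d <= r]) => [x _|]; last exact: closed_ge.
      exact: lip_cts (lip_depth O) x.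
    apply: (@closed_comp _ _ (fun x : X => `|x|) [set r | r <= N + d + 1]) => [x _|]; last exact: closed_le.
    exact: lip_cts lip_norm x.
  + move=> x [/= dx _]; apply: (@lt_depth O x); rewrite subrr normr0.
    exact: lt_le_trans dx.
  + move=> x; rewrite /eta => hx; apply/max_idPl.
    rewrite !ge_min; apply/orP; right; apply/orP.
    have [h|h] := pselect (d <= depth O x).
      right; rewrite /g; have : ~ (`|x| <= N + d + 1) by move=> ?; exact: hx.
      by move=> /negP; rewrite -ltNge; lra.
    left; move/negP: h; rewrite -ltNge => h; rewrite /f.
    by rewrite subr_le0 mulrC ler_pdivrMr // mul1r ltW.
- split => [x|x y Kx yx]; first by rewrite /eta le_max lexx /= ge_max ler01 ge_min lexx.
  have h1 : 1 <= f y.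
    have /hx1 h : x \in K by rewrite inE.
    have := lip_depth O y x; rewrite mul1r ler_norml => /andP[hh _]; move: hh; rewrite lerBrDr.
    have -> : (1 <= f y) = (2 * d <= depth O y).
      by rewrite /f -lerBlDr opprK mulrC ler_pdivlMr.
    move: h yx; rewrite (_ : depth O x1 = 3 * d); first lra.
    by rewrite /d mulrC divfK.
  have h2 : 1 <= g y.
    have := KN _ Kx; have := ler_normD (y - x) x; rewrite subrK /g; lra.
  rewrite /eta (_ : Num.min 1 _ = 1); first by apply/max_idPr; exact: ler01.
  by apply/min_idPl; rewrite le_min h1 h2.
Qed.

End Lipschitz.

(** * Integration by parts against Lipschitz functions *)

Section IntegrationByParts.
Context {R : realType} {n : nat}.
Local Notation X := 'rV[R]_n.
Local Notation B := (borelRn R n).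
Variable lam : {measure set B -> \bar R}.
Hypothesis hlam : is_lebesgue lam.

Lemma derivable_line (f : X -> R) (x e : X) (s : R) : derivable f (s *: e + x) e ->
  is_derive s 1 (fun h : R => f (h *: e + x)) ('D_e f (s *: e + x)).
Proof.
have E : (fun h : R => h^-1 *: ((f \o shift (s *: e + x)) (h *: e) - f (s *: e + x))) =
  (fun h : R => h^-1 *: (((fun r : R => f (r *: e + x)) \o shift s) (h *: 1) - f (s *: e + x))).
  apply/funext => h /=; congr (_ *: (f _ - _)).
  by rewrite addrA -scalerDl [h%:A]mulr1.
move=> df; split; first by move: df; rewrite /derivable E.
by rewrite /derive E.
Qed.

Lemma MVT_line (f : X -> R) (x e : X) (h : R) : 0 < h ->
  (forall s, 0 <= s <= h -> derivable f (s *: e + x) e) ->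
  exists2 s, 0 <= s <= h & f (h *: e + x) - f x = 'D_e f (s *: e + x) * h.
Proof.
move=> h0 df; pose F s := f (s *: e + x).
have dF s : 0 <= s <= h -> is_derive s 1 F ('D_e f (s *: e + x)).
  by move=> /df; exact: derivable_line.
have [||c cab] := @MVT R F (fun s => 'D_e f (s *: e + x)) 0 h h0.
- move=> s; rewrite in_itv /= => /andP[a b]; apply: dF; rewrite ?(ltW a) ?(ltW b) //.
- apply: derivable_within_continuous => s; rewrite in_itv /= => sab.
  by have [] := dF s sab.
- rewrite /F scale0r add0r subr0 => ->; exists c => //.
  by move: cab; rewrite in_itv /= => /andP[a b]; rewrite ?(ltW a) ?(ltW b) //.
Qed.

(* The difference quotients are shifted onto [eta], where the Lipschitz bound applies;
   no differentiability of [eta] is needed. *)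
Lemma ibp_bound (O K : set X) (g eta chi : X -> R) (i : 'I_n) (L d : R) :
  open O -> compact K -> K `<=` O -> 0 < d -> 0 <= L ->
  (forall x, O x -> {for x, continuous g}) ->
  (forall x, O x -> derivable g x (evec R i) /\ {for x, continuous (pderiv g i)}) ->
  lip L eta -> (forall x, ~ K x -> eta x = 0) ->
  Cc O chi -> (forall x, 0 <= chi x) ->
  (forall x y, K x -> `|y - x| <= d -> chi y = 1) ->
  `|J lam (fun x => eta x * pderiv g i x)| <= L * J lam (fun x => chi x * `|g x|).
Proof.
move=> oO cK KO d0 L0 cg dg etaL etaK Ochi chi0 chi1.
set e := evec R i.
have ceta := lip_cts etaL.
have Oeta : Cc O eta by split => //; exists K.
have near_chi y : chi y = 1 -> O y.
  case: Ochi => _ [K' [_ K'O chiK']] chiy; apply: K'O; apply: contrapT => /chiK'.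
  by rewrite chiy => /eqP; rewrite oner_eq0.
have nrm s : `|s *: e| = `|s| by rewrite normrZ evec_norm mulr1.
have KOs s x : `|s| <= d -> K x -> O (s *: e + x).
  by move=> sd Kx; apply: near_chi; apply: (chi1 x) => //; rewrite addrK nrm.
have Oetadg : Cc O (fun x => eta x * pderiv g i x).
  by apply: Cc_mul => // x /dg[].
(* This bounds the derivative of [g] on the [d]-neighbourhood of [K]; by the mean value theorem
   [M * |eta|] then dominates all the products of [eta] with difference quotients. *)
have [M M0 hM] : exists2 M, 0 < M & forall x, `|chi x * pderiv g i x| <= M.
  by apply: (@Cc_bounded _ _ O); apply: Cc_mul => // x /dg[].
have cshift s (x : X) : {for x, continuous (fun y : X => s *: e + y)}.
  by rewrite (_ : (fun _ => _) = (fun y : X => y + s *: e)); [exact: shift_cts | apply/funext => y; rewrite addrC].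
have Og : Cc O (fun x => eta x * g x) by exact: Cc_mul.
have Ogs s : `|s| <= d -> Cc O (fun x => eta x * g (s *: e + x)).
  move=> sd; apply: (Cc_glue cK KO) => [x Kx|x Kx]; first by rewrite etaK // mul0r.
  apply: continuousM; first exact: ceta.
  apply: (@continuous_comp _ _ _ (fun y : X => s *: e + y) g); first exact: cshift.
  by apply: cg; exact: KOs.
have Oetas s : `|s| <= d -> Cc O (fun x => eta (x - s *: e) * g x).
  move=> sd; apply: (@Cc_glue _ _ _ ((fun y : X => y + s *: e) @` K)).
  - by apply: continuous_compact => //; apply: continuous_subspaceT; exact: shift_cts.
  - by move=> _ [x Kx <-]; rewrite addrC; exact: KOs.
  - move=> x Kx; rewrite etaK ?mul0r // => Kxs; apply: Kx.
    by exists (x - s *: e) => //; rewrite subrK.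
  - move=> _ [x Kx <-]; apply: continuousM.
      apply: (@continuous_comp _ _ _ (fun y : X => y - s *: e) eta); last exact: ceta.
      exact: shift_cts.
    by apply: cg; rewrite addrC; exact: KOs.
pose q s x := s^-1 * (eta x * g (s *: e + x) - eta x * g x).
have Oq s : `|s| <= d -> Cc O (q s).
  move=> sd; apply: CcZ; rewrite (_ : (fun _ => _) = fun x => eta x * g (s *: e + x) + -1 * (eta x * g x)).
    by apply: CcD; [exact: Ogs | exact: CcZ].
  by apply/funext => x; rewrite mulN1r.
have Jq s : 0 < s <= d -> `|J lam (q s)| <= L * J lam (fun x => chi x * `|g x|).
  move=> /andP[s0 sd]; have sd' : `|s| <= d by rewrite gtr0_norm.
  have Ocg : Cc O (fun x => chi x * `|g x|).
    apply: Cc_mul => // x Ox.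
    apply: (@continuous_comp _ _ _ g (fun r : R => `|r|)); first exact: cg.
    exact: norm_continuous.
  (* Discrete integration by parts: translating the first of the two integrals by [s *: e] turns the
     difference quotient of [g] into one of [eta]. *)
  have -> : J lam (q s) = J lam (fun x => s^-1 * (eta (x - s *: e) * g x - eta x * g x)).
    have O1 : Cc O (fun x => eta x * g (s *: e + x) - eta x * g x).
      rewrite (_ : (fun _ => _) = fun x => eta x * g (s *: e + x) + -1 * (eta x * g x)).
        by apply: CcD; [exact: Ogs | exact: CcZ].
      by apply/funext => x; rewrite mulN1r.
    have O2 : Cc O (fun x => eta (x - s *: e) * g x - eta x * g x).
      rewrite (_ : (fun _ => _) = fun x => eta (x - s *: e) * g x + -1 * (eta x * g x)).
        by apply: CcD; [exact: Oetas | exact: CcZ].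
      by apply/funext => x; rewrite mulN1r.
    rewrite /q (JZ hlam _ O1) (JZ hlam _ O2); congr (_ * _).
    rewrite (JB hlam (Ogs _ sd') Og) (JB hlam (Oetas _ sd') Og); congr (_ - _).
    rewrite -(J_translation hlam (s *: e) (Oetas _ sd')); congr (J lam _).
    by apply/funext => x; rewrite addrK [x + _]addrC.
  have O3 : Cc O (fun x => s^-1 * (eta (x - s *: e) * g x - eta x * g x)).
    apply: CcZ; rewrite (_ : (fun _ => _) = fun x => eta (x - s *: e) * g x + -1 * (eta x * g x)).
      by apply: CcD; [exact: Oetas | exact: CcZ].
    by apply/funext => x; rewrite mulN1r.
  apply: le_trans (J_norm hlam O3) _.
  rewrite -(JZ hlam _ Ocg); apply: (le_J hlam (Cc_norm O3) (CcZ L Ocg)) => x.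
  (* If neither [x] nor [x - s *: e] lies in [K], both values of [eta] vanish; otherwise [x] is
     within [d] of [K] and [chi x = 1]. *)
  have [h|h] := pselect (K x \/ K (x - s *: e)); last first.
    move/not_orP : h => [h1 h2]; rewrite !etaK // !mul0r subrr mulr0 normr0.
    by rewrite !mulr_ge0.
  have -> : chi x = 1.
    case: h => h; apply: (chi1 _ _ h); first by rewrite subrr normr0 ltW.
    by rewrite opprB addrC subrK nrm.
  rewrite mul1r -mulrBl !normrM mulrA ler_wpM2r //.
  rewrite normfV (gtr0_norm s0) ler_pdivrMl //.
  by apply: le_trans (etaL _ _) _; rewrite addrAC subrr add0r normrN nrm (gtr0_norm s0) mulrC.
pose h k : R := d / k.+1%:R.
have h0 k : 0 < h k <= d.
  by rewrite divr_gt0 //= ler_pdivrMr // ler_peMr ?ler1n // ltW.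
have hcvg : h @ \oo --> 0.
  by rewrite -(mulr0 d); apply: cvgM; [exact: cvg_cst | exact: cvg_harmonic].
have : (fun k => J lam (q (h k))) @ \oo --> J lam (fun x => eta x * pderiv g i x).
  have Obd : Cc O (fun x => M * `|eta x|) by apply: CcZ; exact: Cc_norm.
  apply: (J_dct hlam (fun k => Oq (h k) _) Oetadg Obd).
  - by move=> k; have /andP[a b] := h0 k; rewrite gtr0_norm.
  - move=> k x; have /andP[a b] := h0 k.
    have [Kx|Kx] := pselect (K x); last first.
      by rewrite /q etaK // !mul0r subrr mulr0 normr0 mulr0.
    have [s /andP[s0 sh]|s /andP[s0 sh] E] := @MVT_line g x e (h k) a.
      by have [] := dg (s *: e + x); [apply: KOs => //; rewrite ger0_norm // (le_trans sh)|].
    rewrite /q -mulrBr E mulrCA -[_ * h k]/(_) (mulrC _ (h k)) mulKf ?gt_eqF // normrM mulrC.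
    rewrite ler_wpM2r //.
    have := hM (s *: e + x); rewrite (chi1 x) ?mul1r //.
    by rewrite addrK nrm ger0_norm // (le_trans sh).
  - apply: aeW => x; have [Kx|Kx] := pselect (K x); last first.
      rewrite etaK // mul0r (_ : (fun _ => _) = fun=> 0); first exact: cvg_cst.
      by apply/funext => k; rewrite /q etaK // !mul0r subrr mulr0.
    rewrite (_ : (fun _ => _) = fun k => eta x * ((h k)^-1 *: ((g \o shift x) (h k *: e) - g x))).
      apply: cvgM; first exact: cvg_cst.
      have [dgx _] := dg x (KO _ Kx).
      have : (fun r : R => r^-1 *: ((g \o shift x) (r *: e) - g x)) @ 0^' --> pderiv g i x by exact: dgx.
      have hd : h @ \oo --> 0^'.
        move=> A hA; have : \forall k \near \oo, h k != 0 -> A (h k) by exact: (hcvg _ hA).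
        apply: filterS => k; apply.
        by case/andP: (h0 k) => hk0 _; rewrite gt_eqF.
      exact: cvg_comp hd.
    by apply/funext => k; rewrite /q /= -mulrBr mulrCA.
move=> /cvg_norm; apply: (@closed_cvg _ _ _ _ (fun k => `|J lam (q (h k))|)
  [set r : R | r <= L * J lam (fun x => chi x * `|g x|)]); first exact: closed_le.
by apply: nearW => k /=; exact: Jq.
Qed.

End IntegrationByParts.

(** * The operator in coordinates *)

Section Curvature.
Context {R : realType} {n : nat}.
Local Notation X := 'rV[R]_n.

Lemma is_derive_add (f g : X -> R) (x v : X) df dg :
  is_derive x v f df -> is_derive x v g dg -> is_derive x v (fun y => f y + g y) (df + dg).
Proof. by move=> ? ?; exact: is_deriveD. Qed.

Lemma is_derive_sub (f g : X -> R) (x v : X) df dg :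
  is_derive x v f df -> is_derive x v g dg -> is_derive x v (fun y => f y - g y) (df - dg).
Proof. by move=> ? ?; exact: is_deriveB. Qed.

Lemma is_derive_mul (f g : X -> R) (x v : X) df dg :
  is_derive x v f df -> is_derive x v g dg ->
  is_derive x v (fun y => f y * g y) (f x * dg + g x * df).
Proof. by move=> ? ?; exact: is_deriveM. Qed.

Lemma is_derive_bigsum m (f : 'I_m -> X -> R) (x v : X) (df : 'I_m -> R) :
  (forall i, is_derive x v (f i) (df i)) ->
  is_derive x v (fun y => \sum_(i < m) f i y) (\sum_(i < m) df i).
Proof.
move=> h; rewrite (_ : (fun _ => _) = \sum_(i < m) f i); first exact: is_derive_sum.
by apply/funext => y; rewrite fct_sumE.
Qed.

Lemma is_derive_inv (f : X -> R) (x v : X) df : f x != 0 ->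
  is_derive x v f df -> is_derive x v (fun y => (f y)^-1) (- (f x) ^- 2 * df).
Proof.
move=> fx0 [dfx <-]; split; first exact: derivableV.
by rewrite deriveV.
Qed.

(** [C2_on] provides partial derivatives only, so the chain rule is reduced to one variable by
    restricting [g] to the line through [x] in direction [v]. *)
Lemma is_derive_chain (F : R -> R) (g : X -> R) (x v : X) dF dg :
  is_derive (g x) 1 F dF -> is_derive x v g dg ->
  is_derive x v (fun y => F (g y)) (dF * dg).
Proof.
move=> hF [dgx <-].
have x0 : x = 0%R *: v + x by rewrite scale0r add0r.
have h : is_derive (0 : R) 1 (fun s : R => g (s *: v + x)) ('D_v g x).
  by rewrite {2}x0; apply: derivable_line; rewrite -x0.
have hF' : is_derive (g (0%R *: v + x)) 1 F dF by rewrite -x0.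
have := @is_derive1_comp _ F (fun s : R => g (s *: v + x)) 0 _ _ hF' h.
move=> [d1 d2]; split; first exact/derivable1P.
have E : (fun s : R => s^-1 *: (((fun y => F (g y)) \o shift x) (s *: v) - F (g x))) =
    (fun s : R => s^-1 *: (((F \o (fun r : R => g (r *: v + x))) \o shift 0) (s *: 1) -
      (F \o (fun r : R => g (r *: v + x))) 0)).
  by apply/funext => s /=; rewrite addr0 scale0r add0r [s%:A]mulr1.
by move: d2; rewrite /derive E.
Qed.

(** The derivative of the [i]-th component of [p / sqrt (1 + |p|^2)] when [p] moves at velocity [q].
    It is left unsimplified, in the form that the product, inverse and chain rules produce. *)
Definition DT (p q : 'I_n -> R) (i : 'I_n) : R :=
  let w := Num.sqrt (1 + \sum_(k < n) p k ^+ 2) in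
  p i * (- w ^- 2 * ((2 * w)^-1 * \sum_(k < n) (p k * q k + p k * q k))) + w^-1 * q i.

Lemma W_gt0 (p : 'I_n -> R) : 0 < 1 + \sum_(k < n) p k ^+ 2.
Proof. by rewrite ltr_pwDl // sumr_ge0 // => k _; exact: sqr_ge0. Qed.

Lemma cvg_bigsum {T : Type} (F : set_system T) {FF : Filter F} (I : Type) (r : seq I)
    (P : pred I) (f : I -> T -> R) (l : I -> R) :
  (forall i, f i @ F --> l i) ->
  (fun t => \sum_(i <- r | P i) f i t) @ F --> \sum_(i <- r | P i) l i.
Proof.
move=> h; elim: r => [|i r IH].
  by rewrite big_nil (_ : (fun _ => _) = fun=> 0); [exact: cvg_cst | apply/funext => t; rewrite big_nil].
rewrite big_cons (_ : (fun _ => _) = fun t => if P i then f i t + \sum_(j <- r | P j) f j t else \sum_(j <- r | P j) f j t).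
  by case: (P i) => //; apply: cvgD.
by apply/funext => t; rewrite big_cons.
Qed.

Lemma cvg_W {T : Type} (F : set_system T) {FF : Filter F} (p : 'I_n -> T -> R) (P : 'I_n -> R) :
  (forall k, p k @ F --> P k) ->
  (fun t => Num.sqrt (1 + \sum_(k < n) p k t ^+ 2)) @ F --> Num.sqrt (1 + \sum_(k < n) P k ^+ 2).
Proof.
move=> hp; apply: (@cvg_comp _ _ _ _ Num.sqrt _ (nbhs (1 + \sum_(k < n) P k ^+ 2))).
  apply: cvgD; first exact: cvg_cst.
  by apply: cvg_bigsum => k; rewrite (_ : (fun _ => _) = fun t => p k t * p k t) //; exact: cvgM.
exact: sqrt_continuous.
Qed.

Lemma cvg_DT {T : Type} (F : set_system T) {FF : Filter F} (p q : 'I_n -> T -> R) (P Q : 'I_n -> R) i :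
  (forall k, p k @ F --> P k) -> (forall k, q k @ F --> Q k) ->
  (fun t => DT (p ^~ t) (q ^~ t) i) @ F --> DT P Q i.
Proof.
move=> hp hq; have hW := @cvg_W T F FF p P hp.
have w0 : Num.sqrt (1 + \sum_(k < n) P k ^+ 2) != 0 by rewrite gt_eqF // sqrtr_gt0 W_gt0.
apply: cvgD; last by apply: cvgM => //; apply: cvgV.
apply: cvgM => //; apply: cvgM.
  by apply: cvgN; apply: cvgV; [rewrite sqrf_eq0 | exact: cvgM].
apply: cvgM.
  by apply: cvgV; [rewrite mulf_neq0 // pnatr_eq0 | apply: cvgM => //; exact: cvg_cst].
by apply: cvg_bigsum => k; apply: cvgD; exact: cvgM.
Qed.

Definition Tv (f : X -> R) (i : 'I_n) (y : X) : R :=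
  pderiv f i y / Num.sqrt (1 + \sum_(k < n) pderiv f k y ^+ 2).

Lemma is_derive_Tv (O : set X) f i (j : 'I_n) x : C2_on O f -> O x ->
  is_derive x (evec R j) (Tv f i)
    (DT (fun k => pderiv f k x) (fun k => pderiv (pderiv f k) j x) i).
Proof.
move=> [_ _ c2] Ox; set v := evec R j.
have da k : is_derive x v (pderiv f k) (pderiv (pderiv f k) j x).
  by apply: derivableP; case: (c2 k j x Ox).
rewrite /Tv /DT; apply: is_derive_mul => //.
have W0 := W_gt0 (fun k => pderiv f k x).
apply: (@is_derive_inv (fun y => Num.sqrt (1 + \sum_(k < n) pderiv f k y ^+ 2))).
  by rewrite gt_eqF // sqrtr_gt0.
apply: (@is_derive_chain Num.sqrt (fun y => 1 + \sum_(k < n) pderiv f k y ^+ 2)).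
  exact: is_derive1_sqrt.
have h1 : is_derive x v (fun _ : X => 1 : R) 0 by exact: is_derive_cst.
have h2 := is_derive_bigsum (fun k => is_derive_mul (da k) (da k)).
by have := is_derive_add h1 h2; rewrite add0r.
Qed.

Lemma pderiv_TvE (O : set X) f i (j : 'I_n) x : C2_on O f -> O x ->
  pderiv (Tv f i) j x = DT (fun k => pderiv f k x) (fun k => pderiv (pderiv f k) j x) i.
Proof. by move=> c Ox; have [_] := is_derive_Tv i j c Ox. Qed.

Lemma H1E (O : set X) f x : C2_on O f -> O x ->
  H1 f x = \sum_(i < n) DT (fun k => pderiv f k x) (fun k => pderiv (pderiv f k) i x) i.
Proof. by move=> c Ox; apply: eq_bigr => i _; rewrite -(pderiv_TvE _ _ c Ox). Qed.

Lemma cts_eq_open (O : set X) (f g : X -> R) x : open O -> O x ->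
  (forall y, O y -> f y = g y) -> {for x, continuous g} -> {for x, continuous f}.
Proof.
move=> oO Ox fg /cts_atP cg; apply/cts_atP => e e0.
have [d d0 hd] := cg e e0; have [r r0 hr] := openP_ball oO Ox.
exists (Num.min d r) => [|y]; first by rewrite lt_min d0.
by rewrite lt_min => /andP[/hd h /hr Oy]; rewrite !fg.
Qed.

Lemma cts_Tv (O : set X) f i x : C2_on O f -> O x -> {for x, continuous (Tv f i)}.
Proof.
move=> [_ c1 _] Ox; have c k : {for x, continuous (pderiv f k)} by case: (c1 k x Ox).
rewrite /Tv; apply: (@cvgM _ _ (nbhs x) _ (pderiv f i) (fun y => (Num.sqrt (1 + \sum_(k < n) pderiv f k y ^+ 2))^-1)); first exact: c.
by apply: cvgV; [rewrite gt_eqF // sqrtr_gt0 W_gt0 | exact: cvg_W].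
Qed.

Lemma cts_pderiv_Tv (O : set X) f i (j : 'I_n) x : open O -> C2_on O f -> O x ->
  {for x, continuous (pderiv (Tv f i) j)}.
Proof.
move=> oO c Ox.
apply: (cts_eq_open oO Ox (fun y Oy => pderiv_TvE i j c Oy)).
case: c => _ c1 c2; apply: (@cvg_DT _ (nbhs x) _ (pderiv f) (fun k => pderiv (pderiv f k) j)) => k.
  by case: (c1 k x Ox).
by case: (c2 k j x Ox).
Qed.

Lemma cts_H1 (O : set X) f x : open O -> C2_on O f -> O x -> {for x, continuous (H1 f)}.
Proof.
move=> oO c Ox; apply: (@cvg_bigsum _ (nbhs x) _ _ _ _ (fun i => pderiv (Tv f i) i)) => i.
have h := @cts_pderiv_Tv O f i i x oO c Ox; rewrite /prop_for /continuous_at in h; exact: h.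
Qed.

Lemma Tv_le1 f i x : `|Tv f i x| <= 1.
Proof.
rewrite /Tv normrM normfV (ger0_norm (sqrtr_ge0 _)).
have W0 := W_gt0 (fun k => pderiv f k x).
rewrite ler_pdivrMr ?sqrtr_gt0 // mul1r -sqrtr_sqr ler_wsqrtr //.
rewrite (bigD1 i) //= addrCA lerDl addr_ge0 // sumr_ge0 // => k _; exact: sqr_ge0.
Qed.

(* [(p - q).(T p - T q) = (W p + W q) (1 - N p . N q) >= |N p - N q|^2 >= |T p - T q|^2],
   where [W p = sqrt (1 + |p|^2)] and [N p = (p, -1) / W p] is the unit normal. *)
Lemma T_monotone (p q : 'I_n -> R) (a b : R) :
  a = Num.sqrt (1 + \sum_(k < n) p k ^+ 2) -> b = Num.sqrt (1 + \sum_(k < n) q k ^+ 2) ->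
  \sum_(i < n) (p i / a - q i / b) ^+ 2 <= \sum_(i < n) (p i - q i) * (p i / a - q i / b).
Proof.
move=> ea eb; set P := \sum_(k < n) p k ^+ 2 in ea; set Q := \sum_(k < n) q k ^+ 2 in eb.
pose S := \sum_(k < n) p k * q k.
have P0 : 0 <= P by rewrite sumr_ge0 // => k _; exact: sqr_ge0.
have Q0 : 0 <= Q by rewrite sumr_ge0 // => k _; exact: sqr_ge0.
have a2 : a ^+ 2 = 1 + P by rewrite ea sqr_sqrtr // addr_ge0.
have b2 : b ^+ 2 = 1 + Q by rewrite eb sqr_sqrtr // addr_ge0.
have a1 : 1 <= a by rewrite ea -[leLHS]sqrtr1 ler_wsqrtr // lerDl.
have b1 : 1 <= b by rewrite eb -[leLHS]sqrtr1 ler_wsqrtr // lerDl.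
have a0 : 0 < a by lra.
have b0 : 0 < b by lra.
have -> : \sum_(i < n) (p i / a - q i / b) ^+ 2 = P / a ^+ 2 + Q / b ^+ 2 - 2 * S / (a * b).
  rewrite -mulrA [2 * _]mulrC -mulrA !mulr_suml -big_split -sumrB /=; apply: eq_bigr => i _.
  by field; rewrite !gt_eqF.
have -> : \sum_(i < n) (p i - q i) * (p i / a - q i / b) = P / a + Q / b - S * (a^-1 + b^-1).
  rewrite !mulr_suml -big_split -sumrB /=; apply: eq_bigr => i _; by field; rewrite !gt_eqF.
(* Cauchy-Schwarz for [(1, p)] and [(1, q)]. It follows from [S ^+ 2 <= P * Q] and from [h 1], which
   says [2 * S <= P + Q]. *)
have CS : 1 + S <= a * b.
  have h : (1 + S) ^+ 2 <= (a * b) ^+ 2.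
    rewrite exprMn a2 b2.
    have h t : 0 <= P - 2 * t * S + t ^+ 2 * Q.
        have -> : P - 2 * t * S + t ^+ 2 * Q = \sum_(k < n) (p k - t * q k) ^+ 2.
          rewrite /P /S /Q !mulr_sumr -sumrB -big_split /=; apply: eq_bigr => k _; ring.
        by rewrite sumr_ge0 // => k _; exact: sqr_ge0.
    have hS : S ^+ 2 <= P * Q.
      have [Qz|Qz] := eqVneq Q 0.
        have [Sz|Sz] := eqVneq S 0; first by rewrite Sz expr0n /= mulr_ge0.
        (* For [Q = 0] and [S != 0] this [t] gives the nonnegative expression the value [-1]. *)
        have := h ((P + 1) / (2 * S)); rewrite Qz mulr0 addr0.
        rewrite (_ : 2 * ((P + 1) / (2 * S)) * S = P + 1); first lra.
        by field.
      have Qp : 0 < Q by rewrite lt_def Qz.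
      have := h (S / Q); rewrite (_ : P - _ + _ = P - S ^+ 2 / Q); last by field.
      by rewrite subr_ge0 ler_pdivrMr.
    by have := h 1; nra.
  have [S1|S1] := leP (1 + S) 0; first by apply: (le_trans S1); rewrite mulr_ge0 // ltW.
  rewrite -(@ler_pXn2r _ 2) // nnegrE ?ltW // mulr_gt0 //.
rewrite -subr_ge0.
(* Here [(a * b - 1 - S) / (a * b)] is [1 - N p . N q], of which [|N p - N q|^2] is the double, and
   [(a^-1 - b^-1) ^+ 2] is the square of the component of [N p - N q] that [T p - T q] lacks. The
   first summand is nonnegative by [CS] and [a, b >= 1]. *)
have -> : P / a + Q / b - S * (a^-1 + b^-1) - (P / a ^+ 2 + Q / b ^+ 2 - 2 * S / (a * b)) =
  (a * b - 1 - S) / (a * b) * (a + b - 2) + (a^-1 - b^-1) ^+ 2.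
  have -> : P = a ^+ 2 - 1 by rewrite a2; ring.
  have -> : Q = b ^+ 2 - 1 by rewrite b2; ring.
  by field; rewrite !gt_eqF.
rewrite addr_ge0 ?sqr_ge0 // mulr_ge0 // ?divr_ge0 //; [lra | by rewrite mulr_ge0 // ltW | lra].
Qed.

End Curvature.

(** * Stability of the curvature integrals *)

Section Stability.
Context {R : realType} {n : nat}.
Local Notation X := 'rV[R]_n.
Local Notation B := (borelRn R n).
Variable lam : {measure set B -> \bar R}.
Hypothesis hlam : is_lebesgue lam.
Variable O : set X.
Hypothesis oO : open O.
Local Notation J := (J lam).

Lemma J_sum (f : 'I_n -> X -> R) : (forall i, Cc O (f i)) ->
  J (fun x => \sum_(i < n) f i x) = \sum_(i < n) J (f i).
Proof.
move=> Of.
suff : forall r : seq 'I_n, J (fun x => \sum_(i <- r) f i x) = \sum_(i <- r) J (f i) by exact.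
elim=> [|i r IH].
  rewrite big_nil -[RHS](mul0r (J (fun=> 0))) -(JZ hlam 0 (@Cc0 R n O)).
  by congr (J _); apply/funext => x; rewrite big_nil mul0r.
rewrite big_cons -IH -(JD hlam (Of i) (Cc_sum _ _ Of)).
by congr (J _); apply/funext => x; rewrite big_cons.
Qed.

Definition sol (s : X -> R) := C2_on O s /\ forall x, O x -> 0 <= H1 s x.

Definition I_ (s phi : X -> R) : R := J (fun x => phi x * H1 s x).

Lemma Cc_H1 s phi : sol s -> Cc O phi -> Cc O (fun x => phi x * H1 s x).
Proof. by move=> [cs _] Op; apply: Cc_mul => // x Ox; exact: (cts_H1 oO cs Ox). Qed.

Lemma Cc_zero_or (phi : X -> R) x : Cc O phi -> phi x = 0 \/ O x.
Proof.
move=> [_ [K [_ KO pK]]]; have [/KO|/pK] := pselect (K x); by [right|left].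
Qed.

Lemma I_ge0 s phi : sol s -> Cc O phi -> (forall x, 0 <= phi x) -> 0 <= I_ s phi.
Proof.
move=> [_ Hs] Op p0; apply: J_ge0 => x.
by have [->|/Hs h] := Cc_zero_or x Op; [rewrite mul0r | exact: mulr_ge0].
Qed.

Lemma I_D s phi psi : sol s -> Cc O phi -> Cc O psi ->
  I_ s (fun x => phi x + psi x) = I_ s phi + I_ s psi.
Proof.
move=> ss Op Oq; rewrite /I_ -(JD hlam (Cc_H1 ss Op) (Cc_H1 ss Oq)).
by congr (J _); apply/funext => x; rewrite mulrDl.
Qed.

Lemma I_Z s phi a : sol s -> Cc O phi -> I_ s (fun x => a * phi x) = a * I_ s phi.
Proof.
move=> ss Op; rewrite /I_ -(JZ hlam _ (Cc_H1 ss Op)).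
by congr (J _); apply/funext => x; rewrite mulrA.
Qed.

Lemma I_pos_neg s phi : sol s -> Cc O phi ->
  I_ s phi = I_ s (fun x => Num.max (phi x) 0) - I_ s (fun x => Num.max (- phi x) 0).
Proof.
move=> ss Op; have Opp := Cc_pos Op; have Opn := Cc_neg Op.
rewrite -mulN1r -(I_Z _ ss Opn) -(I_D ss Opp (CcZ _ Opn)).
by congr (I_ s _); apply/funext => x; rewrite mulN1r -pos_neg_part.
Qed.

Lemma le_I s phi psi : sol s -> Cc O phi -> Cc O psi -> (forall x, phi x <= psi x) ->
  I_ s phi <= I_ s psi.
Proof.
move=> ss Op Oq pq; apply: (le_J hlam (Cc_H1 ss Op) (Cc_H1 ss Oq)) => x.
have [p0|Ox] := Cc_zero_or x Op; last by rewrite ler_wpM2r // ss.2.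
have [q0|Ox] := Cc_zero_or x Oq; first by rewrite p0 q0.
by rewrite ler_wpM2r // ss.2.
Qed.

Lemma norm_I s phi psi : sol s -> Cc O phi -> Cc O psi -> (forall x, `|phi x| <= psi x) ->
  `|I_ s phi| <= I_ s psi.
Proof.
move=> ss Op Oq pq; rewrite ler_norml; apply/andP; split.
  rewrite lerNl -mulN1r -I_Z //; apply: le_I => //; first exact: CcZ.
  by move=> x; rewrite mulN1r; apply: le_trans (pq x); rewrite -normrN ler_norm.
by apply: le_I => // x; apply: le_trans (pq x); rewrite ler_norm.
Qed.

(** Since [H1 s >= 0], the test function may be replaced by [M * eta] with [eta] Lipschitz and equal
    to 1 on [K]. Integration by parts then leaves only [Tv s], so that [C] depends on [K] but not on
    [s]. *)
Lemma mass_bound (K : set X) : compact K -> K `<=` O ->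
  exists2 C, 0 <= C & forall s phi M, sol s -> Cc O phi -> (forall x, ~ K x -> phi x = 0) ->
    (forall x, `|phi x| <= M) -> `|I_ s phi| <= M * C.
Proof.
move=> cK KO; have [d [L [eta [d0 L0 Oeta etaL [eta01 etaK]]]]] := nbhd_cutoff oO cK KO.
have [_ [K1 [cK1 K1O eta0]]] := Oeta.
have [d1 [L1 [chi [d10 L10 Ochi _ [chi01 chiK]]]]] := nbhd_cutoff oO cK1 K1O.
have chi0 x : 0 <= chi x by case/andP: (chi01 x).
have Jchi : 0 <= J chi by exact: J_ge0.
exists (\sum_(i < n) L * J chi).
  by apply: sumr_ge0 => i _; rewrite mulr_ge0 // ltW.
move=> s phi M ss Op phiK phiM.
have M0 x : K x -> 0 <= M by move=> _; apply: le_trans (phiM x).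
have [K0|/set0P[x0 Kx0]] := eqVneq K set0.
  have -> : phi = fun x => 0 * phi x.
    by apply/funext => x; rewrite mul0r phiK // K0.
  rewrite I_Z // mul0r normr0 mulr_ge0 //; first by apply: le_trans (phiM 0).
  by apply: sumr_ge0 => i _; rewrite mulr_ge0 // ltW.
have {}M0 := M0 _ Kx0.
apply: (@le_trans _ _ (M * I_ s eta)).
  rewrite -I_Z //; apply: norm_I => //; first exact: CcZ.
  move=> x; have [Kx|Kx] := pselect (K x).
    by rewrite (etaK x x) ?mulr1 // subrr normr0 ltW.
  by rewrite phiK // normr0 mulr_ge0 //; case/andP: (eta01 x).
rewrite ler_wpM2l // (le_trans (ler_norm _)) //.
have OT i : Cc O (fun x => eta x * pderiv (Tv s i) i x).
  by apply: Cc_mul => // x Ox; exact: (@cts_pderiv_Tv _ _ O s i i x oO ss.1 Ox).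
have -> : I_ s eta = \sum_(i < n) J (fun x => eta x * pderiv (Tv s i) i x).
  by rewrite -J_sum //; congr (J _); apply/funext => x; rewrite mulr_sumr.
apply: le_trans (ler_norm_sum _ _ _) _; apply: ler_sum => i _.
apply: (@le_trans _ _ (L * J (fun x => chi x * `|Tv s i x|))).
  apply: (@ibp_bound _ _ lam hlam O K1 (Tv s i) eta chi i L d1) => //.
  - exact: ltW.
  - by move=> x Ox; exact: (@cts_Tv _ _ O s i x ss.1 Ox).
  - move=> x Ox; split; first by have [] := is_derive_Tv i i ss.1 Ox.
    exact: (@cts_pderiv_Tv _ _ O s i i x oO ss.1 Ox).
apply: ler_wpM2l; first exact: ltW.
apply: (le_J hlam _ Ochi).
  apply: (@Cc_mul _ _ O) => // x Ox; apply: (@continuous_comp _ _ _ (Tv s i) (fun r : R => `|r|)).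
      exact: (@cts_Tv _ _ O s i x ss.1 Ox).
    exact: norm_continuous.
  by move=> x; rewrite ler_piMr // Tv_le1.
Qed.

(* [psi e] is bounded by a multiple of [e] although its derivative tends to 1 at 0: in
   [key_estimate] the curvature masses of [s] and [t] only enter multiplied by [e]. *)
Definition psi (e r : R) : R := e * atan (r / e).
Definition psi' (e r : R) : R := (1 + (r / e) ^+ 2)^-1.

Lemma is_derive_psi (e r : R) : 0 < e -> is_derive r (1 : R) (psi e) (psi' e r).
Proof.
move=> e0; have h1 : is_derive r 1 (fun x : R => x / e) (e^-1).
  have := @is_deriveM R R (@id R) (cst e^-1) r 1 1 0 (is_derive_id r 1) (is_derive_cst _ r 1).
  by rewrite scaler0 add0r [_ *: 1]mulr1.
have h2 := @is_derive1_comp _ (@atan R) _ r _ _ (is_derive1_atan (r / e)) h1.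
have := @is_deriveM R R (cst e) (fun x => atan (x / e)) r 1 0 _ (is_derive_cst _ r 1) h2.
rewrite scaler0 addr0 /= => h; apply: (is_derive_eq h).
by rewrite /psi' [_ *: _]mulrCA mulfV ?mulr1 // gt_eqF.
Qed.

Lemma psi'_01 e r : 0 <= psi' e r <= 1.
Proof.
have h : 0 <= (r / e) ^+ 2 by exact: sqr_ge0.
rewrite /psi' invr_ge0 addr_ge0 //= invf_le1 ?lerDl // ltr_pwDl //.
Qed.

Lemma psi_bound e r : 0 < e -> `|psi e r| <= pi * e.
Proof.
move=> e0; rewrite /psi normrM gtr0_norm // mulrC ler_pM2r // ler_norml.
have := atan_gtNpi2 (r / e); have := atan_ltpi2 (r / e); have := pi_gt0 R; lra.
Qed.

Lemma cts_psi e : 0 < e -> continuous (psi e).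
Proof.
move=> e0 r; apply: differentiable_continuous; apply/derivable1_diffP.
by have [] := is_derive_psi r e0.
Qed.

Lemma cts_psi' e : continuous (psi' e).
Proof.
move=> r; rewrite /continuous_at; apply: cvgV.
  by rewrite gt_eqF // ltr_pwDl // sqr_ge0.
apply: cvgD; first exact: cvg_cst.
rewrite (_ : (fun _ => _) = fun x : R => (x / e) * (x / e)) //.
have c : continuous (fun x : R => x / e) by move=> x; apply: mulrr_continuous.
by apply: cvgM; exact: c.
Qed.

Lemma psi_cvg e (r : nat -> R) : 0 < e -> r @ \oo --> 0 -> (fun j => psi e (r j)) @ \oo --> 0.
Proof.
move=> e0 r0; have := cts_psi e0 (x := 0); rewrite /continuous_at {2}/psi mul0r atan0 mulr0.
by move=> h; exact: cvg_comp r0 h.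
Qed.

Lemma psi'_cvg (e : R) (r : nat -> R) : r @ \oo --> 0 -> (fun j => psi' e (r j)) @ \oo --> (1 : R).
Proof.
move=> r0; have := @cts_psi' e 0; rewrite /continuous_at {2}/psi' mul0r expr0n /= addr0 invr1.
by move=> h; exact: cvg_comp r0 h.
Qed.

Lemma Cc_fun (eta g : X -> R) (F : R -> R) : Cc O eta -> continuous F ->
  (forall x, O x -> {for x, continuous g}) -> Cc O (fun x => eta x * F (g x)).
Proof.
move=> Oeta cF cg; apply: Cc_mul => // x Ox.
by apply: (@continuous_comp _ _ _ g F); [exact: cg | exact: cF].
Qed.

Lemma cts_sub (f g : X -> R) (x : X) : {for x, continuous f} -> {for x, continuous g} ->
  {for x, continuous (fun y => f y - g y)}.
Proof. by move=> cf cg; exact: continuousB. Qed.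

(** The divergence of the field [G = psi e (s - t) * (T s - T t)] is [psi' * (D s - D t).(T s - T t)
    + psi * (H1 s - H1 t)]. Tested against [eta], the divergence is controlled by [ibp_bound], which
    gives the term with [L]; the part with [H1] costs [c * e] times the two masses; what remains
    dominates the left side by [T_monotone]. *)
Lemma key_estimate (s t eta chi : X -> R) (K : set X) (L d e c : R) :
  (forall r, `|psi e r| <= c * e) ->
  sol s -> sol t -> compact K -> K `<=` O -> 0 < d -> 0 <= L -> 0 < e ->
  lip L eta -> (forall x, 0 <= eta x) -> (forall x, ~ K x -> eta x = 0) ->
  Cc O chi -> (forall x, 0 <= chi x) ->
  (forall x y, K x -> `|y - x| <= d -> chi y = 1) ->
  J (fun x => eta x * psi' e (s x - t x) * \sum_(i < n) (Tv s i x - Tv t i x) ^+ 2) <=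
  L * \sum_(i < n) J (fun x => chi x * `|psi e (s x - t x) * (Tv s i x - Tv t i x)|)
  + c * e * (I_ s eta + I_ t eta).
Proof.
move=> psic ss st cK KO d0 L0 e0 etaL eta0 etaK Ochi chi0 chiK.
have Oeta : Cc O eta by split; [exact: lip_cts etaL | exists K].
have cst_ x : O x -> {for x, continuous (fun y => s y - t y)}.
  by move=> Ox; apply: cts_sub; [case: ss => [[cf _ _] _] | case: st => [[cf _ _] _]]; exact: cf.
have cpsi x : O x -> {for x, continuous (fun y => psi e (s y - t y))}.
  move=> Ox; apply: (@continuous_comp _ _ _ (fun y => s y - t y) (psi e)); first exact: cst_.
  exact: cts_psi.
have cpsi' x : O x -> {for x, continuous (fun y => psi' e (s y - t y))}.
  move=> Ox; apply: (@continuous_comp _ _ _ (fun y => s y - t y) (psi' e)); first exact: cst_.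
  exact: cts_psi'.
have cTi i x : O x -> {for x, continuous (fun y => Tv s i y - Tv t i y)}.
  by move=> Ox; apply: cts_sub; [exact: (@cts_Tv _ _ O s i x ss.1 Ox) | exact: (@cts_Tv _ _ O t i x st.1 Ox)].
have cai i x : O x -> {for x, continuous (fun y => pderiv s i y - pderiv t i y)}.
  move=> Ox; case: ss => [[_ cs _] _]; case: st => [[_ ct _] _].
  by apply: cts_sub; [case: (cs i x Ox) | case: (ct i x Ox)].
pose G i (x : X) := psi e (s x - t x) * (Tv s i x - Tv t i x).
pose A i (x : X) := (pderiv s i x - pderiv t i x) * (Tv s i x - Tv t i x).
pose D i (x : X) := pderiv (Tv s i) i x - pderiv (Tv t i) i x.
have cDi i x : O x -> {for x, continuous (D i)}.
  by move=> Ox; apply: cts_sub; [exact: (@cts_pderiv_Tv _ _ O s i i x oO ss.1 Ox)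
    | exact: (@cts_pderiv_Tv _ _ O t i i x oO st.1 Ox)].
pose dG i (x : X) := psi e (s x - t x) * D i x + (Tv s i x - Tv t i x) * (psi' e (s x - t x) * (pderiv s i x - pderiv t i x)).
have hG i x : O x -> is_derive x (evec R i) (G i) (dG i x).
  move=> Ox; apply: is_derive_mul.
    apply: is_derive_chain; first exact: is_derive_psi.
    apply: is_derive_sub; apply: derivableP.
      by case: ss => [[_ cs _] _]; case: (cs i x Ox).
    by case: st => [[_ ct _] _]; case: (ct i x Ox).
  apply: is_derive_sub; apply: derivableP.
    by have [] := is_derive_Tv i i ss.1 Ox.
  by have [] := is_derive_Tv i i st.1 Ox.
have pG i x : O x -> pderiv (G i) i x = dG i x by move=> Ox; have [] := hG i x Ox.
have cG i x : O x -> {for x, continuous (G i)}.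
  by move=> Ox; apply: continuousM; [exact: cpsi | exact: cTi].
have cdG i x : O x -> {for x, continuous (pderiv (G i) i)}.
  move=> Ox; apply: (cts_eq_open oO Ox (pG i)); apply: continuousD.
    by apply: continuousM; [exact: cpsi | exact: cDi].
  apply: continuousM; first exact: cTi.
  by apply: continuousM; [exact: cpsi' | exact: cai].
have OdG i : Cc O (fun x => eta x * pderiv (G i) i x) by apply: Cc_mul => // x; exact: cdG.
have bnd i : `|J (fun x => eta x * pderiv (G i) i x)| <= L * J (fun x => chi x * `|G i x|).
  apply: (@ibp_bound _ _ lam hlam O K (G i) eta chi i L d) => //.
  - by move=> x; exact: cG.
  - by move=> x Ox; split; [have [] := hG i x Ox | exact: cdG].
have cA i x : O x -> {for x, continuous (A i)}.
  by move=> Ox; apply: continuousM; [exact: cai | exact: cTi].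
have csum (f : 'I_n -> X -> R) x : O x -> (forall i, {for x, continuous (f i)}) ->
    {for x, continuous (fun y => \sum_(i < n) f i y)}.
  by move=> Ox cf; apply: (@cvg_bigsum _ _ (nbhs x) _ _ _ _ f) => i; exact: cf.
have OA : Cc O (fun x => eta x * psi' e (s x - t x) * \sum_(i < n) A i x).
  apply: Cc_mul => //; first by apply: Cc_mul.
  by move=> x Ox; apply: csum => // i; exact: cA.
have OT : Cc O (fun x => eta x * psi' e (s x - t x) * \sum_(i < n) (Tv s i x - Tv t i x) ^+ 2).
  apply: Cc_mul => //; first by apply: Cc_mul.
  move=> x Ox; apply: csum => // i.
  rewrite (_ : (fun _ => _) = fun y => (Tv s i y - Tv t i y) * (Tv s i y - Tv t i y)) //.
  by apply: continuousM; exact: cTi.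
have OP : Cc O (fun x => eta x * (psi e (s x - t x) * (H1 s x - H1 t x))).
  apply: Cc_mul => // x Ox; apply: continuousM; first exact: cpsi.
  by apply: cts_sub; [exact: (cts_H1 oO ss.1 Ox) | exact: (cts_H1 oO st.1 Ox)].
apply: (@le_trans _ _ (J (fun x => eta x * psi' e (s x - t x) * \sum_(i < n) A i x))).
  apply: (le_J hlam OT OA) => x; apply: ler_wpM2l.
    by rewrite mulr_ge0 //; case/andP: (psi'_01 e (s x - t x)).
  exact: T_monotone.
have -> : J (fun x => eta x * psi' e (s x - t x) * \sum_(i < n) A i x) =
    \sum_(i < n) J (fun x => eta x * pderiv (G i) i x) -
    J (fun x => eta x * (psi e (s x - t x) * (H1 s x - H1 t x))).
  rewrite -J_sum // -(JB hlam (Cc_sum _ _ OdG) OP); congr (J _); apply/funext => x.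
  have [->|Ox] := Cc_zero_or x Oeta; first by rewrite !mul0r subr0 big1 // => i _; rewrite mul0r.
  rewrite -mulr_sumr -mulrBr -mulrA; congr (_ * _).
  rewrite -[H1 s x]/(\sum_(i < n) pderiv (Tv s i) i x) -[H1 t x]/(\sum_(i < n) pderiv (Tv t i) i x).
  rewrite -sumrB !mulr_sumr -sumrB; apply: eq_bigr => i _.
  rewrite pG // /dG /A /D.
  move: (psi e _) (psi' e _) (pderiv (Tv s i) i x) (pderiv (Tv t i) i x) => a b a' p.
  by move: (Tv s i x) (Tv t i x) (pderiv s i x) (pderiv t i x) => q r u v; ring.
apply: lerD.
  apply: le_trans (ler_norm _) _; apply: le_trans (ler_norm_sum _ _ _) _.
  by rewrite mulr_sumr; apply: ler_sum => i _; exact: bnd.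
apply: le_trans (ler_norm _) _; rewrite normrN; apply: le_trans (J_norm hlam OP) _.
have Oe f : sol f -> Cc O (fun x => eta x * H1 f x) by move=> sf; exact: Cc_H1.
rewrite -(JD hlam (Oe s ss) (Oe t st)) -(JZ hlam _ (CcD (Oe s ss) (Oe t st))).
apply: (le_J hlam (Cc_norm OP) (CcZ _ (CcD (Oe s ss) (Oe t st)))) => x.
have [->|Ox] := Cc_zero_or x Oeta.
  move: (psi e (s x - t x)) (H1 s x) (H1 t x) => z a b.
  by rewrite !mul0r normr0 addr0 mulr0.
rewrite normrM (ger0_norm (eta0 x)) -mulrDr [leRHS]mulrCA; apply: ler_wpM2l => //.
rewrite normrM; apply: ler_pM => //.
move: (ss.2 x Ox) (st.2 x Ox); move: (H1 s x) (H1 t x) => a b a0 b0.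
by apply: le_trans (ler_normB _ _) _; rewrite !ger0_norm.
Qed.

End Stability.

(** * Uniform approximation of test functions by Lipschitz functions *)

Section LipschitzApproximation.
Context {R : realType} {n : nat}.
Local Notation X := 'rV[R]_n.

(** Heine-Cantor. [g x] is the supremum, capped at 1, of the radii of balls about [x] on which [phi]
    varies by less than [e]. It is positive and 1-Lipschitz, so its minimum over [K] serves as
    [d]. *)
Lemma Cc_unif_cts (O : set X) (phi : X -> R) (e : R) : Cc O phi -> 0 < e ->
  exists2 d, 0 < d & forall x y, `|x - y| < d -> `|phi x - phi y| < e.
Proof.
move=> [cphi [K [cK _ pK]]] e0.
have h x : exists2 d, 0 < d & forall y z, `|y - x| < d -> `|z - x| < d -> `|phi y - phi z| < e.
  have /cts_atP/(_ (e / 2))[|d d0 hd] := cphi x; first by rewrite divr_gt0.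
  exists d => // y z /hd hy /hd hz; rewrite -(subrKA (phi x)) (le_lt_trans (ler_normD _ _)) //.
  by rewrite [e]splitr ltrD // distrC.
pose P x (r : R) := 0 <= r <= 1 /\ forall y z, `|y - x| < r -> `|z - x| < r -> `|phi y - phi z| < e.
pose g x := sup (P x).
have hs x : has_sup (P x).
  split; last by exists 1 => r [/andP[]].
  by exists 0; split; [rewrite lexx ler01 | move=> y z; rewrite ltNge normr_ge0].
have g0 x : 0 < g x.
  have [d d0 hd] := h x; apply: (@lt_le_trans _ _ (Num.min d 1)); first by rewrite lt_min d0 ltr01.
  apply: ub_le_sup; first by case: (hs x).
  split; first by rewrite le_min ltW //= ler01 ge_min lexx orbT.
  by move=> y z; rewrite !lt_min => /andP[yx _] /andP[zx _]; exact: hd.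
have gl : lip 1 g.
  suff H x y : g x <= g y + `|x - y|.
    move=> x y; rewrite mul1r ler_norml lerBlDl H andbT lerNl opprB lerBlDl.
    by rewrite distrC H.
  apply: ge_sup; first by case: (hs x).
  move=> r [/andP[r0 r1] hr]; have [rx|rx] := leP r `|x - y|.
    by rewrite (le_trans rx) // lerDr ltW.
  rewrite -lerBlDr; apply: ub_le_sup; first by case: (hs y).
  split; first by rewrite subr_ge0 ltW //= lerBlDr (le_trans r1) // lerDl.
  have tri z : `|z - y| < r - `|x - y| -> `|z - x| < r.
    rewrite ltrBrDr => zy; apply: le_lt_trans zy.
    by rewrite -(subrKA y z) (le_trans (ler_normD _ _)) // lerD2l distrC.
  by move=> z w /tri hz /tri hw; exact: hr.
have [K0|/set0P[x0 Kx0]] := eqVneq K set0.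
  by exists 1 => // x y _; rewrite !pK ?K0 // subrr normr0.
have cg : {within K, continuous g} by apply: continuous_subspaceT; exact: lip_cts gl.
have [x1 Kx1 hx1] := @compact_EVT_min _ _ g K (ex_intro _ x0 Kx0) cK cg.
have key x y : K x -> `|x - y| < g x1 -> `|phi x - phi y| < e.
  move=> Kx xy; have gx : g x1 <= g x by apply: hx1; rewrite inE.
  have /sup_gt : `|x - y| < g x by exact: lt_le_trans gx.
  case; first by case: (hs x).
  move=> r [_ hr] xr; apply: hr; last by rewrite distrC.
  by rewrite subrr normr0 (le_lt_trans _ xr).
exists (g x1) => // x y xy; have [Kx|Kx] := pselect (K x); first exact: key.
have [Ky|Ky] := pselect (K y); first by rewrite distrC; apply: key => //; rewrite distrC.
by rewrite !pK // subrr normr0.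
Qed.

(** The approximation is the infimal convolution of [phi] with [L * |x|]. With [L = M / d], points
    at distance [d] or more contribute at least [M], and nearer ones have values of [phi] within
    [e]. *)
Lemma lip_approx (O : set X) (phi : X -> R) (e : R) : Cc O phi -> 0 < e ->
  (forall x, 0 <= phi x) ->
  exists L psi, [/\ 0 <= L, lip L psi & forall x, 0 <= psi x <= phi x /\ phi x <= psi x + e].
Proof.
move=> Op e0 p0; have [M M0 hM] := Cc_bounded Op.
have [d d0 hd] := Cc_unif_cts Op e0.
pose L := M / d; have L0 : 0 <= L by rewrite divr_ge0 // ltW.
pose P x := [set phi y + L * `|x - y| | y in [set: X]].
have hi x : has_inf (P x).
  split; first by exists (phi x + L * `|x - x|); exists x.
  by exists 0 => _ [y _ <-]; rewrite addr_ge0 // mulr_ge0.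
exists L, (fun x => inf (P x)); split => //.
  suff H x y : inf (P x) <= inf (P y) + L * `|x - y|.
    move=> x y; rewrite ler_norml lerBlDl H andbT lerNl opprB lerBlDl.
    by rewrite distrC H.
  rewrite -lerBlDr; apply: lb_le_inf; first by case: (hi y).
  move=> _ [z _ <-]; rewrite lerBlDr; apply: (@le_trans _ _ (phi z + L * `|x - z|)).
    by apply: ge_inf; [case: (hi x) | exists z].
  rewrite -addrA lerD2l -mulrDr ler_wpM2l // -(subrKA y x) addrC.
  by rewrite (le_trans (ler_normD _ _)) // addrC.
move=> x; split.
  apply/andP; split.
    apply: lb_le_inf; first by case: (hi x).
    by move=> _ [y _ <-]; rewrite addr_ge0 // mulr_ge0.
  by apply: ge_inf; [case: (hi x) | exists x => //; rewrite subrr normr0 mulr0 addr0].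
rewrite -lerBlDr; apply: lb_le_inf; first by case: (hi x).
move=> _ [y _ <-]; rewrite lerBlDr.
have [xy|xy] := ltP `|x - y| d.
  have := hd _ _ xy; have : 0 <= L * `|x - y| by rewrite mulr_ge0.
  by rewrite ltr_norml => ? /andP[_ ?]; lra.
apply: (@le_trans _ _ (L * `|x - y|)); last by have := p0 y; lra.
apply: (@le_trans _ _ (L * d)); last by rewrite ler_wpM2l.
by rewrite /L divfK ?gt_eqF // (le_trans _ (hM x)) // ler_norm.
Qed.

End LipschitzApproximation.

(** * Convergence of curvature integrals along sequences of solutions *)

Section CurvatureStability.
Context {R : realType} {n : nat}.
Local Notation X := 'rV[R]_n.
Local Notation B := (borelRn R n).
Variable lam : {measure set B -> \bar R}.
Hypothesis hlam : is_lebesgue lam.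
Variable O : set X.
Hypothesis oO : open O.
Local Notation J := (J lam).
Local Notation sol := (sol O).
Local Notation I_ := (I_ lam).

Lemma psi_bound_ex : exists2 c : R, 0 < c & forall e, 0 < e -> forall r, `|psi e r| <= c * e.
Proof. by exists pi; [exact: pi_gt0 | move=> e e0 r; exact: psi_bound]. Qed.

Lemma cvgZ0 (a : R) (u : nat -> R) : u @ \oo --> 0 -> (fun j => a * u j) @ \oo --> 0.
Proof. by move=> h; have := @cvgM _ _ \oo _ (cst a) u a 0 (cvg_cst a) h; rewrite mulr0; apply. Qed.

Section Sequences.
Variables s_ t_ : nat -> X -> R.
Hypothesis ss : forall j, sol (s_ j).
Hypothesis st : forall j, sol (t_ j).
Hypothesis st0 : {ae lam, forall x : B, O x -> (fun j => s_ j x - t_ j x) @ \oo --> 0}.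

Lemma cts_diff j x : O x -> {for x, continuous (fun y => s_ j y - t_ j y)}.
Proof.
by move=> Ox; apply: cts_sub; [case: (ss j) => [[cf _ _] _] | case: (st j) => [[cf _ _] _]]; exact: cf.
Qed.

Lemma cts_Tdiff j i x : O x -> {for x, continuous (fun y => Tv (s_ j) i y - Tv (t_ j) i y)}.
Proof.
by move=> Ox; apply: cts_sub; [exact: (@cts_Tv _ _ O (s_ j) i x (ss j).1 Ox)
  | exact: (@cts_Tv _ _ O (t_ j) i x (st j).1 Ox)].
Qed.

Lemma Tdiff_le2 j i x : `|Tv (s_ j) i x - Tv (t_ j) i x| <= 2.
Proof.
apply: le_trans (ler_normB _ _) _.
by have := Tv_le1 (s_ j) i x; have := Tv_le1 (t_ j) i x; lra.
Qed.

Lemma Cc_sqT j (eta : X -> R) : Cc O eta ->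
  Cc O (fun x => eta x * \sum_(i < n) (Tv (s_ j) i x - Tv (t_ j) i x) ^+ 2).
Proof.
move=> Oeta; apply: Cc_mul => // x Ox.
apply: (@cvg_bigsum _ _ (nbhs x) _ _ _ _ (fun i y => (Tv (s_ j) i y - Tv (t_ j) i y) ^+ 2)) => i.
have h := @cts_Tdiff j i x Ox.
rewrite (_ : (fun _ => _) = fun y => (Tv (s_ j) i y - Tv (t_ j) i y) * (Tv (s_ j) i y - Tv (t_ j) i y)) //.
exact: (cvgM h h).
Qed.

(** The parameter of [psi] is fixed before the limit: it makes the curvature term of [key_estimate]
    small for all [j]. The other terms, including the cost of replacing [psi'] by 1, tend to 0 by
    dominated convergence. *)
Lemma T_cvg (eta : X -> R) (L : R) : Cc O eta -> (forall x, 0 <= eta x) -> 0 <= L -> lip L eta ->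
  (fun j => J (fun x => eta x * \sum_(i < n) (Tv (s_ j) i x - Tv (t_ j) i x) ^+ 2)) @ \oo --> 0.
Proof.
move=> Oeta eta0 L0 etaL; have [ceta [K [cK KO etaK]]] := Oeta.
have [d [L1 [chi [d0 _ Ochi _ [chi01 chiK]]]]] := nbhd_cutoff oO cK KO.
have chi0 x : 0 <= chi x by case/andP: (chi01 x).
have [M M0 hM] := Cc_bounded Oeta.
have [C C0 hC] := mass_bound hlam oO cK KO.
have [c c0 psic] := psi_bound_ex.
pose m := M * C; have m0 : 0 <= m by rewrite mulr_ge0 // ltW.
have Im f : sol f -> I_ f eta <= m.
  by move=> sf; apply: le_trans (ler_norm _) _; exact: hC.
apply/cvgrPdist_lt => e e0.
pose k := 2 * c * m + 1; have k0 : 0 < k by rewrite ltr_wpDl // !mulr_ge0 // ltW.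
(* Each of the two masses is at most [m], so with this [ep] they contribute at most [e / 3] whatever
   [j] is; the [+ 1] in [k] keeps the divisor positive. *)
pose ep := e / (3 * k); have ep0 : 0 < ep by rewrite divr_gt0 // mulr_gt0.
have epm : c * ep * (m + m) <= e / 3.
  rewrite /ep (_ : c * _ * _ = (2 * c * m) * (e / 3) / k); last by field; rewrite gt_eqF.
  rewrite ler_pdivrMr // mulrC ler_pM2l ?divr_gt0 // /k; lra.
pose a j := J (fun x => chi x * `|psi ep (s_ j x - t_ j x)|).
pose b j := J (fun x => eta x * (1 - psi' ep (s_ j x - t_ j x))).
have ca : continuous (fun r => `|psi ep r|).
  move=> r; apply: (@continuous_comp _ _ _ (psi ep) (fun r : R => `|r|)); first exact: cts_psi.
  exact: norm_continuous.
have cb : continuous (fun r => 1 - psi' ep r).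
  move=> r; apply: continuousB; [exact: cst_continuous | exact: cts_psi'].
have Oa j : Cc O (fun x => chi x * `|psi ep (s_ j x - t_ j x)|).
  by apply: (Cc_fun oO Ochi ca) => x; exact: cts_diff.
have Ob j : Cc O (fun x => eta x * (1 - psi' ep (s_ j x - t_ j x))).
  by apply: (Cc_fun oO Oeta cb) => x; exact: cts_diff.
have Jz : J (fun=> 0) = 0.
  rewrite -[RHS](mul0r (J (fun=> 0))) -(JZ hlam 0 (@Cc0 R n O)).
  by congr (J _); apply/funext => x; rewrite mul0r.
have acvg : a @ \oo --> 0.
  rewrite -Jz; apply: (J_dct hlam Oa (@Cc0 R n O) (CcZ (c * ep) Ochi)).
    move=> j x; rewrite normrM normr_id mulrC ger0_norm // ler_wpM2r //.
    exact: psic.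
  apply: filterS st0 => x hx; have [->|Ox] := Cc_zero_or x Ochi.
    by rewrite (_ : (fun _ => _) = fun=> 0); [exact: cvg_cst | apply/funext => j; rewrite mul0r].
  rewrite -(mulr0 (chi x)); apply: cvgM; first exact: cvg_cst.
  apply/(norm_cvg0P (F := \oo) (fun j => psi ep (s_ j x - t_ j x))).
  exact: (psi_cvg ep0 (hx Ox)).
have bcvg : b @ \oo --> 0.
  rewrite -Jz; apply: (J_dct hlam Ob (@Cc0 R n O) Oeta).
    move=> j x; rewrite normrM ger0_norm // ler_piMr //.
    have /andP[p1 p2] := psi'_01 ep (s_ j x - t_ j x).
    by rewrite ger0_norm ?subr_ge0 // lerBlDr lerDl.
  apply: filterS st0 => x hx; have [->|Ox] := Cc_zero_or x Oeta.
    by rewrite (_ : (fun _ => _) = fun=> 0); [exact: cvg_cst | apply/funext => j; rewrite mul0r].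
  rewrite -(mulr0 (eta x)); apply: cvgM; first exact: cvg_cst.
  rewrite -[X in _ --> X](subrr (1 : R)); apply: cvgB; first exact: cvg_cst.
  exact: (psi'_cvg ep (hx Ox)).
(* The factor 2 bounds a component of [T s - T t] and 4 bounds its square; there are [n]
   components. *)
pose F j := 2 * L * n%:R * a j + 4 * n%:R * b j.
have Fcvg : F @ \oo --> 0.
  by have := cvgD (cvgZ0 (2 * L * n%:R) acvg) (cvgZ0 (4 * n%:R) bcvg); rewrite addr0; apply.
have main j : J (fun x => eta x * \sum_(i < n) (Tv (s_ j) i x - Tv (t_ j) i x) ^+ 2) <= F j + e / 3.
  have OT : Cc O (fun x => eta x * psi' ep (s_ j x - t_ j x) * \sum_(i < n) (Tv (s_ j) i x - Tv (t_ j) i x) ^+ 2).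
    by apply: Cc_sqT; apply: (Cc_fun oO Oeta (@cts_psi' R ep)) => x; exact: cts_diff.
  apply: (@le_trans _ _ (J (fun x => eta x * psi' ep (s_ j x - t_ j x) * \sum_(i < n) (Tv (s_ j) i x - Tv (t_ j) i x) ^+ 2) + 4 * n%:R * b j)).
    rewrite /b -(JZ hlam _ (Ob j)) -(JD hlam OT (CcZ _ (Ob j))).
    apply: (le_J hlam (Cc_sqT j Oeta) (CcD OT (CcZ _ (Ob j)))) => x.
    have hS : \sum_(i < n) (Tv (s_ j) i x - Tv (t_ j) i x) ^+ 2 <= 4 * n%:R.
      apply: (@le_trans _ _ (\sum_(i < n) 4)); last by rewrite sumr_const card_ord mulr_natr.
      apply: ler_sum => i _; have := Tdiff_le2 j i x; rewrite ler_norml => /andP[h1 h2]; nra.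
    move: hS; move: (\sum_(i < n) _) => S hS.
    have /andP[p1 p2] := psi'_01 ep (s_ j x - t_ j x); have e1 := eta0 x.
    move: (psi' _ _) p1 p2 => p p1 p2.
    have : 0 <= eta x * (1 - p) * (4 * n%:R - S).
      by rewrite !mulr_ge0 // subr_ge0.
    lra.
  rewrite /F addrAC; apply: lerD => //.
  apply: le_trans (key_estimate hlam oO (psic ep ep0) (ss j) (st j) cK KO d0 L0 ep0 etaL eta0 etaK Ochi chi0 chiK) _.
  apply: lerD; last first.
    apply: le_trans epm; apply: ler_wpM2l; first by rewrite mulr_ge0 // ltW.
    by apply: lerD; exact: Im.
  rewrite (_ : 2 * L * n%:R * a j = L * \sum_(i < n) (2 * a j)); last first.
    by rewrite sumr_const card_ord -mulr_natr; ring.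
  apply: ler_wpM2l => //; apply: ler_sum => i _.
  rewrite /a -(JZ hlam _ (Oa j)); apply: (le_J hlam _ (CcZ _ (Oa j))).
    apply: (@Cc_mul _ _ O) => // x Ox.
    apply: (@continuous_comp _ _ _ (fun y => psi ep (s_ j y - t_ j y) * (Tv (s_ j) i y - Tv (t_ j) i y)) (fun r : R => `|r|)); last exact: norm_continuous.
    apply: continuousM; last exact: cts_Tdiff.
    by apply: (@continuous_comp _ _ _ (fun y => s_ j y - t_ j y) (psi ep)); [exact: cts_diff | exact: cts_psi].
  move=> x; rewrite mulrCA; apply: ler_wpM2l => //.
  by rewrite normrM mulrC ler_wpM2r // Tdiff_le2.
have := Fcvg => /cvgrPdist_lt /(_ (e / 3)) hF.
have e3 : 0 < e / 3 by rewrite divr_gt0.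
have := hF e3; apply: filterS => j; rewrite sub0r normrN => hj.
rewrite sub0r normrN ger0_norm; last first.
  apply: J_ge0 => x; rewrite mulr_ge0 // sumr_ge0 // => i _; exact: sqr_ge0.
apply: le_lt_trans (main j) _; have := ler_norm (F j); lra.
Qed.

(** The two integrals differ by the divergence of [T s - T t] tested against [phi]. Integration by
    parts bounds this by an L^1 norm, whereas [T_cvg] controls an L^2 norm. *)
Lemma I_cvg_lip (phi : X -> R) (L : R) : Cc O phi -> 0 <= L -> lip L phi ->
  (fun j => I_ (s_ j) phi - I_ (t_ j) phi) @ \oo --> 0.
Proof.
move=> Op L0 pL; have [cp [K [cK KO pK]]] := Op.
have [d [L1 [chi [d0 L10 Ochi chiL [chi01 chiK]]]]] := nbhd_cutoff oO cK KO.
have chi0 x : 0 <= chi x by case/andP: (chi01 x).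
have Tc := T_cvg Ochi chi0 (ltW L10) chiL.
have Jchi : 0 <= J chi by exact: J_ge0.
apply/cvgrPdist_lt => e e0.
pose k := L * n%:R * J chi + 1; have k0 : 0 < k by rewrite ltr_wpDl // !mulr_ge0.
pose de := e / (2 * k); have de0 : 0 < de by rewrite divr_gt0 // mulr_gt0.
have dek : L * n%:R * J chi * de <= e / 2.
  rewrite /de (_ : L * _ * _ * _ = (L * n%:R * J chi) * (e / 2) / k); last by field; rewrite gt_eqF.
  rewrite ler_pdivrMr // mulrC ler_pM2l ?divr_gt0 // /k; lra.
have cD j i x : O x -> {for x, continuous (fun y => pderiv (Tv (s_ j) i) i y - pderiv (Tv (t_ j) i) i y)}.
  by move=> Ox; apply: cts_sub; [exact: (@cts_pderiv_Tv _ _ O (s_ j) i i x oO (ss j).1 Ox)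
    | exact: (@cts_pderiv_Tv _ _ O (t_ j) i i x oO (st j).1 Ox)].
have main j : `|I_ (s_ j) phi - I_ (t_ j) phi| <=
    e / 2 + L / de * J (fun x => chi x * \sum_(i < n) (Tv (s_ j) i x - Tv (t_ j) i x) ^+ 2).
  pose g i x := Tv (s_ j) i x - Tv (t_ j) i x.
  have hg i x : O x -> is_derive x (evec R i) (g i) (pderiv (Tv (s_ j) i) i x - pderiv (Tv (t_ j) i) i x).
    move=> Ox; apply: is_derive_sub; apply: derivableP.
      by have [] := is_derive_Tv i i (ss j).1 Ox.
    by have [] := is_derive_Tv i i (st j).1 Ox.
  have pg i x : O x -> pderiv (g i) i x = pderiv (Tv (s_ j) i) i x - pderiv (Tv (t_ j) i) i x.
    by move=> Ox; have [] := hg i x Ox.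
  have cg i x : O x -> {for x, continuous (pderiv (g i) i)}.
    by move=> Ox; apply: (cts_eq_open oO Ox (pg i)); exact: cD.
  have Og i : Cc O (fun x => phi x * pderiv (g i) i x) by apply: Cc_mul => // x; exact: cg.
  have Ocg i : Cc O (fun x => chi x * `|g i x|).
    apply: Cc_mul => // x Ox; apply: (@continuous_comp _ _ _ (g i) (fun r : R => `|r|)).
      exact: cts_Tdiff.
    exact: norm_continuous.
  have -> : I_ (s_ j) phi - I_ (t_ j) phi = \sum_(i < n) J (fun x => phi x * pderiv (g i) i x).
    rewrite -(J_sum hlam Og) /I_ -(JB hlam (Cc_H1 oO (ss j) Op) (Cc_H1 oO (st j) Op)).
    congr (J _); apply/funext => x.
    have [->|Ox] := Cc_zero_or x Op.
      move: (H1 (s_ j) x) (H1 (t_ j) x) => a b.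
      by rewrite big1 ?mul0r ?subr0 // => i _; rewrite mul0r.
    rewrite -mulr_sumr -mulrBr; congr (_ * _).
    rewrite -[H1 (s_ j) x]/(\sum_(i < n) pderiv (Tv (s_ j) i) i x).
    rewrite -[H1 (t_ j) x]/(\sum_(i < n) pderiv (Tv (t_ j) i) i x).
    by rewrite -sumrB; apply: eq_bigr => i _; rewrite pg.
  apply: le_trans (ler_norm_sum _ _ _) _.
  apply: (@le_trans _ _ (\sum_(i < n) L * J (fun x => chi x * `|g i x|))).
    apply: ler_sum => i _; apply: (@ibp_bound _ _ lam hlam O K (g i) phi chi i L d) => //.
    - by move=> x Ox; exact: cts_Tdiff.
    - by move=> x Ox; split; [have [] := hg i x Ox | exact: cg].
  rewrite -mulr_sumr -(J_sum hlam Ocg).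
  (* Young's inequality [|r| <= de + r ^+ 2 / de] for each component. The first part is at most
     [e / 2] by the choice of [de]; the second tends to 0 once [de] is fixed. *)
  apply: (@le_trans _ _ (L * (n%:R * de * J chi + de^-1 * J (fun x => chi x * \sum_(i < n) (Tv (s_ j) i x - Tv (t_ j) i x) ^+ 2)))).
    apply: ler_wpM2l => //.
    rewrite -(JZ hlam _ Ochi) -(JZ hlam _ (Cc_sqT j Ochi)).
    rewrite -(JD hlam (CcZ _ Ochi) (CcZ _ (Cc_sqT j Ochi))).
    apply: (le_J hlam (Cc_sum _ _ Ocg) (CcD (CcZ _ Ochi) (CcZ _ (Cc_sqT j Ochi)))) => x.
    rewrite -mulr_sumr [n%:R * de * chi x]mulrC [de^-1 * _]mulrCA -mulrDr ler_wpM2l //.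
    rewrite (_ : n%:R * de = \sum_(i < n) de); last by rewrite sumr_const card_ord mulr_natl.
    rewrite mulr_sumr -big_split /=; apply: ler_sum => i _.
    rewrite -/(g i x); move: (g i x) => r.
    rewrite -real_normK ?num_real //; have := normr_ge0 r; move: `|r| => a a0.
    rewrite (_ : de + de^-1 * a ^+ 2 = a + (a ^+ 2 - a * de + de ^+ 2) / de); last by field; rewrite gt_eqF.
    by rewrite lerDl divr_ge0 ?ltW //; have := sqr_ge0 (a - de); have := sqr_ge0 (a + de); nra.
  rewrite mulrDr mulrA; apply: lerD; last by rewrite mulrA.
  by rewrite (_ : L * (n%:R * de) * J chi = L * n%:R * J chi * de) //; ring.
have Lde : 0 <= L / de by rewrite divr_ge0 // ltW.
have hT : (fun j => L / de * J (fun x => chi x * \sum_(i < n) (Tv (s_ j) i x - Tv (t_ j) i x) ^+ 2)) @ \oo --> 0.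
  exact: (cvgZ0 _ Tc).
have e2 : 0 < e / 2 by rewrite divr_gt0.
move/cvgrPdist_lt : hT => /(_ (e / 2) e2); apply: filterS => j.
rewrite !sub0r !normrN => hj; apply: le_lt_trans (main j) _.
rewrite [X in _ < X]splitr ltrD2l; apply: le_lt_trans hj; exact: ler_norm.
Qed.

(** A Lipschitz [q] with [0 <= q <= phi] also vanishes off [K], so by [mass_bound] replacing [phi]
    by [q] costs at most [de * C], uniformly in [j]. *)
Lemma I_cvg_ge0 (phi : X -> R) : Cc O phi -> (forall x, 0 <= phi x) ->
  (fun j => I_ (s_ j) phi - I_ (t_ j) phi) @ \oo --> 0.
Proof.
move=> Op p0; have [cp [K [cK KO pK]]] := Op.
have [C C0 hC] := mass_bound hlam oO cK KO.
apply/cvgrPdist_lt => e e0.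
pose de := e / (3 * (C + 1)); have C1 : 0 < C + 1 by rewrite ltr_wpDl.
have de0 : 0 < de by rewrite divr_gt0 // mulr_gt0.
have deC : de * C < e / 3.
  rewrite /de (_ : _ * C = C * (e / 3) / (C + 1)); last by field; rewrite gt_eqF.
  by rewrite ltr_pdivrMr // mulrC ltr_pM2l ?divr_gt0 // ltrDl.
have [L [q [L0 qL hq]]] := lip_approx Op de0 p0.
have qK x : ~ K x -> q x = 0.
  move=> /pK px; have [/andP[a b] _] := hq x; apply/eqP; rewrite eq_le a andbT.
  by rewrite -px.
have Oq : Cc O q by split; [exact: lip_cts qL | exists K].
have Opq : Cc O (fun x => phi x + -1 * q x) by apply: CcD => //; exact: CcZ.
have diff f : sol f -> `|I_ f phi - I_ f q| <= de * C.
  move=> sf; rewrite (_ : I_ f phi - I_ f q = I_ f (fun x => phi x + -1 * q x)); last first.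
    by rewrite (I_D hlam oO sf Op (CcZ _ Oq)) (I_Z hlam oO _ sf Oq) mulN1r.
  apply: hC => // x; first by move=> Kx; rewrite pK // qK // mulr0 addr0.
  have [/andP[a b] c] := hq x; rewrite mulN1r ger0_norm ?subr_ge0 // lerBlDl //.
have e3 : 0 < e / 3 by rewrite divr_gt0.
have /cvgrPdist_lt/(_ _ e3) := I_cvg_lip Oq L0 qL; apply: filterS => j.
rewrite !sub0r !normrN => hj.
have := diff _ (ss j); have := diff _ (st j).
move: hj; move: (I_ (s_ j) phi) (I_ (s_ j) q) (I_ (t_ j) phi) (I_ (t_ j) q) => a b c f.
rewrite !ltr_norml !ler_norml => /andP[h1 h2] /andP[h3 h4] /andP[h5 h6]; apply/andP; split; lra.
Qed.

Lemma I_cvg (phi : X -> R) : Cc O phi ->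
  (fun j => I_ (s_ j) phi - I_ (t_ j) phi) @ \oo --> 0.
Proof.
move=> Op.
have Opp := Cc_pos Op; have Opn := Cc_neg Op.
have c1 := I_cvg_ge0 Opp (fun x => _); have c2 := I_cvg_ge0 Opn (fun x => _).
rewrite -(subrr (0 : R)).
rewrite (_ : (fun _ => _) = fun j => (I_ (s_ j) (fun x => Num.max (phi x) 0) - I_ (t_ j) (fun x => Num.max (phi x) 0)) -
   (I_ (s_ j) (fun x => Num.max (- phi x) 0) - I_ (t_ j) (fun x => Num.max (- phi x) 0))).
  by apply: cvgB; [apply: c1 | apply: c2] => x; rewrite le_max lexx orbT.
apply/funext => j; rewrite (I_pos_neg hlam oO (ss j) Op) (I_pos_neg hlam oO (st j) Op).
move: (I_ (s_ j) _) (I_ (t_ j) _) (I_ (s_ j) _) (I_ (t_ j) _) => a b c f; ring.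
Qed.

End Sequences.
End CurvatureStability.

(** * The Riesz representation theorem on an open set *)

Section Riesz.
Context {R : realType} {n : nat}.
Local Notation X := 'rV[R]_n.
Local Notation B := (borelRn R n).

Lemma Cc_integrable_radon (mu : {measure set B -> \bar R}) (O : set X) (f : X -> R) :
  radon_on O mu -> Cc O f -> mu.-integrable setT (EFin \o (f : B -> R)).
Proof.
move=> [_ mufin] Of; have [M M0 fM] := Cc_bounded Of; case: Of => cf [K [cK KO fK]].
have mK := compact_borel cK.
have : mu.-integrable K (EFin \o (f : B -> R)).
  apply: measurable_bounded_integrable => //; first exact: mufin.
    by apply: measurable_funTS; exact: continuous_borel.
  by exists M; split; [exact: num_real | move=> x Mx y _; apply: le_trans (ltW Mx)].
rewrite integrable_mkcond // (_ : _ \_ K = EFin \o f) //.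
apply/funext => x; rewrite /patch; case: ifPn => // /negP xK.
by rewrite /= fK // => Kx; apply: xK; exact: mem_set.
Qed.

Variable O : set X.
Hypothesis oO : open O.
Variable Lam : (X -> R) -> R.
Hypothesis LamD : forall f g, Cc O f -> Cc O g -> Lam (fun x => f x + g x) = Lam f + Lam g.
Hypothesis LamZ : forall a f, Cc O f -> Lam (fun x => a * f x) = a * Lam f.
Hypothesis Lam_ge0 : forall f, Cc O f -> (forall x, 0 <= f x) -> 0 <= Lam f.

Lemma CcB f g : Cc O f -> Cc O g -> Cc O (fun x => f x - g x).
Proof.
move=> Of Og; rewrite (_ : (fun _ => _) = fun x => f x + -1 * g x).
  by apply: CcD => //; exact: CcZ.
by apply/funext => x; rewrite mulN1r.
Qed.

Lemma LamB f g : Cc O f -> Cc O g -> Lam (fun x => f x - g x) = Lam f - Lam g.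
Proof.
move=> Of Og; rewrite (_ : (fun _ => _) = fun x => f x + -1 * g x).
  by rewrite LamD ?LamZ ?mulN1r //; exact: CcZ.
by apply/funext => x; rewrite mulN1r.
Qed.

Lemma le_Lam f g : Cc O f -> Cc O g -> (forall x, f x <= g x) -> Lam f <= Lam g.
Proof.
move=> Of Og fg; rewrite -subr_ge0 -LamB //; apply: Lam_ge0; first exact: CcB.
by move=> x; rewrite subr_ge0.
Qed.

Lemma Lam0 : Lam (fun=> 0) = 0.
Proof.
rewrite -[RHS](mul0r (Lam (fun=> 0))) -(LamZ 0 (@Cc0 R n O)); congr Lam.
by apply/funext => x; rewrite mul0r.
Qed.

Lemma Lam_sum (N : nat) (f : nat -> X -> R) : (forall i, Cc O (f i)) ->
  Lam (fun x => \sum_(i < N) f i x) = \sum_(i < N) Lam (f i).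
Proof.
move=> Of; elim: N => [|N IH].
  by rewrite big_ord0 -[RHS]Lam0; congr Lam; apply/funext => x; rewrite big_ord0.
rewrite big_ord_recr /= -IH -LamD //; last exact: Cc_sum.
by congr Lam; apply/funext => x; rewrite big_ord_recr.
Qed.

(** The support of [f] is compact in [O] but may reach the boundary of [U]. This admits functions
    such as [min (f, N * depth U)]; where room inside [U] is required, [trunc] provides it. *)
Definition below (U : set X) : set (X -> R) :=
  [set f | [/\ Cc O f, forall x, 0 <= f x <= 1 & forall x, ~ U x -> f x = 0]].

Definition rm (U : set X) : \bar R := ereal_sup [set (Lam f)%:E | f in below U].

Definition rmu (A : set X) : \bar R :=
  ereal_inf [set rm U | U in [set U | open U /\ A `<=` U]].

Lemma below0 U : below U (fun=> 0).
Proof. by split => // [|x]; [exact: Cc0 | rewrite lexx ler01]. Qed.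

Lemma rm_ge U f : below U f -> ((Lam f)%:E <= rm U)%E.
Proof. by move=> Uf; apply: ereal_sup_ubound; exists f. Qed.

Lemma rm_ge0 U : (0 <= rm U)%E.
Proof. by have := rm_ge (below0 U); rewrite Lam0. Qed.

Lemma le_rm U V : U `<=` V -> (rm U <= rm V)%E.
Proof.
move=> UV; apply: ge_ereal_sup => _ [f [Of f01 fU] <-]; apply: rm_ge; split => //.
by move=> x Vx; apply: fU => /UV.
Qed.

Lemma rmu_ge0 A : (0 <= rmu A)%E.
Proof. by apply: le_ereal_inf_tmp => _ [U _ <-]; exact: rm_ge0. Qed.

Lemma rmu_le A U : open U -> A `<=` U -> (rmu A <= rm U)%E.
Proof. by move=> oU AU; apply: ereal_inf_lbound; exists U. Qed.

Lemma rmu_open U : open U -> rmu U = rm U.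
Proof.
move=> oU; apply/eqP; rewrite eq_le rmu_le //=.
by apply: le_ereal_inf_tmp => _ [V [_ UV] <-]; exact: le_rm.
Qed.

Lemma rm0 : rm set0 = 0%E.
Proof.
apply/eqP; rewrite eq_le rm_ge0 andbT; apply: ge_ereal_sup => _ [f [_ _ f0] <-].
rewrite (_ : f = fun=> 0) ?Lam0 //; apply/funext => x; exact: f0.
Qed.

Lemma le_rmu A A' : A `<=` A' -> (rmu A <= rmu A')%E.
Proof.
move=> AA'; apply: le_ereal_inf_tmp => _ [U [oU A'U] <-].
by apply: rmu_le => //; exact: subset_trans A'U.
Qed.

Definition trunc (e : R) (f : X -> R) (x : X) : R := Num.max (f x - e) 0.

Lemma trunc_ge0 e f x : 0 <= trunc e f x.
Proof. by rewrite /trunc le_max lexx orbT. Qed.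

Lemma trunc_le e f x : 0 <= e -> 0 <= f x -> trunc e f x <= f x.
Proof. by move=> e0 f0; rewrite /trunc ge_max f0 andbT lerBlDr lerDl. Qed.

Lemma Cc_trunc e f : 0 <= e -> Cc O f -> Cc O (trunc e f).
Proof.
move=> e0; apply: (@Cc_comp _ _ O (fun r => Num.max (r - e) 0)).
  move=> r; apply: (@continuous_max _ _ (fun r => r - e) (cst 0)); last exact: cst_continuous.
  by apply: (@continuousB _ _ _ id (cst e)) => //; exact: cst_continuous.
by apply/max_idPr; rewrite sub0r oppr_le0.
Qed.

(** [f <= trunc e f + e * eta] for a cut-off [eta] equal to 1 on a compact set carrying [f]; [C] is
    [Lam eta]. *)
Lemma Lam_trunc f : Cc O f -> exists2 C, 0 <= C & forall e, 0 <= e ->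
  Lam f <= Lam (trunc e f) + e * C.
Proof.
move=> Of; have [_ [K [cK KO fK]]] := Of.
have [d [L [eta [d0 _ Oeta _ [eta01 etaK]]]]] := nbhd_cutoff oO cK KO.
exists (Lam eta) => [|e e0]; first by apply: Lam_ge0 => // x; case/andP: (eta01 x).
rewrite -LamZ // -LamD //; [|exact: Cc_trunc|exact: CcZ].
apply: le_Lam => //; first by apply: CcD; [exact: Cc_trunc | exact: CcZ].
move=> x; have [Kx|Kx] := pselect (K x).
  rewrite (etaK x x Kx) ?subrr ?normr0; last exact: ltW.
  by rewrite mulr1 -lerBlDr /trunc le_max lexx.
by rewrite fK // addr_ge0 ?trunc_ge0 // mulr_ge0 //; case/andP: (eta01 x).
Qed.

Lemma superlevel_compact f (e : R) : 0 < e -> Cc O f -> compact [set x | e <= f x].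
Proof.
move=> e0 [cf [K [cK KO fK]]]; apply: (subclosed_compact _ cK).
  by apply: (@closed_comp _ _ f [set r | e <= r]) => [x _|]; [exact: cf | exact: closed_ge].
move=> x /= ex; apply: contrapT => /fK fx; move: ex; rewrite fx leNgt e0 //.
Qed.

Lemma open_gtf (f : X -> R) (a : R) : continuous f -> open [set x | a < f x].
Proof.
move=> cf; apply: (@open_comp _ _ f [set r | a < r]) => [x _|]; [exact: cf | exact: open_gt].
Qed.

(** In place of a partition of unity: on the compact set where [f >= e], some
    [min (f, N * depth (U i))] with [i < N] equals [f]. So [trunc e f] is at most the sum of these
    [N] functions, each of which lies below its [U i]. *)
Lemma rm_bigcup (U : nat -> set X) : (forall i, open (U i)) ->
  (rm (\bigcup_i U i) <= \sum_(i <oo) rm (U i))%E.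
Proof.
move=> oU; apply: ge_ereal_sup => _ [f [Of f01 fU] <-].
have f0 x : 0 <= f x by case/andP: (f01 x).
have [C C0 hC] := Lam_trunc Of.
have tot0 : (0 <= \sum_(i <oo) rm (U i))%E by apply: nneseries_ge0 => i _ _; exact: rm_ge0.
suff H e : 0 < e -> ((Lam f)%:E <= \sum_(i <oo) rm (U i) + (e * C)%:E)%E.
  apply/lee_addgt0Pr => r r0.
  have C1 : 0 < C + 1 by rewrite ltr_wpDl.
  apply: le_trans (H (r / (C + 1)) _) _; first by rewrite divr_gt0.
  rewrite leeD2l // lee_fin mulrAC ler_pdivrMr // ler_pM2l // lerDl //.
move=> e0; have cK := superlevel_compact e0 Of.
(* A single [N] bounds both the indices and the inverse depth, so the [V N] increase and compactness
   yields one of them. *)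
pose V N := \bigcup_(i in [set i | (i < N)%N]) [set x | N%:R^-1 < depth (U i) x].
have oV N : open (V N).
  by apply: bigcup_open => i _; apply: open_gtf; exact: lip_cts (@lip_depth R n (U i)).
have KV : [set x | e <= f x] `<=` \bigcup_N V N.
  move=> x /= ex; have [i _ Ux] : (\bigcup_i U i) x.
    by apply: contrapT => /fU fx; move: ex; rewrite fx leNgt e0.
  have d0 := depth_gt0 (oU i) Ux.
  pose N := maxn i.+1 (Num.truncn (depth (U i) x)^-1).+1.
  exists N => //; exists i => /=; first by rewrite /N leq_max leqnn.
  have N0 : 0 < N%:R :> R by rewrite ltr0n /N leq_max.
  rewrite -[ltRHS]invrK ltf_pV2 ?posrE ?invr_gt0 //.
  apply: lt_le_trans (truncnS_gt _) _; rewrite ler_nat /N leq_max leqnn orbT //.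
have [D _ KD] : finite_subset_cover [set: nat] V [set x | e <= f x].
  by move: cK; rewrite compact_cover; apply => // N _; exact: oV.
pose N := (\max_(i <- finmap.enum_fset D) i)%N.
have VN : [set x | e <= f x] `<=` V N.
  move=> x /KD [M /= MD [i /= iM hx]]; have MN : (M <= N)%N by apply: leq_bigmax_seq.
  exists i => /=; first exact: leq_trans MN.
  apply: le_lt_trans hx; have M0 : (0 < M)%N by exact: leq_ltn_trans iM.
  by rewrite lef_pV2 ?posrE ?ltr0n ?ler_nat // (leq_trans M0).
pose g i x := Num.min (f x) (N%:R * depth (U i) x).
have Og i : below (U i) (g i).
  have [cf [K [cK' KO fK]]] := Of.
  split.
  - split.
      move=> x; apply: (@continuous_min _ _ f (fun x => N%:R * depth (U i) x)); first exact: cf.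
      by apply: continuousM; [exact: cst_continuous | exact: lip_cts (@lip_depth R n (U i)) x].
    exists K; split => // x Kx; rewrite /g fK //; apply/min_idPl.
    by rewrite mulr_ge0 // depth_ge0.
  - move=> x; case/andP: (f01 x) => a b; rewrite /g le_min a mulr_ge0 ?depth_ge0 //=.
    by rewrite ge_min b.
  - by move=> x Ux; rewrite /g (depth_out Ux) mulr0; apply/min_idPr.
have hle : Lam (trunc e f) <= \sum_(i < N) Lam (g i).
  rewrite -Lam_sum => [|i]; last by case: (Og i).
  apply: le_Lam; first by apply: Cc_trunc => //; exact: ltW.
    by apply: Cc_sum => i; case: (Og i).
  have g0 i x : 0 <= g i x by case: (Og i) => _ /(_ x)/andP[].
  move=> x; have [ex|ex] := leP e (f x); last first.
    rewrite /trunc (_ : Num.max _ _ = 0); first by apply: sumr_ge0 => i _.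
    by apply/max_idPr; rewrite subr_le0 ltW.
  have [i /= iN hi] := VN x ex.
  have N0 : 0 < N%:R :> R by rewrite ltr0n (leq_ltn_trans _ iN).
  rewrite (bigD1 (Ordinal iN)) //= (_ : g i x = f x).
    by apply: (@le_trans _ _ (f x)); [apply: trunc_le => //; exact: ltW | rewrite lerDl sumr_ge0].
  apply/min_idPl; apply: (@le_trans _ _ 1); first by case/andP: (f01 x).
  by rewrite -ler_pdivrMl // mulr1 ltW.
apply: (@le_trans _ _ ((\sum_(i < N) Lam (g i) + e * C)%:E)).
  by rewrite lee_fin (le_trans (hC e (ltW e0))) // lerD2r.
rewrite EFinD; apply: leeD2r; rewrite -sumEFin.
apply: (@le_trans _ _ (\sum_(i < N) rm (U i))%E).
  by apply: lee_sum => i _; exact: rm_ge.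
rewrite -(big_mkord xpredT (fun i => rm (U i))).
by apply: nneseries_lim_ge => i _ _; exact: rm_ge0.
Qed.

Lemma rmu_sigma_subadditive : sigma_subadditive rmu.
Proof.
move=> A; have [[i ioo]|] := pselect (exists i, rmu (A i) = +oo%E).
  rewrite (eseries_pinfty _ _ ioo) ?leey// => k _.
  by rewrite -ltNye (lt_le_trans _ (rmu_ge0 _)).
rewrite -forallNE => Aoo.
apply/lee_addgt0Pr => e e0.
rewrite (le_trans _ (epsilon_trick _ _ (ltW e0)))//; last by move=> k; exact: rmu_ge0.
have /choice[U hU] : forall k, exists U, [/\ open U, A k `<=` U & (rm U <= rmu (A k) + (e / (2 ^ k.+1)%:R)%:E)%E].
  move=> k; have en : 0 < e / (2 ^ k.+1)%:R by rewrite divr_gt0 // ltr0n expn_gt0.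
  have fin : rmu (A k) \is a fin_num.
    by rewrite ge0_fin_numE ?rmu_ge0 // ltey; apply/eqP; exact: Aoo.
  have [_ [U [oU AU] <-] /ltW h] := lb_ereal_inf_adherent en fin.
  by exists U.
apply: (@le_trans _ _ (rm (\bigcup_k U k))).
  apply: rmu_le; first by apply: bigcup_open => k _; case: (hU k).
  by apply: subset_bigcup => k _; case: (hU k).
apply: (@le_trans _ _ (\sum_(k <oo) rm (U k))%E).
  by apply: rm_bigcup => k; case: (hU k).
by apply: lee_nneseries => [k _ _|k _]; [exact: rm_ge0 | case: (hU k)].
Qed.

(** Given [f] below [V] intersected with [U], the part of [V] outside [U] lies in the open set [W]
    where [f < e]. For [g] below [W], the functions [trunc e f] and [g] are never nonzero at the
    same point, so their sum is below [V]. *)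
Lemma rmu_caratheodory_open (U E : set X) : open U ->
  (rmu (E `&` U) + rmu (E `&` ~` U) <= rmu E)%E.
Proof.
move=> oU; apply: le_ereal_inf_tmp => _ [V [oV EV] <-].
apply: (@le_trans _ _ (rm (V `&` U) + rmu (V `&` ~` U))%E).
  apply: leeD; last by apply: le_rmu; exact: setSI.
  by apply: rmu_le; [exact: openI | exact: setSI].
have [->|Voo] := eqVneq (rm V) +oo%E; first by rewrite leey.
have Vfin : rm V \is a fin_num by rewrite ge0_fin_numE ?rm_ge0 // ltey.
have bfin : rmu (V `&` ~` U) \is a fin_num.
  rewrite ge0_fin_numE ?rmu_ge0 //; apply: le_lt_trans (_ : rm V < +oo)%E; last by rewrite ltey.
  by apply: rmu_le => //; exact: subIsetl.
rewrite -leeBrDr //; apply: ge_ereal_sup => _ [f [Of f01 fU] <-].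
rewrite leeBrDr //.
have [C C0 hC] := Lam_trunc Of.
apply/lee_addgt0Pr => r r0.
have C1 : 0 < C + 1 by rewrite ltr_wpDl.
pose e := r / (C + 1); have e0 : 0 < e by rewrite divr_gt0.
have eC : e * C <= r by rewrite /e mulrAC ler_pdivrMr // ler_pM2l // lerDl.
pose W := V `&` [set x | f x < e].
have cf : continuous f by case: Of.
have oW : open W.
  apply: openI => //; apply: (@open_comp _ _ f [set s | s < e]) => [x _|]; [exact: cf | exact: open_lt].
have VW : V `&` ~` U `<=` W.
  move=> x [Vx Ux]; split => //=; rewrite fU // => -[_ /Ux].
  by [].
apply: (@le_trans _ _ ((Lam f)%:E + rm W)%E).
  by apply: leeD2l; exact: rmu_le.
have Wfin : rm W \is a fin_num.
  rewrite ge0_fin_numE ?rm_ge0 //; apply: le_lt_trans (_ : rm V < +oo)%E; last by rewrite ltey.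
  by apply: le_rm; exact: subIsetl.
rewrite addeC -leeBrDr //; apply: ge_ereal_sup => _ [g [Og g01 gW] <-].
rewrite leeBrDr // -EFinD.
apply: (@le_trans _ _ ((Lam (fun x => trunc e f x + g x) + e * C)%:E)).
  rewrite lee_fin LamD //; last by apply: Cc_trunc => //; exact: ltW.
  by have := hC e (ltW e0); lra.
rewrite EFinD; apply: leeD; last by rewrite lee_fin.
apply: rm_ge; split.
- by apply: CcD => //; apply: Cc_trunc => //; exact: ltW.
- move=> x; have /andP[a b] := f01 x; have /andP[c d] := g01 x.
  rewrite addr_ge0 ?trunc_ge0 //=.
  have [ef|ef] := ltP (f x) e.
    by rewrite /trunc (_ : Num.max _ _ = 0) ?add0r //; apply/max_idPr; rewrite subr_le0 ltW.
  rewrite gW ?addr0; first by rewrite (le_trans _ b) // trunc_le // ltW.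
  by move=> [_ /=]; rewrite ltNge ef.
- move=> x Vx; rewrite gW ?addr0; last by case.
  by apply/max_idPr; rewrite fU ?sub0r ?oppr_le0 ?ltW // => -[].
Qed.

(** A function below the set where [eta > 1/2] is at most [2 * eta]. *)
Lemma rm_compact (K : set X) : compact K -> K `<=` O -> exists U, [/\ open U, K `<=` U & (rm U < +oo)%E].
Proof.
move=> cK KO; have [d [L [eta [d0 _ Oeta _ [eta01 etaK]]]]] := nbhd_cutoff oO cK KO.
exists [set x | 2^-1 < eta x]; split.
- by apply: open_gtf; case: Oeta.
- by move=> x Kx /=; rewrite (etaK x x) ?subrr ?normr0 ?ltW // invf_lt1 // ltr1n.
- apply: (@le_lt_trans _ _ (2 * Lam eta)%:E); last exact: ltry.
  apply: ge_ereal_sup => _ [f [Of f01 fU] <-]; rewrite lee_fin -LamZ //.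
  apply: le_Lam => //; first exact: CcZ.
  move=> x; have [h|h] := ltP 2^-1 (eta x).
    case/andP: (f01 x) => _ b; apply: (le_trans b); lra.
  rewrite fU /=; first by rewrite mulr_ge0 //; case/andP: (eta01 x).
  by rewrite ltNge h.
Qed.

Theorem riesz_representation : exists mu : {measure set B -> \bar R},
  radon_on O mu /\ forall f, Cc O f -> (\int[mu]_(x in O) (f x)%:E = (Lam f)%:E)%E.
Proof.
have rmu0 : rmu set0 = 0%E by rewrite rmu_open ?rm0 //; exact: open0.
pose om : {outer_measure set B -> \bar R} :=
  HB.pack rmu (isOuterMeasure.Build R B rmu rmu0 rmu_ge0 le_rmu rmu_sigma_subadditive).
have borel_cara (A : set B) : measurable A -> om.-caratheodory A.
  have : @measurable _ B `<=` (@measurable _ (caratheodory_type om)).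
    apply: smallest_sub; first exact: sigma_algebra_measurable.
    by move=> U oU; apply: le_caratheodory_measurable => E; exact: rmu_caratheodory_open.
  by move=> h mA; exact: (h A mA).
(* Intersecting with [O] makes the measure carried by [O], as [radon_on] requires. *)
pose nu (A : set B) := rmu (A `&` O).
have nu0 : nu set0 = 0%E by rewrite /nu set0I.
have nu_ge0 A : (0 <= nu A)%E by exact: rmu_ge0.
have mO : measurable (O : set B) by exact: open_borel.
have nu_sa : semi_sigma_additive nu.
  move=> F mF tF mUF; rewrite /nu setI_bigcupl.
  apply: (@caratheodory_measure_sigma_additive R B om (fun k => F k `&` O)).
  - by move=> i; apply: borel_cara; exact: measurableI.
  - exact: trivIset_setIr.
  - by apply: borel_cara; apply: bigcupT_measurable => i; exact: measurableI.
pose mu : {measure set B -> \bar R} := HB.pack nu (isMeasure.Build _ B R nu nu0 nu_ge0 nu_sa).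
have radmu : radon_on O mu.
  split; first by rewrite /mu /= /nu setICl.
  move=> K cK KO; have [U [oU KU Ufin]] := rm_compact cK KO.
  apply: le_lt_trans Ufin; rewrite /mu /= /nu; apply: rmu_le => //.
  by move=> x [/KU].
have muE U : open U -> U `<=` O -> mu U = rm U.
  by move=> oU UO; rewrite /mu /= /nu (setIidl UO) rmu_open.
exists mu; split => //.
pose I (f : X -> R) : R := \int[mu]_x (f : B -> R) x.
have II f : Cc O f -> mu.-integrable setT (EFin \o (f : B -> R)).
  by move=> Of; exact: Cc_integrable_radon radmu Of.
have IB f g : Cc O f -> Cc O g -> I (fun x => f x - g x) = I f - I g.
  by move=> Of Og; apply: RintegralB => //; exact: II.
have E1 f : Cc O f -> (\int[mu]_(x in O) (f x)%:E = (I f)%:E)%E.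
  move=> Of; rewrite /I /Rintegral fineK; last exact: integrable_fin_num (II f Of).
  rewrite [LHS]integral_mkcond; apply: eq_integral => x _; rewrite /patch; case: ifPn => // /negP xO.
  case: Of => _ [K [_ KO fK]]; rewrite fK // => /KO Ox; apply: xO.
  exact: mem_set.
suff pos f : Cc O f -> (forall x, 0 <= f x) -> I f = Lam f.
  move=> f Of; rewrite E1 //; congr EFin.
  have Op := Cc_pos Of; have On := Cc_neg Of.
  have -> : f = fun x => Num.max (f x) 0 - Num.max (- f x) 0.
    by apply/funext => x; exact: pos_neg_part.
  by rewrite IB // LamB // !pos // => x; rewrite le_max lexx orbT.
move=> Of f0.
have [M M0 hM] := Cc_bounded Of.
have [cf [K [cK KO fK]]] := Of.
(* Layer-cake argument. [D e k] is the slice of [f] between heights [k * e] and [(k + 1) * e]. Both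
   [I] and [Lam] send it to a number between [e * a e k.+1] and [e * a e k], where [a e k] is the
   measure of the set where [f > k * e]. *)
pose A (e : R) (k : nat) : set X := [set x | k%:R * e < f x].
have oA e k : open (A e k) by exact: open_gtf.
have AK e k : 0 < e -> A e k `<=` K.
  move=> e0 x; rewrite /A /= => h; apply: contrapT => /fK fx; move: h; rewrite fx ltNge.
  by rewrite mulr_ge0 // ltW.
have AO e k : 0 < e -> A e k `<=` O by move=> e0; exact: subset_trans (AK e k e0) KO.
have muK : (mu K < +oo)%E by case: radmu => _; exact.
have Afin e k : 0 < e -> rm (A e k) \is a fin_num.
  move=> e0; rewrite ge0_fin_numE ?rm_ge0 // -muE //; last exact: AO.
  apply: le_lt_trans muK; apply: le_measure; rewrite ?inE.
  - exact: open_borel.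
  - exact: compact_borel.
  - exact: AK.
pose a e k := fine (rm (A e k)).
have aK e k : 0 < e -> a e k <= fine (mu K).
  move=> e0; rewrite fine_le //; first exact: Afin.
    by rewrite ge0_fin_numE.
  rewrite -muE //; last exact: AO.
  apply: le_measure; rewrite ?inE; [exact: open_borel | exact: compact_borel | exact: AK].
pose T e k := trunc (k%:R * e) f.
have OT e k : 0 < e -> Cc O (T e k).
  by move=> e0; apply: Cc_trunc => //; rewrite mulr_ge0 // ltW.
pose D e k x := T e k x - T e k.+1 x.
have OD e k : 0 < e -> Cc O (D e k) by move=> e0; apply: CcB; exact: OT.
have kS (k : nat) (e : R) : k.+1%:R * e = k%:R * e + e by rewrite -natr1 mulrDl mul1r.
have D0 e k x : 0 < e -> 0 <= D e k x <= e.
  move=> e0; rewrite /D /T /trunc kS; case: (leP (f x - k%:R * e) 0) => h1;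
    case: (leP (f x - (k%:R * e + e)) 0) => h2; apply/andP; split; lra.
have D1 e k x : 0 < e -> A e k.+1 x -> D e k x = e.
  move=> e0; rewrite /A /= /D /T /trunc kS => h.
  case: (leP (f x - k%:R * e) 0) => h1;
    case: (leP (f x - (k%:R * e + e)) 0) => h2; lra.
have D2 e k x : 0 < e -> ~ A e k x -> D e k x = 0.
  move=> e0; rewrite /A /= /D /T /trunc kS => /negP; rewrite -leNgt => h.
  case: (leP (f x - k%:R * e) 0) => h1;
    case: (leP (f x - (k%:R * e + e)) 0) => h2; lra.
have LD1 e k : 0 < e -> Lam (D e k) <= e * a e k.
  move=> e0; rewrite -ler_pdivrMl // -LamZ; last exact: OD.
  rewrite -lee_fin /a fineK; last exact: Afin.
  apply: rm_ge; split.
  - by apply: CcZ; exact: OD.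
  - move=> x; have /andP[p q] := D0 e k x e0.
    by rewrite mulr_ge0 ?invr_ge0 ?(ltW e0) //= ler_pdivrMl // mulr1.
  - by move=> x Ax; rewrite D2 // mulr0.
have LD2 e k : 0 < e -> e * a e k.+1 <= Lam (D e k).
  move=> e0; rewrite -ler_pdivlMl // -lee_fin /a fineK; last exact: Afin.
  apply: ge_ereal_sup => _ [g [Og g01 gA] <-]; rewrite lee_fin ler_pdivlMl // -LamZ //.
  apply: le_Lam; [exact: CcZ | exact: OD | move=> x].
  have [Ax|Ax] := pselect (A e k.+1 x).
    by rewrite D1 // ler_piMr ?(ltW e0) //; case/andP: (g01 x).
  by rewrite gA // mulr0; case/andP: (D0 e k x e0).
have mA e k : measurable (A e k : set B) by exact: open_borel.
have indI e k : 0 < e -> mu.-integrable setT (EFin \o (fun x : B => e * \1_(A e k) x)).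
  move=> e0; have : mu.-integrable setT (fun x : B => (e%:E * (\1_(A e k) x)%:E)%E).
    apply: integrableZl => //; apply/integrableP; split.
      by apply/measurable_EFinP; exact: measurable_indic.
    under eq_integral do rewrite gee0_abs ?lee_fin //.
    rewrite integral_indic // setIT; apply: le_lt_trans muK.
    apply: le_measure; rewrite ?inE; [exact: mA | exact: compact_borel | exact: AK].
  by apply: eq_integrable => // x _; rewrite /= EFinM.
have indE e k : 0 < e -> \int[mu]_x (e * \1_(A e k) x) = e * a e k.
  move=> e0; rewrite /Rintegral (_ : (fun x : B => (e * \1_(A e k) x)%:E) = (fun x : B => (e%:E * (\1_(A e k) x)%:E)%E));
    last by apply/funext => x; rewrite EFinM.
  rewrite ge0_integralZl //; last first.
  - by rewrite lee_fin ltW.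
  - by apply/measurable_EFinP; exact: measurable_indic.
  rewrite integral_indic // setIT muE //; last exact: AO.
  by rewrite fineM //; exact: Afin.
have ID1 e k : 0 < e -> I (D e k) <= e * a e k.
  move=> e0; rewrite -indE //; apply: le_Rintegral => //; [exact: II (OD e k e0) | exact: indI |].
  move=> x _; rewrite indicE; case: (boolP (x \in A e k)) => h.
    by rewrite mulr1; case/andP: (D0 e k x e0).
  by rewrite mulr0 D2 // => Ax; move: h; rewrite notin_setE.
have ID2 e k : 0 < e -> e * a e k.+1 <= I (D e k).
  move=> e0; rewrite -indE //; apply: le_Rintegral => //; [exact: indI | exact: II (OD e k e0) |].
  move=> x _; rewrite indicE; case: (boolP (x \in A e k.+1)) => h.
    by rewrite mulr1 D1 //; move: h; rewrite inE.
  by rewrite mulr0; case/andP: (D0 e k x e0).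
(* The errors on the slices telescope, so their total is at most [e] times one bounded
   difference. *)
have step e N : 0 < e -> `|(I f - I (T e N)) - (Lam f - Lam (T e N))| <= e * (a e 0 - a e N).
  move=> e0; elim: N => [|N IH].
    rewrite (_ : T e 0 = f) ?subrr ?normr0 ?mulr0 //.
    by apply/funext => x; rewrite /T /trunc mul0r subr0; apply/max_idPl.
  have E2 : I (D e N) = I (T e N) - I (T e N.+1) by apply: IB; exact: OT.
  have E3 : Lam (D e N) = Lam (T e N) - Lam (T e N.+1) by apply: LamB; exact: OT.
  have h1 := LD1 e N e0; have h2 := LD2 e N e0; have h3 := ID1 e N e0; have h4 := ID2 e N e0.
  move: IH h1 h2 h3 h4; rewrite E2 E3.
  move: (I f) (I (T e N)) (I (T e N.+1)) (Lam f) (Lam (T e N)) (Lam (T e N.+1))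
    (a e 0) (a e N) (a e N.+1) => i0 i1 i2 l0 l1 l2 a0 a1 a2.
  rewrite !mulrBr !ler_norml => /andP[h5 h6] h1 h2 h3 h4; apply/andP; split; lra.
have fin e : 0 < e -> `|I f - Lam f| <= e * fine (mu K).
  (* With [N * e >= M] no part of [f] remains above the last slice. *)
  move=> e0; pose N := (Num.truncn (M / e)).+1.
  have TN : T e N = fun=> 0.
    apply/funext => x; apply/max_idPr; rewrite subr_le0.
    apply: (@le_trans _ _ M); first by rewrite (le_trans _ (hM x)) // ler_norm.
    by rewrite -ler_pdivrMr // ltW // truncnS_gt.
  have := step e N e0; rewrite TN Lam0.
  have -> : I (fun=> 0) = 0.
    rewrite -[RHS](subrr (I (fun=> 0))) -(IB _ _ (@Cc0 R n O) (@Cc0 R n O)); congr I; by apply/funext => x; rewrite subr0.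
  rewrite !subr0 => h; apply: (le_trans h); rewrite ler_pM2l //.
  have : 0 <= a e N by rewrite fine_ge0 // rm_ge0.
  have := aK e 0%N e0; lra.
apply/eqP; rewrite -subr_eq0 -normr_eq0 eq_le normr_ge0 andbT.
apply/ler_addgt0Pr => r r0; rewrite add0r.
have k0 : 0 <= fine (mu K) by rewrite fine_ge0.
have k1 : 0 < fine (mu K) + 1 by rewrite ltr_wpDl.
apply: le_trans (fin (r / (fine (mu K) + 1)) _) _; first by rewrite divr_gt0.
by rewrite mulrAC ler_pdivrMr // ler_pM2l // lerDl.
Qed.

End Riesz.

(** * Dugundji's extension of a function off a separable set *)

Section GeometricSeries.
Context {R : realType}.
Implicit Types a b : nat -> R.

Definition gw (k : nat) : R := 2^-1 ^+ k.

Lemma gw_gt0 k : 0 < gw k.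
Proof. by rewrite exprn_gt0 // invr_gt0. Qed.

Lemma gw_cvg : series gw @ \oo --> (2 : R).
Proof.
have : series (geometric 1 (2^-1 : R)) @ \oo --> 1 * (1 - 2^-1 : R)^-1.
  by apply: cvg_geometric_series; rewrite ger0_norm ?invr_ge0 // invf_lt1 // ltr1n.
rewrite (_ : 1 * (1 - 2^-1)^-1 = 2 :> R); last by field.
by rewrite (_ : geometric 1 2^-1 = gw) //; apply/funext => k; rewrite /geometric /= mul1r.
Qed.

Definition dominated a := exists C : R, forall k, `|a k| <= C * gw k.

Definition sum_series a : R := limn (series a).

Lemma dominated_cvg a : dominated a -> cvgn (series a).
Proof.
move=> [C hC]; apply: normed_cvg; apply: (@series_le_cvg _ _ (fun k => C * gw k)) => //.
- by move=> k; exact: normr_ge0.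
- by move=> k; apply: le_trans (hC k).
- rewrite (_ : (fun k => C * gw k) = C *: gw) //; apply: is_cvg_seriesZ.
  by apply/cvg_ex; exists 2; exact: gw_cvg.
Qed.

Lemma dominatedZ (c : R) a : dominated a -> dominated (fun k => c * a k).
Proof. by move=> [C hC]; exists (`|c| * C) => k; rewrite normrM -mulrA ler_wpM2l. Qed.

Lemma sum_seriesD a b : dominated a -> dominated b -> sum_series (fun k => a k + b k) = sum_series a + sum_series b.
Proof. by move=> da db; apply: lim_seriesD; exact: dominated_cvg. Qed.

Lemma sum_seriesZ (c : R) a : dominated a -> sum_series (fun k => c * a k) = c * sum_series a.
Proof. by move=> da; apply: lim_seriesZ; exact: dominated_cvg. Qed.

Lemma le_sum_series a b : dominated a -> dominated b -> (forall k, a k <= b k) -> sum_series a <= sum_series b.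
Proof. by move=> da db ab; apply: lim_series_le => //; exact: dominated_cvg. Qed.

Lemma sum_series_gw : sum_series gw = 2.
Proof. by apply: cvg_lim => //; exact: gw_cvg. Qed.

Lemma dominated_gw : dominated gw.
Proof. by exists 1 => k; rewrite mul1r ger0_norm // ltW // gw_gt0. Qed.

Lemma norm_sum_series a C : (forall k, `|a k| <= C * gw k) -> `|sum_series a| <= 2 * C.
Proof.
move=> h; have da : dominated a by exists C.
have dg := dominatedZ C dominated_gw; have dg' := dominatedZ (- C) dominated_gw.
rewrite mulrC -sum_series_gw ler_norml -mulNr -!sum_seriesZ //; try exact: dominated_gw.
by apply/andP; split; apply: le_sum_series => // k; have := h k; rewrite ler_norml => /andP[]; rewrite ?mulNr.
Qed.

Lemma sum_series_gt0 a j : dominated a -> (forall k, 0 <= a k) -> 0 < a j -> 0 < sum_series a.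
Proof.
move=> da a0 aj; apply: lt_le_trans aj _; apply: limr_ge; first exact: dominated_cvg.
near=> m; rewrite /series /=.
have jm : (j < m)%N by near: m; exists j.+1.
rewrite (bigD1_seq j) ?iota_uniq ?mem_index_iota //= lerDl.
by apply: sumr_ge0.
Unshelve. all: by end_near. Qed.

End GeometricSeries.

Section Dugundji.
Context {R : realType} {U : Type}.
Variables (d : U -> U -> R) (s : nat -> U).
Hypothesis d_ge0 : forall u v, 0 <= d u v.
Hypothesis d_sym : forall u v, d u v = d v u.
Hypothesis d_tri : forall u v w, d u w <= d u v + d v w.

Definition dist_to (u : U) : R := inf (range (fun k => d u (s k))).

Let hinf u : has_inf (range (fun k => d u (s k))).
Proof. by split; [exists (d u (s 0)); exists 0%N | exists 0 => _ [k _ <-]]. Qed.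

Lemma dist_to_ge0 u : 0 <= dist_to u.
Proof. by apply: lb_le_inf; [case: (hinf u) | move=> _ [k _ <-]]. Qed.

Lemma dist_to_le u k : dist_to u <= d u (s k).
Proof. by apply: ge_inf; [case: (hinf u) | exists k]. Qed.

Lemma dist_to_lt u r : dist_to u < r -> exists k, d u (s k) < r.
Proof.
move=> h; have [_ [k _ <-] hk] := inf_lt (hinf u).1 h.
by exists k.
Qed.

Lemma dist_to_lip u v : dist_to u <= dist_to v + d u v.
Proof.
rewrite -lerBlDr; apply: lb_le_inf; first by case: (hinf v).
by move=> _ [k _ <-]; rewrite lerBlDr addrC (le_trans (dist_to_le u k)).
Qed.

(** Only points less than twice as far from [u] as the infimum get a positive weight, so averages
    use values near [u]. The factor [gw k] makes the sums converge, which replaces local finiteness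
    of a partition of unity. *)
Definition wt (u : U) (k : nat) : R := gw k * Num.max 0 (2 * dist_to u - d u (s k)).

Lemma wt_ge0 u k : 0 <= wt u k.
Proof. by rewrite mulr_ge0 ?le_max ?lexx // ltW // gw_gt0. Qed.

Lemma wt_eq0 u k : 2 * dist_to u <= d u (s k) -> wt u k = 0.
Proof. by move=> h; rewrite /wt (max_l (_ : _ <= 0)) ?mulr0 // subr_le0. Qed.

Lemma wt_le u k : wt u k <= 2 * dist_to u * gw k.
Proof.
rewrite /wt mulrC ler_wpM2r ?(ltW (gw_gt0 _)) // ge_max mulr_ge0 ?dist_to_ge0 //=.
by rewrite gerBl.
Qed.

Lemma wt_lip u v k : `|wt u k - wt v k| <= 3 * d u v * gw k.
Proof.
rewrite /wt -mulrBr normrM (ger0_norm (ltW (gw_gt0 k))) mulrC ler_wpM2r ?(ltW (gw_gt0 _)) //.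
have h1 := dist_to_lip u v; have h2 := dist_to_lip v u.
have h3 := d_tri u v (s k); have h4 := d_tri v u (s k).
rewrite (d_sym v u) in h2 h4.
move: h1 h2 h3 h4 (d_ge0 u v); move: (dist_to u) (dist_to v) (d u (s k)) (d v (s k)) (d u v) => a b x y z h1 h2 h3 h4 h5.
rewrite ler_norml; apply/andP; split; case: (leP 0 (2 * a - x)) => h6; case: (leP 0 (2 * b - y)) => h7; lra.
Qed.

Definition bounded_seq (F : nat -> R) := exists C, forall k, `|F k| <= C.

Lemma bounded_seq_ge0 F : bounded_seq F -> exists2 C, 0 < C & forall k, `|F k| <= C.
Proof.
move=> [C hC]; exists (`|C| + 1) => [|k]; first by rewrite ltr_wpDl.
by rewrite (le_trans (hC k)) // (le_trans (ler_norm _)) // lerDl.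
Qed.

Lemma dominated_wtF u F : bounded_seq F -> dominated (fun k => wt u k * F k).
Proof.
move=> /bounded_seq_ge0[C C0 hC]; exists (2 * dist_to u * C) => k.
rewrite normrM (ger0_norm (wt_ge0 u k)) [leRHS]mulrAC; apply: ler_pM => //; [exact: wt_ge0 | exact: wt_le].
Qed.

Lemma dominated_wt u : dominated (wt u).
Proof.
exists (2 * dist_to u) => k; rewrite (ger0_norm (wt_ge0 u k)); exact: wt_le.
Qed.

Lemma sum_wt_gt0 u : 0 < dist_to u -> 0 < sum_series (wt u).
Proof.
move=> D0; have [k hk] : exists k, d u (s k) < 2 * dist_to u.
  by apply: dist_to_lt; rewrite ltr_pMl // ltr1n.
apply: (sum_series_gt0 (j := k) (dominated_wt u)); first exact: wt_ge0.
by rewrite /wt mulr_gt0 ?gw_gt0 // lt_max subr_gt0 hk orbT.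
Qed.

(** The approximating indices are chosen independently of [F], so that the limit along them is
    linear in [F]. *)
Definition kap (u : U) (m : nat) : nat :=
  xget 0%N [set k | d u (s k) < (m.+1)%:R^-1].

Lemma kapP u m : dist_to u = 0 -> d u (s (kap u m)) < (m.+1)%:R^-1.
Proof.
move=> D0; rewrite /kap; case: xgetP => [k -> //|h].
have [k hk] : exists k, d u (s k) < (m.+1)%:R^-1.
  by apply: dist_to_lt; rewrite D0 invr_gt0.
by have := h k.
Qed.

(* Dugundji's formula for extending a function off the closure of the points [s k]. *)
Definition ext (F : nat -> R) (u : U) : R :=
  if dist_to u == 0 then limn (fun m => F (kap u m))
  else sum_series (fun k => wt u k * F k) / sum_series (wt u).

(** If [dist_to u > 0] the condition is empty for [r = dist_to u]; it constrains [F] only at limits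
    of the points [s k]. *)
Definition cauchy_near (F : nat -> R) (u : U) := forall e, 0 < e ->
  exists2 r, 0 < r & forall k l, d u (s k) < r -> d u (s l) < r -> `|F k - F l| < e.

Lemma inv_small (r : R) : 0 < r -> \forall m \near \oo, (m.+1)%:R^-1 < r.
Proof.
move=> r0; have := @cvg_harmonic R; move=> /cvgrPdist_lt/(_ r r0); apply: filterS => m.
by rewrite sub0r normrN ger0_norm // /harmonic /= invr_ge0.
Qed.

Lemma kap_cvg F u : dist_to u = 0 -> cauchy_near F u -> cvgn (fun m => F (kap u m)).
Proof.
move=> D0 cF; apply/cauchy_cvgP; apply: cauchy_exP => e e0.
have [r r0 hr] := cF e e0; have [m0 _ hm0] := inv_small r0.
exists (F (kap u m0)); exists m0 => // m /= m0m.
rewrite /ball /=; apply: hr; first by apply: lt_trans (kapP _ D0) _; exact: hm0 (leqnn _).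
by apply: lt_trans (kapP _ D0) _; exact: hm0.
Qed.

(** In both cases of [ext] only values [F k] with [d u (s k) < 2 * dist_to u + r] matter: other
    weights vanish, and the points [s (kap u m)] eventually come within [r] of [u]. *)
Lemma ext_near F u l e r : bounded_seq F -> (dist_to u = 0 -> cauchy_near F u) -> 0 < r ->
  (forall k, d u (s k) < 2 * dist_to u + r -> `|F k - l| <= e) -> `|ext F u - l| <= e.
Proof.
move=> bF cF r0 h; rewrite /ext; case: eqP => [D0|/eqP D0].
  have hc := kap_cvg D0 (cF D0).
  have : (fun m => `|F (kap u m) - l|) @ \oo --> `|limn (fun m => F (kap u m)) - l|.
    by apply: cvg_norm; apply: cvgB => //; exact: cvg_cst.
  apply: (@closed_cvg _ _ _ _ _ [set x : R | x <= e]); first exact: closed_le.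
  apply: filterS (inv_small r0) => m hm /=; apply: h; rewrite D0 mulr0 add0r.
  exact: lt_trans (kapP _ D0) hm.
have Dp : 0 < dist_to u by rewrite lt_def D0 dist_to_ge0.
have W0 := sum_wt_gt0 Dp.
have dF := dominated_wtF u bF.
have e0 : 0 <= e.
  have [k hk] : exists k, d u (s k) < 2 * dist_to u by apply: dist_to_lt; rewrite ltr_pMl // ltr1n.
  by apply: le_trans (h k _); rewrite // (lt_trans hk) // ltrDl.
have W1 : sum_series (wt u) != 0 by rewrite gt_eqF.
rewrite -[X in _ - X](mulfK W1).
rewrite -mulrBl normrM normfV (ger0_norm (ltW W0)) ler_pdivrMr //.
have -> : sum_series (fun k => wt u k * F k) - l * sum_series (wt u) = sum_series (fun k => wt u k * (F k - l)).
  rewrite -mulNr -sum_seriesZ; last exact: dominated_wt.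
  rewrite -sum_seriesD //; last by apply: dominatedZ; exact: dominated_wt.
  by congr (sum_series _); apply/funext => k; ring.
have dl : dominated (fun k => wt u k * (F k - l)).
  have [C C0 hC] := bounded_seq_ge0 bF.
  apply: dominated_wtF; exists (C + `|l|) => k.
  by rewrite (le_trans (ler_normB _ _)) // lerD2r.
have key k : `|wt u k * (F k - l)| <= e * wt u k.
  have [hk|hk] := ltP (d u (s k)) (2 * dist_to u).
    rewrite normrM (ger0_norm (wt_ge0 u k)) mulrC ler_wpM2r ?wt_ge0 //.
    by apply: h; rewrite (lt_trans hk) // ltrDl.
  by rewrite wt_eq0 // mul0r normr0 mulr0.
rewrite -sum_seriesZ; last exact: dominated_wt.
rewrite ler_norml; apply/andP; split.
  rewrite -mulN1r -sum_seriesZ; last by apply: dominatedZ; exact: dominated_wt.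
  apply: le_sum_series => //; first by apply: dominatedZ; apply: dominatedZ; exact: dominated_wt.
  by move=> k; have := key k; rewrite ler_norml mulN1r => /andP[].
apply: le_sum_series => //; first by apply: dominatedZ; exact: dominated_wt.
by move=> k; have := key k; rewrite ler_norml => /andP[].
Qed.

Lemma extD F G u : bounded_seq F -> bounded_seq G -> cauchy_near F u -> cauchy_near G u ->
  ext (fun k => F k + G k) u = ext F u + ext G u.
Proof.
move=> bF bG cF cG; rewrite /ext; case: eqP => [D0|_].
  by apply: cvg_lim => //; apply: cvgD; exact: kap_cvg.
rewrite -mulrDl -sum_seriesD; [|exact: dominated_wtF|exact: dominated_wtF].
by congr (sum_series _ / _); apply/funext => k; rewrite mulrDr.
Qed.

Lemma extZ (c : R) F u : bounded_seq F -> cauchy_near F u ->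
  ext (fun k => c * F k) u = c * ext F u.
Proof.
move=> bF cF; rewrite /ext; case: eqP => [D0|_].
  by apply: cvg_lim => //; apply: cvgM; [exact: cvg_cst | exact: kap_cvg].
rewrite mulrA -sum_seriesZ; last exact: dominated_wtF.
by congr (sum_series _ / _); apply/funext => k; rewrite mulrCA.
Qed.

Lemma ext_ge0 F u : bounded_seq F -> cauchy_near F u -> (forall k, 0 <= F k) -> 0 <= ext F u.
Proof.
move=> bF cF F0; rewrite /ext; case: eqP => [D0|/eqP D0].
  by apply: limr_ge; [exact: kap_cvg | apply: nearW].
have Dp : 0 < dist_to u by rewrite lt_def D0 dist_to_ge0.
rewrite divr_ge0 ?(ltW (sum_wt_gt0 Dp)) //.
have d0 : dominated (fun _ : nat => 0 : R) by exists 0 => k; rewrite normr0 mul0r.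
have -> : 0 = sum_series (fun _ : nat => 0 : R).
  by rewrite -[LHS](mul0r (sum_series (fun _ : nat => 0 : R))) -sum_seriesZ //; congr sum_series; apply/funext => k; rewrite mul0r.
by apply: le_sum_series => // [|k]; [exact: dominated_wtF | rewrite mulr_ge0 ?wt_ge0].
Qed.

Lemma sum_wt_cvg (F : nat -> R) (u : U) (v : nat -> U) : bounded_seq F ->
  (fun j => d u (v j)) @ \oo --> 0 ->
  (fun j => sum_series (fun k => wt (v j) k * F k)) @ \oo --> sum_series (fun k => wt u k * F k).
Proof.
move=> bF uv; have [C C0 hC] := bounded_seq_ge0 bF.
(* The 2 is the sum of the geometric weights, the 3 comes from [wt_lip]. *)
have bnd j : `|sum_series (fun k => wt u k * F k) - sum_series (fun k => wt (v j) k * F k)| <= 2 * (3 * d u (v j) * C).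
  have -> : sum_series (fun k => wt u k * F k) - sum_series (fun k => wt (v j) k * F k) =
      sum_series (fun k => wt u k * F k + -1 * (wt (v j) k * F k)).
    by rewrite sum_seriesD ?sum_seriesZ ?mulN1r //; [exact: dominated_wtF | exact: dominated_wtF | apply: dominatedZ; exact: dominated_wtF].
  apply: norm_sum_series => k; rewrite mulN1r -mulrBl normrM mulrAC; apply: ler_pM => //.
  exact: wt_lip.
apply/cvgrPdist_lt => e e0.
have r0 : 0 < e / (6 * C) by rewrite divr_gt0 // mulr_gt0.
move/cvgrPdist_lt : uv => /(_ _ r0); apply: filterS => j.
rewrite sub0r normrN ger0_norm // ltr_pdivlMr ?mulr_gt0 // => h.
apply: le_lt_trans (bnd j) _; lra.
Qed.

(** At a limit of the points [s k] the Cauchy condition transfers to [v j] through [ext_near]. At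
    positive distance [dist_to (v j)] is eventually nonzero, and numerator and denominator of the
    average converge separately. *)
Lemma ext_cvg F u (v : nat -> U) : bounded_seq F -> cauchy_near F u ->
  (forall j, cauchy_near F (v j)) ->
  (fun j => d u (v j)) @ \oo --> 0 -> (fun j => ext F (v j)) @ \oo --> ext F u.
Proof.
move=> bF cu cv uv; have [D0|D0] := eqVneq (dist_to u) 0.
  apply/cvgrPdist_le => e e0; have e2 : 0 < e / 2 by rewrite divr_gt0.
  have [r r0 hr] := cu _ e2.
  have hu k : d u (s k) < r -> `|F k - ext F u| <= e / 2.
    move=> hk; rewrite distrC; apply: (ext_near (r := r)) => // l; rewrite D0 mulr0 add0r => hl.
    by apply: ltW; exact: hr.
  (* A point that matters for [v j] is within [r / 4 + (2 * (r / 4) + r / 4) = r] of [u], because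
     [dist_to (v j) <= d u (v j) < r / 4]. *)
  have r4 : 0 < r / 4 by rewrite divr_gt0.
  move/cvgrPdist_lt : uv => /(_ _ r4); apply: filterS => j.
  rewrite sub0r normrN ger0_norm // => hj.
  rewrite distrC; apply: (ext_near (r := r / 4)) => // k hk.
  apply: le_trans (hu k _) _; last lra.
  have h1 := d_tri u (v j) (s k); have h2 := dist_to_lip (v j) u.
  rewrite D0 add0r (d_sym (v j) u) in h2; lra.
have Dp : 0 < dist_to u by rewrite lt_def D0 dist_to_ge0.
have W0 := sum_wt_gt0 Dp.
have b1 : bounded_seq (fun _ => 1) by exists 1 => k; rewrite normr1.
have W1 x : sum_series (wt x) = sum_series (fun k => wt x k * 1) by congr sum_series; apply/funext => k; rewrite mulr1.
have hW : (fun j => sum_series (wt (v j))) @ \oo --> sum_series (wt u).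
  rewrite W1 (_ : (fun j => sum_series (wt (v j))) = fun j => sum_series (fun k => wt (v j) k * 1)).
    exact: sum_wt_cvg.
  by apply/funext => j; rewrite W1.
have hD : \forall j \near \oo, dist_to (v j) != 0.
  move/cvgrPdist_lt : uv => /(_ _ Dp); apply: filterS => j.
  rewrite sub0r normrN ger0_norm // => hj; apply/eqP => E.
  by have := dist_to_lip u (v j); rewrite E add0r leNgt hj.
rewrite /ext (negbTE D0).
have hQ : (fun j => sum_series (fun k => wt (v j) k * F k) / sum_series (wt (v j))) @ \oo --> sum_series (fun k => wt u k * F k) / sum_series (wt u).
  apply: cvgM; first exact: sum_wt_cvg.
  by apply: cvgV => //; rewrite gt_eqF.
apply: cvg_trans hQ; apply: near_eq_cvg.
by apply: filterS hD => j /negbTE ->.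
Qed.

End Dugundji.

(** * A pseudometric for almost everywhere convergence *)

Section FiniteMeasure.
Context {R : realType} {n : nat}.
Local Notation X := 'rV[R]_n.
Local Notation B := (borelRn R n).
Variable lam : {measure set B -> \bar R}.
Hypothesis hlam : is_lebesgue lam.

Lemma equivalent_finite_measure : exists nu : {measure set B -> \bar R},
  [/\ (nu setT < +oo)%E, forall A, measurable A -> lam A = 0%E -> nu A = 0%E
    & forall A, measurable A -> nu A = 0%E -> lam A = 0%E].
Proof.
pose Q (k : nat) : set B := cube k%:R.
have mQ k : measurable (Q k) by exact: box_borel.
have Qfin k : (lam (Q k) < +oo)%E by exact: (cube_lty hlam).
(* The [k]-th summand then has total mass at most [1 / 2 ^ k.+1]; the [1 +] avoids dividing by the
   volume of a null cube. *)
pose c (k : nat) : R := 1 / (2 ^ k.+1)%:R / (1 + fine (lam (Q k))).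
have l0 k : 0 <= fine (lam (Q k)) by rewrite fine_ge0.
have c0 k : 0 < c k by rewrite !divr_gt0 // ?ltr0n ?expn_gt0 // ltr_pwDl.
pose nn (k : nat) : {nonneg R} := NngNum (ltW (c0 k)).
pose m (k : nat) : {measure set B -> \bar R} := mscale (nn k) (mrestr lam (mQ k)).
have mE k A : m k A = ((c k)%:E * lam (A `&` Q k))%E by [].
exists (mseries m 0); split.
- apply: le_lt_trans (ltry 1).
  apply: le_trans (epsilon_trick0 xpredT ler01).
  apply: lee_nneseries => [k _ _|k _]; first by rewrite mule_ge0 // lee_fin ltW.
  rewrite -[X in (X _ <= _)%E]/(m k : set B -> \bar R) mE setTI -(@fineK _ (lam (Q k))); last by rewrite ge0_fin_numE.
  rewrite -EFinM lee_fin /c mulrAC ler_pdivrMr ?ltr_pwDl // ler_wpM2l //.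
  by rewrite lerDr.
- move=> A mA A0; rewrite /mseries /=; apply: eseries0 => k _ _.
  rewrite -[LHS]/(m k A) mE; have -> : lam (A `&` Q k) = 0%E; last by rewrite mule0.
  apply/eqP; rewrite eq_le measure_ge0 andbT -A0.
  by apply: le_measure; rewrite ?inE //; exact: measurableI.
- move=> A mA; rewrite /mseries /= => A0.
  have Ak k : lam (A `&` Q k) = 0%E.
    have : (m k A <= 0)%E.
      rewrite -A0 (_ : m k A = \sum_(k <= i < k.+1) m i A)%E; last by rewrite big_nat1.
      apply: le_trans (nneseries_lim_ge k.+1 _) => [|i _ _]; last exact: measure_ge0.
      rewrite (big_cat_nat (leq0n k)) //=.
      by apply: leeDr; apply: sume_ge0 => i _; exact: measure_ge0.
    rewrite mE pmule_rle0 ?lte_fin // => h.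
    by apply/eqP; rewrite eq_le h measure_ge0.
  have -> : A = \bigcup_k (A `&` Q k).
    rewrite -setI_bigcupr (_ : \bigcup_k Q k = setT) ?setIT //.
    apply/seteqP; split => // x _; exists (Num.truncn `|x : X|).+1 => //.
    by apply: norm_lt_cube; exact: truncnS_gt.
  have mAQ k : measurable (A `&` Q k) by exact: measurableI.
  apply/negligibleP; first exact: bigcupT_measurable.
  apply: negligible_bigcup => k; apply/negligibleP => //; exact: Ak.
Qed.

End FiniteMeasure.

Section Metric.
Context {R : realType} {n : nat}.
Local Notation X := 'rV[R]_n.
Local Notation B := (borelRn R n).
Variables (lam nu : {measure set B -> \bar R}).
Hypothesis nufin : (nu setT < +oo)%E.
Hypothesis lamnu : forall A, measurable A -> lam A = 0%E -> nu A = 0%E.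
Hypothesis nulam : forall A, measurable A -> nu A = 0%E -> lam A = 0%E.
Variable O : set X.
Hypothesis oO : open O.
Let mO : measurable (O : set B) := open_borel oO.
Let nuO : (nu O < +oo)%E.
Proof. by apply: le_lt_trans nufin; apply: le_measure; rewrite ?inE. Qed.

(** A common domain for the pseudometric: it contains the subharmonic functions and the classical
    solutions, and gives measurability and finiteness almost everywhere. *)
Definition tame (u : X -> \bar R) : Prop :=
  [/\ usc_on O u, forall x, O x -> u x != +oo%E
    & lam.-negligible ([set x | O x /\ u x = -oo%E] : set B)].

Lemma tame_measurable u : tame u ->
  measurable_fun (O : set B) ((fun x => contract (u x)) : B -> R).
Proof.
move=> [usc upoo _]; apply: (measurability _ (RGenInftyO.measurableE R)).
move=> _ [_ [a ->] <-]; apply: open_borel.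
rewrite openE => x [Ox]; rewrite /= in_itv /= => xa.
have [e e0 he] := openP_ball oO Ox.
suff [V Vx hV] : exists2 V, nbhs x V & forall y, V y -> O y -> contract (u y) < a.
  have nO : nbhs x O by exact: open_nbhs_nbhs.
  apply: filterI => //; near=> y; rewrite /= in_itv /=.
  by apply: hV; near: y.
(* For [a >= 1] the inequality holds on all of [O], since [u] avoids [+oo] there; [a <= -1]
   contradicts [xa]; otherwise [a] is [contract b] for a real [b] and semicontinuity applies. *)
have [a1|a1] := leP 1 a.
  exists setT; first exact: filterT.
  move=> y _ Oy; apply: lt_le_trans a1.
  rewrite lt_neqAle contract_eq1 upoo //=.
  exact: le_trans (ler_norm _) (contract_le1 _).
have aN1 : -1 < a.
  apply: le_lt_trans xa; have := contract_le1 (u x); rewrite ler_norml => /andP[].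
  by [].
pose b := a / (1 - `|a|).
have ea : contract b%:E = a.
  have <- : expand a = b%:E by rewrite /expand leNgt a1 /= leNgt aN1.
  by apply: expandK; rewrite inE ltW // ltr_norml aN1.
have xb : (u x < b%:E)%E.
  by rewrite -(leW_mono (@le_contract R)) ea.
have [V Vx hV] := usc x Ox b xb; exists V => // y Vy Oy.
by rewrite -ea (leW_mono (@le_contract R)); exact: hV.
Unshelve. all: by end_near. Qed.

(* [contract] maps [[-oo, +oo]] onto [[-1, 1]], so that the integrand is bounded. *)
Definition dist (u v : X -> \bar R) : R :=
  \int[nu]_(x in O) `|contract (u x) - contract (v x)|.

Lemma tame_diff_measurable u v : tame u -> tame v ->
  measurable_fun (O : set B) ((fun x => `|contract (u x) - contract (v x)|) : B -> R).
Proof.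
move=> tu tv; apply: measurableT_comp; first exact: normr_measurable.
by apply: measurable_funB; exact: tame_measurable.
Qed.

Lemma tame_integrable u v : tame u -> tame v ->
  nu.-integrable (O : set B) (EFin \o ((fun x => `|contract (u x) - contract (v x)|) : B -> R)).
Proof.
move=> tu tv; apply: measurable_bounded_integrable => //; first exact: tame_diff_measurable.
exists 2; split; first exact: num_real.
move=> M M2 x _ /=; rewrite normr_id; apply: le_trans (ltW M2).
apply: le_trans (ler_normB _ _) _.
by have := contract_le1 (u x); have := contract_le1 (v x); lra.
Qed.

Lemma dist_ge0 u v : 0 <= dist u v.
Proof. exact: Rintegral_ge0. Qed.

Lemma dist_sym u v : dist u v = dist v u.
Proof. by rewrite /dist; apply: eq_Rintegral => x _; rewrite distrC. Qed.

Lemma dist_tri u v w : tame u -> tame v -> tame w -> dist u w <= dist u v + dist v w.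
Proof.
move=> tu tv tw; rewrite /dist -RintegralD //; [|exact: tame_integrable|exact: tame_integrable].
apply: le_Rintegral => //; first exact: tame_integrable.
  have := integrableD mO (tame_integrable tu tv) (tame_integrable tv tw).
  by apply: eq_integrable.
by move=> x _; exact: ler_distD.
Qed.

Lemma ae_nu (P : B -> Prop) : {ae lam, forall x, P x} -> {ae nu, forall x, P x}.
Proof. by move=> [N [mN N0 PN]]; exists N; split => //; exact: lamnu. Qed.

Lemma ae_lam (P : B -> Prop) : {ae nu, forall x, P x} -> {ae lam, forall x, P x}.
Proof. by move=> [N [mN N0 PN]]; exists N; split => //; exact: nulam. Qed.

Lemma contract_cvg (v : nat -> \bar R) (l : \bar R) : v @ \oo --> l <->
  (fun j => `|contract l - contract (v j)|) @ \oo --> 0.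
Proof.
split=> h.
  apply/cvgrPdist_lt => e e0; have : \forall j \near \oo, ball l e (v j) by exact: cvg_ball.
  by apply: filterS => j; rewrite sub0r normrN normr_id.
apply/cvg_ballP => e e0; move/cvgrPdist_lt : h => /(_ e e0); apply: filterS => j.
by rewrite sub0r normrN normr_id.
Qed.

Lemma dist_cvg (u : X -> \bar R) (v : nat -> X -> \bar R) : tame u -> (forall j, tame (v j)) ->
  {ae lam, forall x : B, O x -> v ^~ x @ \oo --> u x} ->
  (fun j => dist u (v j)) @ \oo --> 0.
Proof.
move=> tu tv h.
have [] := @dominated_convergence _ B R nu O mO
  (fun j => EFin \o (fun x => `|contract (u x) - contract (v j x)|)) (cst 0%E) (cst 2%:E).
- by move=> j; apply/measurable_EFinP; exact: tame_diff_measurable.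
- exact: measurable_cst.
- apply: filterS (ae_nu h) => x hx Ox.
  apply: cvg_EFin; first exact: nearW.
  by have /contract_cvg := hx Ox.
- apply/integrableP; split; first exact: measurable_cst.
  by rewrite integral_cst //= ger0_norm // lte_mul_pinfty // lee_fin.
- apply: aeW => x j _; rewrite /= lee_fin normr_id.
  apply: le_trans (ler_normB _ _) _.
  by have := contract_le1 (u x); have := contract_le1 (v j x); lra.
move=> _ _; rewrite integral0 => /fine_cvg; apply.
Qed.

(** The series of the integrands has a finite integral, hence is finite almost everywhere, and its
    terms tend to 0 there. *)
Lemma dist_fast_ae (u : X -> \bar R) (v : nat -> X -> \bar R) : tame u -> (forall j, tame (v j)) ->
  (forall j, dist u (v j) < 1 / (2 ^ j.+1)%:R) ->
  {ae lam, forall x : B, O x -> v ^~ x @ \oo --> u x}.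
Proof.
move=> tu tv hd; apply: ae_lam.
pose f j (x : B) : \bar R := (`|contract (u x) - contract (v j x)|)%:E.
have f0 j x : (0 <= f j x)%E by rewrite lee_fin.
have mf j : measurable_fun (O : set B) (f j) by apply/measurable_EFinP; exact: tame_diff_measurable.
have int : nu.-integrable (O : set B) (fun x => \sum_(j <oo) f j x)%E.
  apply/integrableP; split.
    by apply: ge0_emeasurable_sum => // j x _ _; exact: f0.
  under eq_integral do rewrite gee0_abs ?nneseries_ge0 //.
  rewrite integral_nneseries //.
  apply: le_lt_trans (ltry 1); apply: le_trans (epsilon_trick0 xpredT ler01).
  apply: lee_nneseries => [j _ _|j _]; first exact: integral_ge0.
  rewrite -[leLHS]fineK; first by rewrite lee_fin ltW // hd.
  exact: integrable_fin_num (tame_integrable tu (tv j)).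
have := integrable_ae mO int; apply: filterS => x hx Ox.
have fin := hx Ox.
apply/contract_cvg.
pose a j : R := `|contract (u x) - contract (v j x)|.
apply: (@cvg_series_cvg_0 _ _ a).
apply: nondecreasing_is_cvgn.
  by apply: nondecreasing_series => j _ _; exact: normr_ge0.
exists (fine (\sum_(j <oo) f j x)%E) => _ [m _ <-].
rewrite -lee_fin fineK // /series /= -sumEFin.
by apply: (nneseries_lim_ge (u_ := f ^~ x) (P := xpredT) m) => j _.
Qed.

Lemma tame_ae_fin u : tame u -> {ae lam, forall x : B, O x -> u x \is a fin_num}.
Proof.
move=> [_ upoo um]; apply: negligibleS um => x /= /not_implyP[Ox].
rewrite fin_numE (upoo _ Ox) andbT => /negP; rewrite negbK => /eqP ->.
by split.
Qed.

End Metric.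

(** * A countable dense family of classical solutions *)

Section Separability.
Context {R : realType} {n : nat}.
Local Notation X := 'rV[R]_n.
Local Notation B := (borelRn R n).
Variables (lam nu : {measure set B -> \bar R}).
Hypothesis hlam : is_lebesgue lam.
Hypothesis nufin : (nu setT < +oo)%E.
Hypothesis lamnu : forall A, measurable A -> lam A = 0%E -> nu A = 0%E.
Hypothesis nulam : forall A, measurable A -> nu A = 0%E -> lam A = 0%E.
Variable O : set X.
Hypothesis oO : open O.
Let mO : measurable (O : set B) := open_borel oO.
Local Notation sol := (sol O).
Local Notation I_ := (I_ lam).
Local Notation tame := (tame lam O).
Local Notation dist := (dist nu O).
Local Notation "s %:EF" := (fun x => (s x)%:E) (at level 2, format "s %:EF").

Lemma sol_tame s : sol s -> tame s%:EF.
Proof.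
move=> [[cs _ _] _]; split => //.
- move=> x Ox a; rewrite lte_fin => sa.
  exists (s @^-1` [set r | r < a]).
    by apply: (cs x Ox); apply: open_nbhs_nbhs; split => //; exact: open_lt.
  by move=> y ya _; rewrite lte_fin.
- rewrite (_ : [set x | _] = set0); first exact: negligible_set0.
  by apply/seteqP; split => // x [].
Qed.

Lemma sol_cst c : sol (fun=> c).
Proof.
have pd (b : R) i : pderiv (fun=> b) i = (fun=> 0 : R) :> (X -> R).
  by apply/funext => x; exact: derive_cst.
have pd2 i j : pderiv (pderiv (fun=> c) i) j = (fun=> 0 : R) :> (X -> R) by rewrite !pd.
split; first split.
- by move=> x _; exact: cst_continuous.
- by move=> i x _; split; [exact: derivable_cst | rewrite pd; exact: cst_continuous].
- by move=> i j x _; rewrite pd2 pd; split; [exact: derivable_cst | exact: cst_continuous].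
move=> x _; rewrite /H1; apply: sumr_ge0 => i _.
rewrite (_ : (fun y => _) = (fun=> 0 : R)) ?pd // .
by apply/funext => y; rewrite mul0r.
Qed.

(* Otherwise two sequences of solutions converge to [u] so fast that they converge almost
   everywhere, and [I_cvg] is contradicted. *)
Lemma I_near u phi : tame u -> Cc O phi -> forall e, 0 < e -> exists2 r, 0 < r &
  forall s t, sol s -> sol t -> dist u s%:EF < r -> dist u t%:EF < r -> `|I_ s phi - I_ t phi| < e.
Proof.
move=> tu Op e e0; apply: contrapT => h.
have /choice[st hst] : forall j : nat, exists st : (X -> R) * (X -> R),
    [/\ sol st.1, sol st.2, dist u st.1%:EF < 1 / (2 ^ j.+1)%:R,
        dist u st.2%:EF < 1 / (2 ^ j.+1)%:R & ~ (`|I_ st.1 phi - I_ st.2 phi| < e)].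
  move=> j; apply: contrapT => hj; apply: h; exists (1 / (2 ^ j.+1)%:R).
    by rewrite divr_gt0 // ltr0n expn_gt0.
  move=> s t ss sT us ut; apply: contrapT => hs; apply: hj.
  by exists (s, t); exact: And5 ss sT us ut hs.
pose s_ j := (st j).1; pose t_ j := (st j).2.
have ss j : sol (s_ j) := let: And5 h _ _ _ _ := hst j in h.
have sT j : sol (t_ j) := let: And5 _ h _ _ _ := hst j in h.
have as_ := dist_fast_ae nufin nulam oO tu (v := fun j => (s_ j)%:EF)
  (fun j => sol_tame (ss j)) (fun j => let: And5 _ _ h _ _ := hst j in h).
have at_ := dist_fast_ae nufin nulam oO tu (v := fun j => (t_ j)%:EF)
  (fun j => sol_tame (sT j)) (fun j => let: And5 _ _ _ h _ := hst j in h).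
have : {ae lam, forall x : B, O x -> (fun j => s_ j x - t_ j x) @ \oo --> 0}.
  have afin := tame_ae_fin tu.
  move: as_ at_ afin; apply: filterS3 => x hs ht hf Ox.
  have := hf Ox; case E : (u x) (hs Ox) (ht Ox) => [l| |] // hs' ht' _.
  rewrite -(subrr l); apply: cvgB; first exact: (fine_cvg hs').
  exact: (fine_cvg ht').
move=> /(I_cvg hlam oO ss sT) /(_ _ Op) /cvgrPdist_lt/(_ e e0)[N _ hN].
have := hN N (leqnn N); rewrite sub0r normrN => hlt.
exact: (let: And5 _ _ _ _ h := hst N in h) hlt.
Qed.

Lemma dist_refl u : dist u u = 0.
Proof.
rewrite /dist (_ : (fun x => _) = fun=> 0 : R); last by apply/funext => x; rewrite subrr normr0.
by rewrite Rintegral_cst // mul0r.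
Qed.

(** Two values of [contract] differ by at most 2, which is the price on the part of [O] outside
    [A]. *)
Lemma dist_split u v (A : set B) (a : R) : tame u -> tame v -> measurable A -> 0 <= a ->
  (forall x, O x -> A x -> `|contract (u x) - contract (v x)| <= a) ->
  dist u v <= a * fine (nu setT) + 2 * fine (nu (O `\` A)).
Proof.
move=> tu tv mA a0 h.
have nufinA (D : set B) : measurable D -> (nu D < +oo)%E.
  by move=> mD; apply: le_lt_trans nufin; apply: le_measure; rewrite ?inE.
have mOA := measurableI _ _ mO mA; have mDA := measurableD mO mA.
have intO := tame_integrable nufin oO tu tv.
have cint (D : set B) (b : R) : measurable D -> nu.-integrable D (EFin \o (cst b)).
  move=> mD; apply: measurable_bounded_integrable => //; first exact: nufinA.
  by exists `|b|; split; [exact: num_real | move=> M bM y _; exact: ltW].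
have E : O = (O `&` A) `|` (O `\` A) :> set B by rewrite setUIDK.
rewrite /dist E Rintegral_setU //; [|by rewrite -E|]; last first.
  by apply/disj_setPS => x [[_ ?] [_ ?]].
have i1 := integrableS mO mOA (@subIsetl _ O A) intO.
have i2 := integrableS mO mDA (@subDsetl _ O A) intO.
apply: lerD.
  apply: le_trans (le_Rintegral mOA i1 (cint _ a mOA) _) _; first by move=> x [Ox Ax]; exact: h.
  rewrite Rintegral_cst // ler_wpM2l // fine_le ?ge0_fin_numE ?nufinA //.
  by apply: le_measure; rewrite ?inE.
apply: le_trans (le_Rintegral mDA i2 (cint _ 2 mDA) _) _.
  move=> x _; apply: le_trans (ler_normB _ _) _.
  by have := contract_le1 (u x); have := contract_le1 (v x); lra.
by rewrite -E Rintegral_cst.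
Qed.

Definition rat_row (q : 'rV[rat]_n) : X := map_mx ratr q.

(* A code [(L, m)] prescribes, up to [1 / (m + 1)], the value of a function on each rational
   ball of the finite list [L] of triples (centre, radius, value). *)
Definition fits (s : X -> R) (m : nat) (p : 'rV[rat]_n * rat * rat) : Prop :=
  forall x, O x -> `|x - rat_row p.1.1| < ratr p.1.2 ->
    `|contract (s x)%:E - ratr p.2| <= m.+1%:R^-1.

Definition fitting (c : seq ('rV[rat]_n * rat * rat) * nat) : set (X -> R) :=
  [set s | sol s /\ forall p, p \in c.1 -> fits s c.2 p].

Definition rat_ball (p : 'rV[rat]_n * rat * rat) : set X :=
  [set x | `|x - rat_row p.1.1| < ratr p.1.2].

Lemma rat_ball_open p : open (rat_ball p).
Proof.
have -> : rat_ball p = ball (rat_row p.1.1) (ratr p.1.2).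
  by apply/seteqP; split => x; rewrite -ball_normE /ball_ /= distrC.
exact: ball_open.
Qed.

(** Half of the tolerance goes to the rational approximation of the value at [x], half to the
    oscillation of [contract (s y)] on the ball of radius [d]. A centre within [d / 4] of [x] and a
    radius between [d / 4] and [d / 2] keep the rational ball inside that one and around [x]. *)
Lemma fits_cover s m x : sol s -> O x -> exists2 p, fits s m p & rat_ball p x.
Proof.
move=> [[cs _ _] _] Ox; set e : R := m.+1%:R^-1 / 2.
have e0 : 0 < e by rewrite divr_gt0 // invr_gt0.
have : \forall y \near x, ball (s x)%:E e (s y)%:E.
  have : (fun y => (s y)%:E) @ x --> (s x)%:E.
    apply: (@cvg_EFin R X (nbhs x) _ (fun y => (s y)%:E) (s x)); last exact: (cs x Ox).
    exact: nearW.
  by move=> /cvg_ball; exact.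
move=> /nbhs_ballP[d /= d0 hd].
have d4 : 0 < d / 4 by rewrite divr_gt0.
have [v /andP[v1 v2]] := rat_approxr (contract (s x)%:E) e0.
have [r /andP[r1 r2]] := rat_approxr (d / 4) d4.
have /choice[q hq] : forall i, exists q : rat, coord x i < ratr q < coord x i + d / 4.
  by move=> i; exact: rat_approxr.
have xq : `|x - rat_row (\row_i q i)| < d / 4.
  apply/norm_lt_coord => // i; rewrite /coord !mxE.
  by have /andP[] := hq i; rewrite ltr_norml /coord => h1 h2; apply/andP; split; lra.
exists (\row_i q i, r, v); last by rewrite /rat_ball /=; exact: lt_trans r1.
move=> y Oy /= yq.
suff: `|contract (s y)%:E - ratr v| <= m.+1%:R^-1 by [].
have : `|contract (s x)%:E - contract (s y)%:E| < e.
  apply: hd; rewrite -ball_normE /ball_ /=.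
  rewrite -[x - y](subrKA (rat_row (\row_i q i))) (le_lt_trans (ler_normD _ _)) //.
  by rewrite (distrC _ y); lra.
move: (contract (s x)%:E) (contract (s y)%:E) v1 v2 => a b v1 v2.
have -> : m.+1%:R^-1 = 2 * e by rewrite /e mulrC divfK.
rewrite ltr_norml ler_norml => /andP[h1 h2]; apply/andP; split; lra.
Qed.

(** One solution is selected for each code that some solution fits, so the family consists of
    solutions by construction; a constant solution fills the other indices. *)
Definition sample (k : nat) : X -> R :=
  if unpickle k is Some c then xget (fun=> 0) (fitting c) else fun=> 0.

Lemma sample_sol k : sol (sample k).
Proof.
rewrite /sample; case: unpickle => [c|]; last exact: sol_cst.
by case: xgetP => [_ -> []//|_]; exact: sol_cst.
Qed.

(** Countably many rational balls fitting [s] cover [O], and finitely many of them cover it up to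
    [nu]-measure [e / 4]. The solution selected for their code is within [2 / (m + 1)] of [s] on
    these balls, after [contract]. The two parts contribute less than [e / 2] each. *)
Lemma sample_dense s e : sol s -> 0 < e -> exists k, dist s%:EF (sample k)%:EF < e.
Proof.
move=> ss e0; have ts := sol_tame ss.
have V0 : 0 <= fine (nu setT) by rewrite fine_ge0.
have [m hm] : exists m : nat, 2 * m.+1%:R^-1 * fine (nu setT) < e / 2.
  have d0 : 0 < e / 2 / (2 * (fine (nu setT) + 1)).
    by rewrite divr_gt0 // ?divr_gt0 // mulr_gt0 // ltr_wpDl.
  have [m _ hm] := inv_small d0; exists m.
  have := hm m (leqnn m); rewrite /= ltr_pdivlMr; last by rewrite mulr_gt0 // ltr_wpDl.
  have : 0 < m.+1%:R^-1 :> R by rewrite invr_gt0.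
  by move: (m.+1%:R^-1) => z z0 hz; apply: le_lt_trans hz; nra.
pose F (k : nat) : set B := if unpickle k is Some p then
   (if pselect (fits s m p) then rat_ball p else set0) else set0.
have mF k : measurable (F k).
  rewrite /F; case: unpickle => [p|]; last exact: measurable0.
  case: pselect => a /=; last exact: measurable0.
  by apply: open_borel; exact: rat_ball_open.
pose G (K : nat) : set B := \big[setU/set0]_(k < K) F k.
have mG K : measurable (G K) by exact: bigsetU_measurable.
have capG : \bigcap_K (O `\` G K) = set0 :> set B.
  apply/seteqP; split => // x hx; have [Ox _] := hx 0%N I.
  have [p fp px] := fits_cover m ss Ox.
  have [_] := hx (pickle p).+1 I; apply.
  rewrite /G -bigcup_mkord; exists (pickle p) => //=.
  by rewrite /F pickleK; case: pselect.
have : (fun K => nu (O `\` G K)) @ \oo --> (0%E : \bar R).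
  rewrite -(measure0 nu) -capG; apply: nonincreasing_cvg_mu.
  - by apply: le_lt_trans nufin; apply: le_measure; rewrite ?inE //; exact: measurableD.
  - by move=> K; exact: measurableD.
  - by rewrite capG.
  - apply/nonincreasing_seqP => K; apply/subsetPset => x [Ox nx]; split => // Gx; apply: nx.
    by rewrite /G big_ord_recr /=; left.
move=> /fine_cvg /cvgrPdist_lt /(_ (e / 4)) []; first by rewrite divr_gt0.
move=> K _ /(_ K (leqnn K)); rewrite /= sub0r normrN ger0_norm ?fine_ge0 // => hK.
pose good k := if unpickle k is Some p then
   (if pselect (fits s m p) then Some p else None) else None.
pose c := (pmap good (iota 0 K), m).
exists (pickle c).
have cs : fitting c s.
  split => // p; rewrite mem_pmap => /mapP[k _]; rewrite /good.
  by case: unpickle => // p'; case: pselect => // fp [->].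
have [sc fc] : fitting c (sample (pickle c)).
  by rewrite /sample pickleK; case: xgetP => [_ -> //|h]; have := h s.
apply: le_lt_trans (@dist_split _ _ (G K) (2 * m.+1%:R^-1) ts (sol_tame sc) (mG K) _ _) _.
- by rewrite mulr_ge0 // invr_ge0.
- move=> x Ox; rewrite /G -bigcup_mkord => -[k /= kK].
  rewrite /F; case E : (unpickle k) => [p|//]; case: pselect => // fp px.
  have pc : p \in c.1.
    rewrite mem_pmap; apply/mapP; exists k; first by rewrite mem_iota.
    by rewrite /good E; case: pselect.
  have h1 := fc p pc x Ox px; have h2 := fp x Ox px.
  apply: le_trans (_ : m.+1%:R^-1 + m.+1%:R^-1 <= _); last by rewrite mulrDl mul1r.
  by apply: le_trans (ler_distD (ratr p.2) _ _) _; apply: lerD h2 _; rewrite distrC.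
- by apply: (@lt_le_trans _ _ (e / 2 + 2 * (e / 4))); [rewrite ltrD // ltr_pM2l | lra].
Qed.

End Separability.

(** * Extension of the curvature integrals to tame functions *)

Section Functional.
Context {R : realType} {n : nat}.
Local Notation X := 'rV[R]_n.
Local Notation B := (borelRn R n).
Variable lam : {measure set B -> \bar R}.
Hypothesis hlam : is_lebesgue lam.
Variable O : set X.
Hypothesis oO : open O.
Local Notation sol := (sol O).
Local Notation I_ := (I_ lam).
Local Notation tame := (tame lam O).
Local Notation "s %:EF" := (fun x => (s x)%:E) (at level 2, format "s %:EF").

Lemma curvature_functional : exists ell : (X -> \bar R) -> (X -> R) -> R,
  [/\ forall u, tame u -> [/\ forall f g, Cc O f -> Cc O g -> ell u (fun x => f x + g x) = ell u f + ell u g,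
        forall a f, Cc O f -> ell u (fun x => a * f x) = a * ell u f
      & forall f, Cc O f -> (forall x, 0 <= f x) -> 0 <= ell u f],
    forall s, sol s -> forall f, Cc O f -> ell s%:EF f = I_ s f
  & forall u (v : nat -> X -> \bar R), tame u -> (forall j, tame (v j)) ->
      {ae lam, forall x : B, O x -> v ^~ x @ \oo --> u x} ->
      forall f, Cc O f -> (fun j => ell (v j) f) @ \oo --> ell u f].
Proof.
have [nu [nufin lamnu nulam]] := equivalent_finite_measure hlam.
(* The triangle inequality for [dist] rests on integrability, so the extension takes place on the
   subtype of tame functions. *)
pose U := {u : X -> \bar R | tame u}.
pose d (u v : U) := dist nu O (sval u) (sval v).
pose q := sample O.
have qs k : sol (q k) := sample_sol O k.
pose sq k : U := exist _ _ (sol_tame lam (qs k)).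
have d0 u v : 0 <= d u v by exact: dist_ge0.
have ds u v : d u v = d v u by exact: dist_sym.
have dt u v w : d u w <= d u v + d v w := dist_tri nufin oO (svalP u) (svalP v) (svalP w).
pose F f k := I_ (q k) f.
(* [mass_bound] is uniform over all solutions, hence over the samples. *)
have bF f : Cc O f -> bounded_seq (F f).
  move=> Of; have [M _ hM] := Cc_bounded Of; have [_ [K [cK KO fK]]] := Of.
  have [C _ hC] := mass_bound hlam oO cK KO.
  by exists (M * C) => k; exact: hC (qs k) Of fK hM.
have cF f u : Cc O f -> cauchy_near d sq (F f) u.
  move=> Of e e0; have [r r0 hr] := I_near hlam nufin nulam oO (svalP u) Of e0.
  by exists r => // k l hk hl; exact: hr (qs k) (qs l) hk hl.
(* The default 0 makes [ell] total; proof irrelevance makes its value independent of the proof of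
   tameness. *)
pose ell (u : X -> \bar R) f : R := if pselect (tame u) is left h then ext d sq (F f) (exist _ u h) else 0.
have ellE u f (h : tame u) : ell u f = ext d sq (F f) (exist _ u h).
  by rewrite /ell; case: pselect => // h'; rewrite (Prop_irrelevance h' h).
exists ell; split.
- move=> u tu; split.
  + move=> f g Of Og; rewrite !(ellE _ _ tu) -(extD d0 (bF _ Of) (bF _ Og) (cF _ _ Of) (cF _ _ Og)).
    by congr (ext d sq _ _); apply/funext => k; exact: (I_D hlam oO (qs k) Of Og).
  + move=> a f Of; rewrite !(ellE _ _ tu) -(extZ d0 a (bF _ Of) (cF _ _ Of)).
    by congr (ext d sq _ _); apply/funext => k; exact: (I_Z hlam oO a (qs k) Of).
  + move=> f Of f0; rewrite (ellE _ _ tu); apply: (ext_ge0 d0 (bF _ Of) (cF _ _ Of)) => k.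
    exact: I_ge0 (qs k) Of f0.
- move=> s ss f Of; have ts := sol_tame lam ss; rewrite (ellE _ _ ts).
  set u : U := exist _ _ ts.
  (* A solution is a limit of samples, so its value is a limit of sample integrals, and [I_near]
     identifies it with its own integral. *)
  have D0 : dist_to d sq u = 0.
    apply/eqP; rewrite eq_le (dist_to_ge0 _ d0) andbT; apply/ler_addgt0Pr => e e0; rewrite add0r.
    have [k hk] := sample_dense lam nufin oO ss e0.
    by apply: le_trans (ltW hk); exact: (dist_to_le _ d0 u k).
  apply/eqP; rewrite -subr_eq0 -normr_eq0 eq_le normr_ge0 andbT.
  apply/ler_addgt0Pr => e e0; rewrite add0r.
  have [r r0 hr] := I_near hlam nufin nulam oO ts Of e0.
  apply: (ext_near d0 (bF _ Of) (fun=> cF _ _ Of) r0) => k; rewrite D0 mulr0 add0r => hk.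
  by apply: ltW; apply: (hr _ _ (qs k) ss hk); rewrite dist_refl.
- move=> u v tu tv uv f Of; rewrite (ellE _ _ tu).
  rewrite (_ : (fun j => ell (v j) f) = fun j => ext d sq (F f) (exist _ (v j) (tv j))); last first.
    by apply/funext => j; exact: ellE.
  apply: (ext_cvg d0 ds dt (bF _ Of) (cF _ _ Of) (fun j => cF _ _ Of)).
  exact: (dist_cvg nufin lamnu oO tu tv uv).
Qed.

Lemma SH1_tame u : SH1 lam O u -> tame u.
Proof. by case. Qed.

End Functional.

(** * Curvature densities of C^2 functions *)

Section Density.
Import HBNNSimple.
Local Open Scope ereal_scope.
Context d (T : measurableType d) (R : realType).
Variables (mu rho : {measure set T -> \bar R}) (g : T -> \bar R).
Hypothesis mg : measurable_fun setT g.
Hypothesis g0 : forall x, 0 <= g x.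
Hypothesis gfin : forall x, g x \is a fin_num.
Hypothesis rhoE : forall A, measurable A -> rho A = \int[mu]_(x in A) g x.

Lemma integral_density_nnsfun (h : {nnsfun T >-> R}) :
  \int[rho]_x (h x)%:E = \int[mu]_x ((h x)%:E * g x).
Proof.
rewrite integralT_nnsfun sintegralE.
transitivity (\int[mu]_x (\sum_(y \in range h) ((y * \1_(h @^-1` [set y]) x)%:E * g x))).
  rewrite ge0_integral_fsum //; last 2 first.
  - move=> y; apply: emeasurable_funM => //; apply/measurable_EFinP.
    by apply: measurable_funM => //; exact: measurable_indic.
  - by move=> y x _; rewrite mule_ge0 // nnfun_muleindic_ge0.
  apply: eq_fsbigr => y; rewrite inE => -[t _ <-].
  under eq_integral do rewrite EFinM -muleA.
  rewrite ge0_integralZl //; last first.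
  - by rewrite lee_fin.
  - by move=> x _; rewrite mule_ge0 // lee_fin indicE.
  - by apply: emeasurable_funM => //; apply/measurable_EFinP; exact: measurable_indic.
  congr (_ * _); rewrite rhoE // integral_mkcond; apply: eq_integral => x _.
  by rewrite epatch_indic muleC.
apply: eq_integral => x _.
rewrite -ge0_mule_fsuml => [|y]; last exact: nnfun_muleindic_ge0.
by rewrite fsumEFin // -(fimfunE _ x).
Qed.

Lemma integral_density (f : T -> \bar R) : measurable_fun setT f -> (forall x, 0 <= f x) ->
  \int[rho]_x f x = \int[mu]_x (f x * g x).
Proof.
move=> mf f0; pose h := nnsfun_approx measurableT mf.
have hf x : (EFin \o h k) x @[k --> \oo] --> f x by exact: cvg_nnsfun_approx.
have hnd x a b : (a <= b)%N -> (h a x <= h b x)%R by move=> ab; exact/lefP/nd_nnsfun_approx.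
transitivity (lim (\int[rho]_x (EFin \o h k) x @[k --> \oo])).
  rewrite -monotone_convergence //.
  - by apply: eq_integral => x _; apply/esym/cvg_lim => //; exact: hf.
  - by move=> k; apply/measurable_EFinP.
  - by move=> k x _; rewrite lee_fin.
  - by move=> x _ a b ab; rewrite lee_fin; exact: hnd.
rewrite (_ : (fun k => _) = fun k => \int[mu]_x ((h k x)%:E * g x)); last first.
  by apply/funext => k; exact: integral_density_nnsfun.
rewrite -monotone_convergence //.
- by apply: eq_integral => x _; apply/cvg_lim => //; apply: cvgeZr => //; exact: hf.
- by move=> k; apply: emeasurable_funM => //; apply/measurable_EFinP.
- by move=> k x _; rewrite mule_ge0 // lee_fin.
- by move=> x _ a b ab; rewrite lee_wpmul2r // lee_fin; exact: hnd.
Qed.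

End Density.

Section CurvatureDensity.
Context {R : realType} {n : nat}.
Local Notation X := 'rV[R]_n.
Local Notation B := (borelRn R n).
Variable lam : {measure set B -> \bar R}.
Hypothesis hlam : is_lebesgue lam.
Variable O : set X.
Hypothesis oO : open O.
Let mO : measurable (O : set B) := open_borel oO.

Lemma cts_on_measurable (f : X -> R) : (forall x, O x -> {for x, continuous f}) ->
  measurable_fun (O : set B) (f : B -> R).
Proof.
move=> cf; apply: (measurability _ (RGenInftyO.measurableE R)).
move=> _ [_ [a ->] <-]; apply: open_borel.
rewrite openE => x [Ox]; rewrite /= in_itv /= => xa.
apply: filterI; first exact: open_nbhs_nbhs.
by apply: (cf x Ox); apply: open_nbhs_nbhs; split => //; rewrite set_itvNyo; exact: open_lt.
Qed.

(** In the C^2 case this measure serves as [mu1 u], which makes the formula on Borel sets immediate.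
    Compact sets have finite measure because [rho K] is at most the integral of a cut-off, that is
    [I_ lam v eta]. *)
Lemma density_measure (v : X -> R) : sol O v -> exists rho : {measure set B -> \bar R},
  [/\ radon_on O rho,
      forall A : set B, measurable A -> A `<=` (O : set B) -> rho A = (\int[lam]_(x in A) (H1 v x)%:E)%E
    & forall f, Cc O f -> (\int[rho]_(x in O) (f x)%:E = (I_ lam v f)%:E)%E].
Proof.
move=> sv; have [cv v0] := sv.
(* Extended by zero, since neither the sign nor the measurability of [H1 v] is known outside [O]. *)
pose g : B -> \bar R := (fun x : B => (H1 v x)%:E) \_ (O : set B).
have gE x : O x -> g x = (H1 v x)%:E by move=> Ox; rewrite /g patchE mem_set.
have gN x : ~ O x -> g x = 0%E by move=> Ox; rewrite /g patchE memNset.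
have g0 x : (0 <= g x)%E.
  by have [Ox|Ox] := pselect (O x); [rewrite gE // lee_fin v0 | rewrite gN].
have gfin x : g x \is a fin_num.
  by have [Ox|Ox] := pselect (O x); [rewrite gE | rewrite gN].
have mg : measurable_fun setT g.
  apply: (iffLR (measurable_restrictT _ mO)); apply/measurable_EFinP; apply: cts_on_measurable.
  by move=> x Ox; exact: cts_H1 oO cv Ox.
pose r (A : set B) := (\int[lam]_(x in A) g x)%E.
have r0 : r set0 = 0%E by exact: integral_set0.
have rge0 A : (0 <= r A)%E by exact: integral_ge0.
pose rho : {measure set B -> \bar R} :=
  HB.pack r (isMeasure.Build _ B R r r0 rge0 (semi_sigma_additive_nng_induced mg g0)).
have rhoE (A : set B) : rho A = (\int[lam]_(x in A) g x)%E by [].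
have ICc f : Cc O f -> (forall x, 0 <= f x) ->
    (\int[rho]_x (f x)%:E = (I_ lam v f)%:E)%E.
  move=> Of f0; rewrite (@integral_density _ B R lam rho g) //; last first.
    by apply/measurable_EFinP; apply: continuous_borel; case: Of.
  rewrite /I_ /J /Rintegral fineK; last first.
    have h := Cc_integrable hlam (Cc_H1 oO sv Of).
    exact: (integrable_fin_num measurableT h).
  apply: eq_integral => x _; have [Ox|Ox] := pselect (O x); first by rewrite gE // EFinM.
  have [fx|//] := Cc_zero_or x Of; rewrite gN // fx mule0.
  by move: (H1 v x) => z; rewrite mul0r.
have radon : radon_on O rho.
  split; first by rewrite rhoE; apply: integral0_eq => x; exact: gN.
  move=> K cK KO; have [e [L [eta [e0 _ Oeta _ [eta01 etaK]]]]] := nbhd_cutoff oO cK KO.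
  have mK := compact_borel cK.
  rewrite -[rho K]mul1e -integral_cst //.
  apply: (@le_lt_trans _ _ (\int[rho]_x (eta x)%:E)%E); last first.
    by rewrite ICc ?ltry // => x; case/andP: (eta01 x).
  apply: (@le_trans _ _ (\int[rho]_(x in K) (eta x)%:E)%E).
    rewrite le_eqVlt; apply/orP; left; apply/eqP; apply: eq_integral => x; rewrite inE => Kx.
    by rewrite (etaK x x) // subrr normr0 ltW.
  apply: ge0_subset_integral => //.
    by apply/measurable_EFinP; apply: continuous_borel; case: Oeta.
  by move=> x _; rewrite lee_fin; case/andP: (eta01 x).
exists rho; split => //.
- by move=> A mA AO; rewrite rhoE; apply: eq_integral => x; rewrite inE => /AO /gE.
move=> f Of.
have Ofp := Cc_pos Of; have Ofn := Cc_neg Of.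
have -> : (\int[rho]_(x in O) (f x)%:E = \int[rho]_x (f x)%:E)%E.
  rewrite integral_mkcond; apply: eq_integral => x _; rewrite patchE.
  case: ifPn => //; rewrite notin_setE => Ox.
  by have [->|] := Cc_zero_or x Of.
under eq_integral do rewrite [f _]pos_neg_part EFinB.
rewrite integralB //; [|exact: Cc_integrable_radon radon Ofp|exact: Cc_integrable_radon radon Ofn].
rewrite !ICc //; [|by move=> x; rewrite le_max lexx orbT..].
by rewrite -EFinB -(I_pos_neg hlam oO sv Of).
Qed.

End CurvatureDensity.

(** * Nonnegative curvature of C^2 subharmonic functions *)

Section Comparison.
Context {R : realType} {n : nat}.
Local Notation X := 'rV[R]_n.
Local Notation B := (borelRn R n).

Lemma coord_is_derive (k i : 'I_n) (x : X) (c : R) :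
  is_derive x (evec R i) (fun y => coord y k - c) (k == i)%:R.
Proof.
have h : (fun t : R => t^-1 *: (((fun y => coord y k - c) \o shift x) (t *: evec R i) - (coord x k - c)))
    @ 0^' --> ((k == i)%:R : R).
  apply: cvg_near_cst; apply: filterS (nbhs_dnbhs_neq (0 : R)) => t t0.
  rewrite /= /coord /evec !mxE eqxx /= eq_sym.
  rewrite (_ : _ - _ - _ = t * (i == k)%:R) ?scalerA ?mulVf ?scale1r //; last by ring.
by split; [apply/cvg_ex; exists (k == i)%:R | exact: cvg_lim].
Qed.

Section Paraboloid.
Variables (O : set X) (v : X -> R) (x0 : X) (e c : R).
Hypothesis oO : open O.
Hypothesis cv : C2_on O v.

(* On the boundary of a sup-norm ball of radius [sqrt c] about [x0] the added term is nonnegative,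
   at [x0] it is negative. *)
Definition add_paraboloid (y : X) : R := v y + e * (\sum_(k < n) (coord y k - coord x0 k) ^+ 2 - c).

Lemma is_derive_paraboloid i x : O x ->
  is_derive x (evec R i) add_paraboloid (pderiv v i x + 2 * e * (coord x i - coord x0 i)).
Proof.
move=> Ox; apply: is_derive_add.
  by apply: DeriveDef => //; case: cv => _ /(_ i x Ox) [].
have := is_derive_sub (is_derive_bigsum (fun k =>
    is_derive_mul (coord_is_derive k i x (coord x0 k)) (coord_is_derive k i x (coord x0 k))))
  (@is_derive_cst _ _ _ c x (evec R i)).
move=> /(is_derive_mul (@is_derive_cst _ _ _ e x (evec R i))) => h.
have -> : 2 * e * (coord x i - coord x0 i) =
  e * ((\sum_(k < n) ((coord x k - coord x0 k) * (k == i)%:R + (coord x k - coord x0 k) * (k == i)%:R)) - 0)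
   + ((\sum_(k < n) ((coord x k - coord x0 k) * (coord x k - coord x0 k))) - c) * 0.
  rewrite (bigD1 i) //= big1 ?eqxx => [|k /negbTE ->]; last by rewrite !mulr0 addr0.
  by rewrite (_ : true%:R = 1) //; ring.
exact: h.
Qed.

Lemma pderiv_paraboloid i x : O x ->
  pderiv add_paraboloid i x = pderiv v i x + 2 * e * (coord x i - coord x0 i).
Proof. by move=> Ox; have [_] := is_derive_paraboloid i Ox. Qed.

Lemma is_derive2_paraboloid i j x : O x ->
  is_derive x (evec R j) (pderiv add_paraboloid i)
    (pderiv (pderiv v i) j x + 2 * e * (i == j)%:R).
Proof.
move=> Ox; apply: (near_eq_is_derive (f := fun y => pderiv v i y + 2 * e * (coord y i - coord x0 i))).
  have : nbhs x O by exact: open_nbhs_nbhs.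
  by apply: filterS => y Oy; rewrite pderiv_paraboloid.
apply: is_derive_add.
  by apply: DeriveDef => //; case: cv => _ _ /(_ i j x Ox) [].
have := is_derive_mul (@is_derive_cst _ _ _ (2 * e) x (evec R j)) (coord_is_derive i j x (coord x0 i)).
by rewrite mulr0 addr0.
Qed.

Lemma pderiv2_paraboloid i j x : O x ->
  pderiv (pderiv add_paraboloid i) j x = pderiv (pderiv v i) j x + 2 * e * (i == j)%:R.
Proof. by move=> Ox; have [_] := is_derive2_paraboloid i j Ox. Qed.

Lemma cts_coord_sub (k : 'I_n) x : {for x, continuous (fun y : X => coord y k - coord x0 k)}.
Proof. by apply: (@cvgB _ _ _ (nbhs x)); [exact: coord_cts | exact: cvg_cst]. Qed.

Lemma C2_paraboloid : C2_on O add_paraboloid.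
Proof.
have [c0 c1 c2] := cv; split.
- move=> x Ox; apply: (@cvgD _ _ _ (nbhs x)); first exact: c0.
  apply: cvgMr; apply: cvgB; last exact: cvg_cst.
  apply: (@cvg_bigsum R _ (nbhs x) _ _ _ _ (fun k y => (coord y k - coord x0 k) ^+ 2)) => k.
  by apply: cvgM; exact: cts_coord_sub.
- move=> i x Ox; split; first by case: (is_derive_paraboloid i Ox).
  apply: (cts_eq_open oO Ox (fun y Oy => pderiv_paraboloid i Oy)).
  apply: (@cvgD _ _ _ (nbhs x)); first by case: (c1 i x Ox).
  by apply: cvgMr; exact: cts_coord_sub.
- move=> i j x Ox; split; first by case: (is_derive2_paraboloid i j Ox).
  apply: (cts_eq_open oO Ox (fun y Oy => pderiv2_paraboloid i j Oy)).
  by apply: (@cvgD _ _ _ (nbhs x)); [case: (c2 i j x Ox) | exact: cvg_cst].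
Qed.

End Paraboloid.

Lemma C2_closure_sub (O w : set X) h : C2_on O h -> closure w `<=` O -> C2_closure w h.
Proof.
move=> [c0 c1 c2] wO; have wO' : w `<=` O by apply: subset_trans wO; exact: subset_closure.
have within (f : X -> R) : (forall x, O x -> {for x, continuous f}) -> {within closure w, continuous f}.
  by move=> cf; apply: continuous_in_subspaceT => x; rewrite inE => /wO; exact: cf.
split.
- split; [by move=> x /wO'; exact: c0 | by move=> i x /wO'; exact: c1 | by move=> i j x /wO'; exact: c2].
- exact: within.
- by move=> i; exists (pderiv h i) => //; apply: within => x Ox; case: (c1 i x Ox).
- by move=> i j; exists (pderiv (pderiv h i) j) => //; apply: within => x Ox; case: (c2 i j x Ox).
Qed.

(** Through [DT], the curvature of the perturbed function is a continuous expression in [(e, x)]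
    whose limit at [(0, x0)] is [H1 v x0]. The constant [c] disappears on differentiation, so [d]
    does not depend on it. *)
Lemma H1_paraboloid_lt0 (O : set X) (v : X -> R) (x0 : X) : open O -> C2_on O v -> O x0 ->
  H1 v x0 < 0 -> exists2 d, 0 < d & forall e c x, 0 < e < d -> `|x - x0| < d -> O x ->
    H1 (add_paraboloid v x0 e c) x < 0.
Proof.
move=> oO cv Ox0 v0; pose F := filter_prod (nbhs (0 : R)) (nbhs x0).
have [_ c1 c2] := cv.
pose p k (t : R * X) := pderiv v k t.2 + 2 * t.1 * (coord t.2 k - coord x0 k).
pose q i k (t : R * X) := pderiv (pderiv v k) i t.2 + 2 * t.1 * (k == i)%:R.
have c2t : (fun t : R * X => 2 * t.1) @ F --> (0 : R).
  by rewrite -(mulr0 (2 : R)); apply: cvgMr; exact: cvg_fst.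
have at2 (f : X -> R) : {for x0, continuous f} -> (fun t : R * X => f t.2) @ F --> f x0.
  by move=> cf; exact: (@cvg_comp _ _ _ snd f F (nbhs x0) _ cvg_snd cf).
have cp k : p k @ F --> pderiv v k x0.
  rewrite -[X in _ --> X]addr0 -[X in _ --> _ + X](mul0r (coord x0 k - coord x0 k)).
  apply: cvgD; first by apply: at2; case: (c1 k x0 Ox0).
  apply: cvgM; first exact: c2t.
  exact: (at2 (fun y => coord y k - coord x0 k) (@cts_coord_sub x0 k x0)).
have cq i k : q i k @ F --> pderiv (pderiv v k) i x0.
  rewrite -[X in _ --> X]addr0 -[X in _ --> _ + X](mul0r ((k == i)%:R : R)).
  apply: cvgD; first by apply: at2; case: (c2 k i x0 Ox0).
  by apply: cvgM; [exact: c2t | exact: cvg_cst].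
have : (fun t => \sum_(i < n) DT (p ^~ t) ((q i) ^~ t) i) @ F --> H1 v x0.
  rewrite (H1E cv Ox0); apply: (@cvg_bigsum R _ F _ _ _ _ (fun i t => DT (p ^~ t) ((q i) ^~ t) i)) => i.
  exact: (@cvg_DT R n _ F _ p (q i) _ _ i cp (cq i)).
move=> /(_ [set r | r < 0]) []; first by apply: open_nbhs_nbhs; split => //; exact: open_lt.
move=> [P Q] /= [/nbhs_ballP[a /= a0 Pa] /nbhs_ballP[b /= b0 Qb]] PQ.
exists (Num.min a b) => [|e c x /andP[e0]]; first by rewrite lt_min a0.
rewrite !lt_min => /andP[ea _] /andP[_ xb] Ox.
have := PQ (e, x) (conj (Pa e _) (Qb x _)).
rewrite /= => h; rewrite (H1E (C2_paraboloid x0 e c oO cv) Ox).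
apply: le_lt_trans (h _ _).
- rewrite le_eqVlt; apply/orP; left; apply/eqP; apply: eq_bigr => i _; congr (DT _ _ i).
    by apply/funext => k; rewrite (pderiv_paraboloid x0 e c cv k Ox).
  by apply/funext => k; rewrite (pderiv2_paraboloid x0 e c oO cv k i Ox).
- by rewrite -ball_normE /ball_ /= sub0r normrN gtr0_norm.
- by rewrite -ball_normE /ball_ /= distrC.
Qed.

(** If [H1 v x0 < 0], the perturbation [h] of [v] is a supersolution on a small ball and lies above
    [v] on its boundary, yet [h x0 = v x0 - e * r ^+ 2], contrary to comparison. *)
Lemma SH1_H1_ge0 (lam : {measure set B -> \bar R}) (O : set X) (u : X -> \bar R) (v : X -> R) :
  open O -> SH1 lam O u -> C2_on O v -> (forall x, O x -> u x = (v x)%:E) ->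
  forall x, O x -> 0 <= H1 v x.
Proof.
move=> oO [_ _ _ cmp] cv uv x0 Ox0; rewrite leNgt; apply/negP => v0.
have [d d0 hd] := H1_paraboloid_lt0 oO cv Ox0 v0.
have [s s0 hs] := openP_ball oO Ox0.
pose r := Num.min d s / 2; pose e := d / 2.
have ds0 : 0 < Num.min d s by rewrite lt_min d0.
have r0 : 0 < r by rewrite divr_gt0.
have rds : r < Num.min d s by rewrite ltr_pdivrMr // ltr_pMr // ltr1n.
have /andP[rd rs] : (r < d) && (r < s) by rewrite -lt_min.
pose w : set X := ball x0 r.
have wE y : w y <-> `|y - x0| < r by rewrite /w -ball_normE /ball_ /= distrC.
have cw : closure w `<=` [set y | `|y - x0| <= r].
  have -> : [set y | `|y - x0| <= r] = closed_ball x0 r.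
    by rewrite closed_ballE //; apply/seteqP; split => y; rewrite /closed_ball_ /= distrC.
  by [].
have wO : closure w `<=` O by move=> y /cw yr; apply: hs; exact: le_lt_trans rs.
have e0 : 0 < e < d by rewrite divr_gt0 //= ltr_pdivrMr // ltr_pMr // ltr1n.
have e00 : 0 < e by case/andP: e0.
pose h := add_paraboloid v x0 e (r ^+ 2).
have : (u x0 <= (h x0)%:E)%E.
  apply: (cmp w h); first exact: ball_open.
  - split => //; apply: bounded_closed_compact; last exact: closed_closure.
    exists (`|x0| + r); split; first exact: num_real.
    move=> M hM y /cw yr; apply: ltW; apply: le_lt_trans hM.
    by rewrite -[y](subrK x0) (le_trans (ler_normD _ _)) // [leRHS]addrC lerD2r.
  - by apply: C2_closure_sub wO; exact: C2_paraboloid.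
  - move=> y wy; have Oy : O y by apply: wO; exact: subset_closure.
    apply: ltW; apply: hd => //; apply: lt_trans rd; exact/wE.
  - move=> y [/wO Oy nwy]; rewrite uv // lee_fin /h /add_paraboloid lerDl mulr_ge0 ?(ltW e00) // subr_ge0.
    have [k hk] : exists k, r <= `|coord (y - x0) k|.
      apply: contrapT => hk; apply: nwy; apply/wE; apply/norm_lt_coord => // k.
      by rewrite ltNge; apply/negP => hrk; apply: hk; exists k.
    rewrite (bigD1 k) //= ler_wpDr ?sumr_ge0 // => [i _|]; first exact: sqr_ge0.
    rewrite -[leRHS]real_normK ?num_real // ler_sqr ?nnegrE ?(ltW r0) //.
    by move: hk; rewrite /coord !mxE.
  - by apply/wE; rewrite subrr normr0.
rewrite uv // lee_fin /h /add_paraboloid big1 => [|k _]; last by rewrite subrr expr0n.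
by rewrite lerDl sub0r mulrN oppr_ge0 leNgt mulr_gt0 // exprn_gt0.
Qed.

End Comparison.

(** * Locality of the curvature operator *)

Section Uniqueness.
Context {R : realType} {n : nat}.
Local Notation X := 'rV[R]_n.
Variables (O : set X) (v w : X -> R).
Hypothesis oO : open O.
Hypothesis cv : C2_on O v.
Hypothesis cw : C2_on O w.
Hypothesis vw : forall x, O x -> v x = w x.

(** A subharmonic function determines a C^2 representative on [O] only, and two representatives may
    differ elsewhere. Derivatives at a point of an open set see only nearby values. *)
Lemma H1_local x : O x -> H1 v x = H1 w x.
Proof.
have p1 i y : O y -> pderiv v i y = pderiv w i y.
  move=> Oy; apply: near_eq_derive; have : nbhs y O by exact: open_nbhs_nbhs.
  by apply: filterS => z; exact: vw.
have p2 i j y : O y -> pderiv (pderiv v i) j y = pderiv (pderiv w i) j y.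
  move=> Oy; apply: near_eq_derive; have : nbhs y O by exact: open_nbhs_nbhs.
  by apply: filterS => z; exact: p1.
move=> Ox; rewrite (H1E cv Ox) (H1E cw Ox); apply: eq_bigr => i _.
have DT_eq (p p' q q' : 'I_n -> R) : p = p' -> q = q' -> DT p q i = DT p' q' i by move=> -> ->.
by apply: DT_eq; apply/funext => k; [exact: p1 | exact: p2].
Qed.

End Uniqueness.

(** * The curvature measures *)

Theorem theorem6p1 (R : realType) (n : nat)
  (lam : {measure set (borelRn R n) -> \bar R}) (hlam : is_lebesgue lam)
  (Omega : set 'rV[R]_n) (hopen : open Omega) (hconn : connected Omega)
  (hne : Omega !=set0) :
  exists mu1 : ('rV[R]_n -> \bar R) -> {measure set (borelRn R n) -> \bar R},
    (forall u, SH1 lam Omega u -> radon_on Omega (mu1 u)) /\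
    (forall (u : 'rV[R]_n -> \bar R) (v : 'rV[R]_n -> R),
        SH1 lam Omega u -> C2_on Omega v -> (forall x, Omega x -> u x = (v x)%:E) ->
        forall A : set (borelRn R n), measurable A -> A `<=` Omega ->
          mu1 u A = (\int[lam]_(x in A) (H1 v x)%:E)%E) /\
    (forall (us : nat -> 'rV[R]_n -> \bar R) (u : 'rV[R]_n -> \bar R),
        (forall j, SH1 lam Omega (us j)) -> SH1 lam Omega u ->
        {ae lam, forall x : borelRn R n, Omega x -> us ^~ x @ \oo --> u x} ->
        weak_cvg Omega (fun j => mu1 (us j)) (mu1 u)).
Proof.
have [ell [ell_lin ell_sol ell_cvg]] := curvature_functional hlam hopen.
have /choice[mu1 hmu] : forall u, exists mu : {measure set (borelRn R n) -> \bar R},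
    SH1 lam Omega u -> [/\ radon_on Omega mu,
      forall v, C2_on Omega v -> (forall x, Omega x -> u x = (v x)%:E) ->
        forall A : set (borelRn R n), measurable A -> A `<=` Omega ->
          mu A = (\int[lam]_(x in A) (H1 v x)%:E)%E
    & forall f, Cc Omega f -> (\int[mu]_(x in Omega) (f x)%:E = (ell u f)%:E)%E].
  (* For functions that are not subharmonic nothing is claimed, and [lam] is a mere default. *)
  move=> u; have [su|nsu] := pselect (SH1 lam Omega u); last by exists lam.
  have tu := SH1_tame su.
  have [[w [cw uw]]|nC2] := pselect (exists w, C2_on Omega w /\ forall x, Omega x -> u x = (w x)%:E).
    have sw : sol Omega w by split => // x; exact: SH1_H1_ge0 hopen su cw uw x.
    have [mu [radon muE muI]] := density_measure hlam hopen sw.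
    exists mu => _; split; [exact: radon | move=> v cv uv A mA AO | move=> f Of].
      have wv y : Omega y -> w y = v y by move=> Oy; apply/EFin_inj; rewrite -uw // uv.
      rewrite (muE A mA AO); apply: eq_integral => x; rewrite inE => /AO Ox.
      by rewrite (H1_local hopen cw cv wv Ox).
    rewrite (muI f Of) -(ell_sol w sw f Of).
    (* [u] and [w] agree only on [Omega], so [ell_sol] gives the value at [w], not at [u].
       Continuity along the constant sequence [w], which converges to [u] on [Omega], identifies the
       two values. *)
    have ae_uw : {ae lam, forall x : borelRn R n, Omega x ->
        (fun j : nat => (w x)%:E) @ \oo --> u x}.
      by apply: aeW => x Ox; rewrite uw //; exact: cvg_cst.
    have h := ell_cvg u (fun _ x => (w x)%:E) tu (fun=> sol_tame lam sw) ae_uw f Of.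
    have h' : (fun j : nat => ell (fun x => (w x)%:E) f) @ \oo --> ell (fun x => (w x)%:E) f.
      exact: cvg_cst.
    by rewrite (cvg_unique _ h' h).
  have [ellD ellZ ell_ge0] := ell_lin u tu.
  have [mu [radon muI]] := riesz_representation hopen ellD ellZ ell_ge0.
  exists mu => _; split; [exact: radon | move=> v cv uv; case: nC2 | exact: muI].
  exact: (ex_intro _ v (conj cv uv)).
exists mu1; split; [|split].
- by move=> u su; have [] := hmu u su.
- by move=> u v su cv uv; have [_ h _] := hmu u su; exact: h.
- move=> us u sus su h f Of.
  have [_ _ ->//] := hmu u su.
  rewrite (_ : (fun j => _) = fun j => (ell (us j) f)%:E); last first.
    by apply/funext => j; have [_ _ ->] := hmu _ (sus j).
  apply: cvg_EFin; first exact: nearW.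
  exact: ell_cvg (SH1_tame su) (fun j => SH1_tame (sus j)) h f Of.
Qed.
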